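(* Suppose that $p=1$ or $p\ge1.5$. (i) Let $(\mathbf P_k)_{k\ge1}$ be a finite sequence of independent, random, positive semidefinite $d\times d$ matrices that satisfy $\mathbb E\|\mathbf P_k\|_{2p}^{2p}<\infty$. Then $$\Big(\mathbb E\Big\|\sum_k\mathbf P_k\Big\|_{2p}^{2p}\Big)^{1/(2p)}\le\Big[\Big\|\sum_k\mathbb E\,\mathbf P_k\Big\|_{2p}^{1/2}+\sqrt{4p-2}\cdot\Big(\sum_k\mathbb E\|\mathbf P_k\|_{2p}^{2p}\Big)^{1/(4p)}\Big]^2.$$ (ii) Let $(\mathbf Y_k)_{k\ge1}$ be a finite sequence of centered, independent, random Hermitian $d\times d$ matrices, and assume that $\mathbb E\|\mathbf Y_k\|_{4p}^{4p}<\infty$. Then $$\Big(\mathbb E\Big\|\sum_k\mathbf Y_k\Big\|_{4p}^{4p}\Big)^{1/(4p)}\le\sqrt{4p-1}\cdot\Big\|\Big(\sum_k\mathbb E\,\mathbf Y_k^2\Big)^{1/2}\Big\|_{4p}+(4p-1)\cdot\Big(\sum_k\mathbb E\|\mathbf Y_k\|_{4p}^{4p}\Big)^{1/(4p)}.$$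
   Context: Matrices are complex; positive semidefinite matrices are Hermitian. For $q\ge1$, the Schatten $q$-norm of a $d\times d$ complex matrix is $\|\mathbf B\|_q=(\mathrm{tr}\,|\mathbf B|^q)^{1/q}$ with $|\mathbf B|=(\mathbf B^*\mathbf B)^{1/2}$. ''Centered'' means $\mathbb E\,\mathbf Y_k=\mathbf 0$. *)

(* Defs.v *)
From HB Require Import structures.
From mathcomp Require Import all_boot all_order all_algebra.
From mathcomp Require Import sesquilinear spectral complex.
From mathcomp Require Import all_classical all_reals all_analysis.

Set Implicit Arguments.
Unset Strict Implicit.
Unset Printing Implicit Defensive.

Import Order.TTheory GRing.Theory Num.Theory.
Import numFieldNormedType.Exports.

Local Open Scope classical_set_scope.
Local Open Scope ring_scope.
Local Open Scope sesquilinear_scope.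

(* In the order of R[i], 0 <= z means that z is real and nonnegative. *)
Definition psdmx (R : realType) (d : nat) (A : 'M[R[i]]_d) : Prop :=
  A \is hermsymmx /\ forall v : 'cV[R[i]]_d, 0 <= (v^t* *m A *m v) 0 0.

(* Functional calculus, meaningful for Hermitian A, whose eigenvalues are real:
   with A = U^-1 diag(l_1, ..., l_d) U the spectral decomposition, this is
   U^-1 diag(f l_1, ..., f l_d) U. *)
Definition hermfun (R : realType) (d : nat) (f : R -> R) (A : 'M[R[i]]_d) :
    'M[R[i]]_d :=
  invmx (spectralmx A)
    *m diag_mx (\row_j (f (complex.Re (spectral_diag A 0 j)))%:C%C)
    *m spectralmx A.

Definition mxsqrt (R : realType) (d : nat) (A : 'M[R[i]]_d) : 'M[R[i]]_d :=
  hermfun Num.sqrt A.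

Definition mxpowR (R : realType) (d : nat) (A : 'M[R[i]]_d) (q : R) :
    'M[R[i]]_d :=
  hermfun (fun x => x `^ q) A.

Definition mxabs (R : realType) (d : nat) (B : 'M[R[i]]_d) : 'M[R[i]]_d :=
  mxsqrt (B^t* *m B).

Definition schatten (R : realType) (d : nat) (q : R) (B : 'M[R[i]]_d) : R :=
  (complex.Re (\tr (mxpowR (mxabs B) q))) `^ q^-1.

(* 'M[R[i]]_d with its Borel sigma-algebra, which is the one generated by the
   real and imaginary parts of the entries. *)
Definition cmx (R : realType) (d : nat) : Type := 'M[R[i]]_d.

Section cmx_measurable.
Context (R : realType) (d : nat).

HB.instance Definition _ := Choice.copy (cmx R d) 'M[R[i]]_d.
HB.instance Definition _ := isPointed.Build (cmx R d) (0 : 'M[R[i]]_d).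

Definition cmx_cylinders : set (set (cmx R d)) :=
  [set A | exists i j (B : set R), measurable B /\
    (A = [set M : 'M[R[i]]_d | B (complex.Re (M i j))] \/
     A = [set M : 'M[R[i]]_d | B (complex.Im (M i j))])].

Fact cmx_measurableC (A : set (cmx R d)) :
  <<s cmx_cylinders >> A -> <<s cmx_cylinders >> (~` A).
Proof. by move=> mA; rewrite -setTD; exact: sigma_algebraCD. Qed.

HB.instance Definition _ := @isMeasurable.Build default_measure_display
  (cmx R d) <<s cmx_cylinders >>
  (@sigma_algebra0 _ setT cmx_cylinders) cmx_measurableC
  (@sigma_algebra_bigcup _ setT cmx_cylinders).

End cmx_measurable.

Section random_matrices.
Context (dT : measure_display) (T : measurableType dT) (R : realType).
Context (P : probability T R).

Definition mutually_independent (dE : measure_display) (E : measurableType dE)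
    (I : finType) (X : I -> {RV P >-> E}) : Prop :=
  forall (J : {set I}) (B : I -> set E), (forall k, measurable (B k)) ->
    (P (\bigcap_(k in [set` J]) (X k @^-1` B k)) =
     \prod_(k in J) P (X k @^-1` B k))%E.

(* Entrywise expectation; meaningful when the entries of X are integrable. *)
Definition mxexpect (d : nat) (X : T -> 'M[R[i]]_d) : 'M[R[i]]_d :=
  \matrix_(i, j) Complex (fine 'E_P[fun w => complex.Re (X w i j)])
                         (fine 'E_P[fun w => complex.Im (X w i j)]).

Definition schatten_moment (d : nat) (q : R) (X : T -> 'M[R[i]]_d) : \bar R :=
  'E_P[fun w => (schatten q (X w) `^ q)%R]%E.

End random_matrices.

(* Main.v *)
(* Everything is phrased through tr f(A) for Hermitian A.  If A and B have
   eigenvalues l_i, m_j, then tr(f(A) g(B)) = sum_ij w_ij f(l_i) g(m_j) with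
   weights w_ij >= 0, so scalar inequalities transfer to traces (Klein).

   Matrix Burkholder-Davis-Gundy by exchangeable pairs: for p = 1 or p >= 3/2
   the function |t|^(2p-2) is convex, so
     (x - y) (x |x|^(2p-2) - y |y|^(2p-2))
        <= (2p-1)/2 (x - y)^2 (|x|^(2p-2) + |y|^(2p-2)).
   Applied under the trace to X_k + Y and X_k' + Y, where Y is the sum of the
   other summands and X_k' an independent copy of X_k, it gives for X = sum X_k
     E tr|X|^2p <= (2p-1)/2 E tr(sum (X_k^2 + E X_k^2) |X|^(2p-2)),
   and Young's inequality absorbs the power of |X|.

   (i) With X_k = P_k - E P_k this bounds E tr|X|^2p by
   (4p-2)^p E tr(sum P_k^2)^p.  A Schur basis of Q^(1/2) (sum P_k^2) Q^(-1/2),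
   Q = sum P_k, and Jensen's inequality yield
     tr(sum P_k^2)^p <= 1/2 (s tr Q^2p + s^-1 sum tr P_k^2p)  for all s > 0.
   Minkowski's inequality then leaves a quadratic inequality for
   (E tr Q^2p)^(1/(4p)).
   (ii) The same bound at exponent 2p in place of p, with X_k = Y_k, reduces
   (ii) to (i) for the matrices Y_k^2. *)

Require Import Defs.
From HB Require Import structures.
From mathcomp Require Import all_boot all_order all_algebra.
From mathcomp Require Import sesquilinear spectral complex.
From mathcomp Require Import all_classical all_reals all_analysis.
From mathcomp Require Import measurable_realfun.
From mathcomp Require Import ring lra.

Set Implicit Arguments.
Unset Strict Implicit.
Unset Printing Implicit Defensive.

Import Order.TTheory GRing.Theory Num.Theory.
Import numFieldNormedType.Exports.

Local Open Scope classical_set_scope.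
Local Open Scope ring_scope.
Local Open Scope sesquilinear_scope.
Local Open Scope complex_scope.

(** * Hermitian matrices and traces *)

(** Klein's argument compares two spectra at a time, so an inequality must first be split into
    products of a function of one matrix with a function of another. The square function involves
    more matrices than that. It is handled through the diagonal entries of Q^(1/2) (sum P_k^2)
    Q^(-1/2), which, unlike eigenvalues, are linear in the P_k^2, and which a Schur basis turns into
    eigenvalues.

    Constants: the exchange step gives (2p-1)/2; centering P_k costs a factor 2, and passing from S
    + E S to S = sum P_k^2 costs another 2 inside the p-th power. This makes 4p-2, and its square
    root after the root of order 2p. Part (ii) starts from (4p-1)/2 and splits S + E S by Minkowski
    instead, because E S is the variance of the statement.

    No independent copy of X_k is constructed: an inequality at a pair w, w' is integrated twice
    over the same space. Eigenvectors picked by [spectralmx] need not depend measurably on the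
    matrix, so measurability of f(X) comes from polynomials by pointwise limits. *)

Section adjoint.
Context {R : realType}.
Local Notation C := R[i].

Lemma adjM m n q (A : 'M[C]_(m, n)) (B : 'M[C]_(n, q)) :
  (A *m B)^t* = B^t* *m A^t*.
Proof. by rewrite trmx_mul map_mxM. Qed.

Lemma adjD m n (A B : 'M[C]_(m, n)) : (A + B)^t* = A^t* + B^t*.
Proof. by rewrite linearD map_mxD. Qed.

Lemma adjN m n (A : 'M[C]_(m, n)) : (- A)^t* = - A^t*.
Proof. by rewrite linearN map_mxN. Qed.

Lemma adjB m n (A B : 'M[C]_(m, n)) : (A - B)^t* = A^t* - B^t*.
Proof. by rewrite adjD adjN. Qed.

Lemma conjC_real (a : R) : (a%:C)^*%R = a%:C.
Proof. by apply/CrealP; rewrite complex_real. Qed.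

Lemma adjZ m n (a : R) (A : 'M[C]_(m, n)) : (a%:C *: A)^t* = a%:C *: A^t*.
Proof. by apply/matrixP => i j; rewrite !mxE rmorphM /= conjC_real. Qed.

Lemma hermP d (A : 'M[C]_d) : reflect (A^t* = A) (A \is hermsymmx).
Proof.
apply: (iffP (is_hermitianmxP _ _ _)); rewrite expr0 scale1r => h.
  by rewrite [RHS]h.
by rewrite h.
Qed.

Lemma hermD d (A B : 'M[C]_d) :
  A \is hermsymmx -> B \is hermsymmx -> A + B \is hermsymmx.
Proof. by move=> /hermP hA /hermP hB; apply/hermP; rewrite adjD hA hB. Qed.

Lemma hermB d (A B : 'M[C]_d) :
  A \is hermsymmx -> B \is hermsymmx -> A - B \is hermsymmx.
Proof. by move=> /hermP hA /hermP hB; apply/hermP; rewrite adjB hA hB. Qed.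

Lemma hermZ d (a : R) (A : 'M[C]_d) :
  A \is hermsymmx -> a%:C *: A \is hermsymmx.
Proof. by move=> /hermP hA; apply/hermP; rewrite adjZ hA. Qed.

Lemma herm0 d : (0 : 'M[C]_d) \is hermsymmx.
Proof. by apply/hermP/matrixP => i j; rewrite !mxE conjC0. Qed.

Lemma herm_sum d (I : Type) (r : seq I) (Pr : pred I) (A : I -> 'M[C]_d) :
  (forall i, Pr i -> A i \is hermsymmx) ->
  \sum_(i <- r | Pr i) A i \is hermsymmx.
Proof.
move=> h; apply: (big_ind (fun M : 'M[C]_d => M \is hermsymmx)); last exact: h.
  exact: herm0.
by move=> M N; exact: hermD.
Qed.

Lemma herm_sq d (A : 'M[C]_d) : A \is hermsymmx -> A *m A \is hermsymmx.
Proof. by move=> /hermP hA; apply/hermP; rewrite adjM hA. Qed.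

Lemma herm_scalar d (a : R) : ((a%:C)%:M : 'M[C]_d) \is hermsymmx.
Proof.
apply/hermP/matrixP => i j; rewrite !mxE eq_sym; case: eqP => _.
  by rewrite !mulr1n conjC_real.
by rewrite !mulr0n conjC0.
Qed.

Lemma Re_conjC (z : C) : complex.Re z^*%R = complex.Re z.
Proof. by case: z. Qed.

End adjoint.

Section retrace.
Context {R : realType}.
Local Notation C := R[i].

Fact trR_key : unit. Proof. by []. Qed.

(* Sealed, like mxfun below, lest failing conversion checks unfold it. *)
Definition trR d : 'M[C]_d -> R :=
  locked_with trR_key (fun M => complex.Re (\tr M)).

Lemma trRE d (M : 'M[C]_d) : trR M = complex.Re (\tr M).
Proof. by rewrite /trR unlock. Qed.

Lemma ReD (x y : C) : complex.Re (x + y) = complex.Re x + complex.Re y.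
Proof. by case: x y => [a b] [c e]. Qed.

Lemma ReN (x : C) : complex.Re (- x) = - complex.Re x.
Proof. by case: x. Qed.

Lemma ReZ (a : R) (x : C) : complex.Re (a%:C * x) = a * complex.Re x.
Proof. by case: x => [b c] /=; rewrite mul0r subr0. Qed.

Lemma Re_sum (I : Type) (r : seq I) (Pr : pred I) (F : I -> C) :
  complex.Re (\sum_(i <- r | Pr i) F i) = \sum_(i <- r | Pr i) complex.Re (F i).
Proof. by elim/big_rec2: _ => // i x y _ <-; rewrite ReD. Qed.

Lemma trRD d (A B : 'M[C]_d) : trR (A + B) = trR A + trR B.
Proof. by rewrite !trRE linearD ReD. Qed.

Lemma trRN d (A : 'M[C]_d) : trR (- A) = - trR A.
Proof. by rewrite !trRE linearN ReN. Qed.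

Lemma trRB d (A B : 'M[C]_d) : trR (A - B) = trR A - trR B.
Proof. by rewrite trRD trRN. Qed.

Lemma trRZ d (a : R) (A : 'M[C]_d) : trR (a%:C *: A) = a * trR A.
Proof. by rewrite !trRE linearZ /= ReZ. Qed.

Lemma trR0 d : trR (0 : 'M[C]_d) = 0.
Proof. by rewrite !trRE linear0. Qed.

Lemma trR_sum d (I : Type) (r : seq I) (Pr : pred I) (F : I -> 'M[C]_d) :
  trR (\sum_(i <- r | Pr i) F i) = \sum_(i <- r | Pr i) trR (F i).
Proof. by elim/big_rec2: _ => [|i x y _ <-]; rewrite ?trR0 ?trRD. Qed.

Lemma trRC d (A B : 'M[C]_d) : trR (A *m B) = trR (B *m A).
Proof. by rewrite !trRE mxtrace_mulC. Qed.

Lemma trR_adj d (A : 'M[C]_d) : trR (A^t*) = trR A.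
Proof.
rewrite !trRE /mxtrace !Re_sum; apply: eq_bigr => i _.
by rewrite !mxE Re_conjC.
Qed.

End retrace.

(** * Functional calculus *)

Section unitary_diagonal.
Context {C : numClosedFieldType} {d : nat}.
Implicit Types (U V A B : 'M[C]_d) (l m : 'I_d -> C).

Lemma unitary_adjK U : U \is unitarymx -> U^t* *m U = 1%:M.
Proof. by move=> hU; have := mulmxKtV (1%:M : 'M[C]_d) hU erefl; rewrite mul1mx. Qed.

Lemma unitary_adjVK U : U \is unitarymx -> U *m U^t* = 1%:M.
Proof. by move/unitarymxP. Qed.

Definition cdiag U l : 'M[C]_d := U^t* *m diag_mx (\row_j l j) *m U.

Lemma cdiagE U l i j : cdiag U l i j = \sum_k l k * ((U k i)^* * U k j).
Proof.
rewrite /cdiag mul_mx_diag !mxE; apply: eq_bigr => k _.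
by rewrite !mxE mulrCA mulrA.
Qed.

Lemma eq_cdiag U l m : l =1 m -> cdiag U l = cdiag U m.
Proof. by move=> /funext ->. Qed.

(** With Z = [U *m V^t*], the two matrices agree exactly when l_i Z_ij = Z_ij m_j for all i, j. So
    each Z_ij either vanishes or forces l_i = m_j, hence l'_i = m'_j. This makes f(A) independent of
    the eigenbasis, also for repeated eigenvalues. *)
Lemma cdiag_uniq U V l m l' m' : U \is unitarymx -> V \is unitarymx ->
  (forall i j, l i = m j -> l' i = m' j) ->
  cdiag U l = cdiag V m -> cdiag U l' = cdiag V m'.
Proof.
move=> hU hV lm e.
have key l1 m1 : cdiag U l1 = cdiag V m1 <->
    forall i j, l1 i * (U *m V^t*) i j = (U *m V^t*) i j * m1 j.
  have -> : (forall i j, l1 i * (U *m V^t*) i j = (U *m V^t*) i j * m1 j) <->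
      diag_mx (\row_j l1 j) *m (U *m V^t*) =
      (U *m V^t*) *m diag_mx (\row_j m1 j).
    rewrite mul_mx_diag mul_diag_mx; split => [h|/matrixP h i j].
      by apply/matrixP => i j; rewrite !mxE /=; have := h i j; rewrite !mxE.
    by have := h i j; rewrite !mxE.
  rewrite /cdiag; split => [h|h].
    transitivity (U *m (U^t* *m diag_mx (\row_j l1 j) *m U) *m V^t*).
      by rewrite !mulmxA unitary_adjVK // mul1mx.
    by rewrite [X in U *m X]h !mulmxA mulmxtVK.
  transitivity (U^t* *m (diag_mx (\row_j l1 j) *m (U *m V^t*)) *m V).
    by rewrite -!mulmxA unitary_adjK // mulmx1.
  by rewrite h !mulmxA unitary_adjK // mul1mx.
have /key h := e.
apply/key => i j; have := h i j.
set w := (U *m V^t*) i j => {}h.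
have [->|w0] := eqVneq w 0; first by rewrite mulr0 mul0r.
by rewrite (lm i j) 1?mulrC //; apply: (mulfI w0); rewrite -h mulrC.
Qed.

Lemma cdiagM U l m : U \is unitarymx ->
  cdiag U l *m cdiag U m = cdiag U (fun j => l j * m j).
Proof.
move=> hU; rewrite /cdiag !mulmxA; congr (_ *m U).
rewrite -[_ *m U *m U^t*]mulmxA unitary_adjVK // mulmx1 -mulmxA; congr (_ *m _).
rewrite mul_diag_mx; apply/matrixP => i j; rewrite !mxE.
by rewrite mulrnAr.
Qed.

Lemma cdiagD U l m : cdiag U l + cdiag U m = cdiag U (fun j => l j + m j).
Proof.
apply/matrixP => i j; rewrite mxE !cdiagE -big_split /=.
by apply: eq_bigr => k _; rewrite mulrDl.
Qed.

Lemma cdiagZ U l a : a *: cdiag U l = cdiag U (fun j => a * l j).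
Proof.
apply/matrixP => i j; rewrite mxE !cdiagE mulr_sumr.
by apply: eq_bigr => k _; rewrite mulrA.
Qed.

Lemma cdiag_cst U a : U \is unitarymx -> cdiag U (fun=> a) = a%:M.
Proof.
move=> hU; rewrite /cdiag.
have -> : diag_mx (\row__ a) = a%:M :> 'M[C]_d.
  by rewrite -diag_const_mx; congr diag_mx; apply/rowP => j; rewrite !mxE.
by rewrite mul_mx_scalar -scalemxAl unitary_adjK // scalemx1.
Qed.

Lemma mxtrace_cdiag U l : U \is unitarymx -> \tr (cdiag U l) = \sum_j l j.
Proof.
move=> hU; rewrite /cdiag mxtrace_mulC mulmxA unitary_adjVK // mul1mx.
by rewrite mxtrace_diag; apply: eq_bigr => j _; rewrite mxE.
Qed.

Lemma mxtrace_cdiagM U V l m :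
  \tr (cdiag U l *m cdiag V m) =
  \sum_i \sum_j l i * m j *
    ((U *m V^t*) i j * ((U *m V^t*) i j)^*).
Proof.
set Z := U *m V^t*.
have -> : \tr (cdiag U l *m cdiag V m) = \tr (diag_mx (\row_j l j) *m Z *m
      diag_mx (\row_j m j) *m Z^t*).
  rewrite /cdiag mxtrace_mulC !mulmxA mxtrace_mulC !mulmxA mxtrace_mulC.
  have -> : Z^t* = V *m U^t* by rewrite trmx_mul map_mxM trmxCK.
  by rewrite /Z !mulmxA mxtrace_mulC !mulmxA.
rewrite /mxtrace; apply: eq_bigr => i _.
rewrite mul_diag_mx mul_mx_diag !mxE; apply: eq_bigr => j _.
by rewrite !mxE; ring.
Qed.

End unitary_diagonal.

Section functional_calculus.
Context {R : realType} {d : nat}.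
Local Notation C := R[i].
Implicit Types (U V : 'M[C]_d) (l m : 'I_d -> R) (f g : R -> R) (A B : 'M[C]_d).

Definition udiag U l : 'M[C]_d := cdiag U (fun j => (l j)%:C).

Lemma udiagE U l : udiag U l = U^t* *m diag_mx (\row_j (l j)%:C) *m U.
Proof. by []. Qed.

Lemma udiag_herm U l : udiag U l \is hermsymmx.
Proof.
apply/hermP/matrixP => i j; rewrite 2!mxE !cdiagE rmorph_sum /=.
apply: eq_bigr => k _; rewrite !rmorphM /= conjC_real conjCK; congr (_ * _).
by rewrite mulrC.
Qed.

Fact mxfun_key : unit. Proof. by []. Qed.

Definition mxfun : (R -> R) -> 'M[C]_d -> 'M[C]_d :=
  locked_with mxfun_key (@hermfun R d).

Lemma hermfunE f A : hermfun f A = mxfun f A.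
Proof. by rewrite /mxfun unlock. Qed.

Lemma mxfunE f A : mxfun f A =
  udiag (spectralmx A) (fun j => f (complex.Re (spectral_diag A 0 j))).
Proof. by rewrite -hermfunE /hermfun invmx_unitary // spectral_unitarymx. Qed.

Lemma mxfun_id A : A \is hermsymmx -> mxfun id A = A.
Proof.
move=> hA; have /hermitian_normalmx/orthomx_spectralP {2}-> := hA.
rewrite -hermfunE /hermfun; have -> // : \row_j (complex.Re (spectral_diag A 0 j))%:C =
  spectral_diag A.
apply/rowP => j; rewrite !mxE RRe_real //.
by have /mxOverP := hermitian_spectral_diag_real hA; exact.
Qed.

Lemma udiag_uniq U V l m f : U \is unitarymx -> V \is unitarymx ->
  udiag U l = udiag V m -> udiag U (f \o l) = udiag V (f \o m).
Proof.
by move=> hU hV; refine (cdiag_uniq hU hV _) => i j /complexI /= ->.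
Qed.

Lemma herm_udiag A : A \is hermsymmx ->
  exists U l, [/\ U \is unitarymx, A = udiag U l &
    forall f, mxfun f A = udiag U (f \o l)].
Proof.
move=> hA; exists (spectralmx A), (fun j => complex.Re (spectral_diag A 0 j)).
split => [||f]; [exact: spectral_unitarymx| |exact: mxfunE].
by rewrite -{1}(mxfun_id hA) mxfunE.
Qed.

Lemma mxfun_udiag U l f : U \is unitarymx ->
  mxfun f (udiag U l) = udiag U (f \o l).
Proof.
move=> hU; have [V [m [hV e ->]]] := herm_udiag (udiag_herm U l).
exact/esym/udiag_uniq.
Qed.

Lemma mxfun_herm f A : mxfun f A \is hermsymmx.
Proof. by rewrite mxfunE udiag_herm. Qed.

Lemma eq_mxfun f g A : f =1 g -> mxfun f A = mxfun g A.
Proof. by move=> /funext ->. Qed.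

Lemma udiagM U l m : U \is unitarymx ->
  udiag U l *m udiag U m = udiag U (fun j => l j * m j).
Proof.
move=> hU; rewrite /udiag (cdiagM _ _ hU).
by apply: eq_cdiag => j; rewrite rmorphM.
Qed.

Lemma udiagD U l m : udiag U l + udiag U m = udiag U (fun j => l j + m j).
Proof. by rewrite /udiag cdiagD; apply: eq_cdiag => j; rewrite rmorphD. Qed.

Lemma udiagZ U l a : a%:C *: udiag U l = udiag U (fun j => a * l j).
Proof. by rewrite /udiag cdiagZ; apply: eq_cdiag => j; rewrite rmorphM. Qed.

Lemma trR_udiag U l : U \is unitarymx -> trR (udiag U l) = \sum_j l j.
Proof. by move=> hU; rewrite /udiag !trRE mxtrace_cdiag // Re_sum. Qed.

Lemma mxfun_comp f g A : A \is hermsymmx ->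
  mxfun f (mxfun g A) = mxfun (f \o g) A.
Proof.
move=> /herm_udiag [U [l [hU _ h]]]; rewrite !h.
exact: mxfun_udiag.
Qed.

Lemma mxfunM f g A :
  mxfun f A *m mxfun g A = mxfun (fun x => f x * g x) A.
Proof. by rewrite !mxfunE udiagM // spectral_unitarymx. Qed.

Lemma mxfunD f g A : mxfun f A + mxfun g A = mxfun (fun x => f x + g x) A.
Proof. by rewrite !mxfunE udiagD. Qed.

Lemma mxfunZ a f A : a%:C *: mxfun f A = mxfun (fun x => a * f x) A.
Proof. by rewrite !mxfunE udiagZ. Qed.

Lemma mxfun_cst a A : mxfun (fun=> a) A = (a%:C)%:M.
Proof. by rewrite mxfunE /udiag cdiag_cst // spectral_unitarymx. Qed.

Lemma mxfun_one A : mxfun (fun=> 1) A = 1%:M.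
Proof. by rewrite mxfun_cst rmorph1. Qed.

Lemma mxfun_scale a f A : A \is hermsymmx ->
  mxfun f (a%:C *: A) = mxfun (fun x => f (a * x)) A.
Proof.
by move=> hA; rewrite -{1}(mxfun_id hA) mxfunZ mxfun_comp.
Qed.

(* The squared moduli |<u_i, v_j>|^2 of the inner products of two eigenbases
   are a joint weight through which every trace tr(f(A) g(B)) factors. *)
Lemma trace_pairing A B : A \is hermsymmx -> B \is hermsymmx ->
  exists (w : 'I_d -> 'I_d -> R) (l m : 'I_d -> R),
    (forall i j, 0 <= w i j) /\
    (forall f g, trR (mxfun f A *m mxfun g B) =
      \sum_i \sum_j w i j * (f (l i) * g (m j))).
Proof.
move=> /herm_udiag [U [l [hU _ hA]]] /herm_udiag [V [m [hV _ hB]]].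
pose Z := U *m V^t*.
exists (fun i j => complex.Re (Z i j * (Z i j)^*%R)), l, m; split.
- move=> i j; have := mul_conjC_ge0 (Z i j).
  by rewrite lecE => /andP[].
- move=> f g; rewrite hA hB !trRE mxtrace_cdiagM.
  rewrite Re_sum; apply: eq_bigr => i _.
  rewrite Re_sum; apply: eq_bigr => j _.
  by rewrite -rmorphM ReZ mulrC.
Qed.

End functional_calculus.

Section klein.
Context {R : realType} {d : nat}.
Local Notation C := R[i].
Implicit Types (f g : R -> R) (A B : 'M[C]_d).

(* Each triple (c, f, g) of s stands for the summand c f(x) g(y). *)
Lemma klein (f0 g0 : R -> R) (s : seq (R * (R -> R) * (R -> R))) A B :
  A \is hermsymmx -> B \is hermsymmx ->
  (forall x y, 0 <= f0 x + g0 y + \sum_(t <- s) t.1.1 * (t.1.2 x * t.2 y)) ->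
  0 <= trR (mxfun f0 A) + trR (mxfun g0 B) +
    \sum_(t <- s) t.1.1 * trR (mxfun t.1.2 A *m mxfun t.2 B).
Proof.
move=> hA hB h; have [w [l [m [w0 tr_w]]]] := trace_pairing hA hB.
have e1 : trR (mxfun f0 A) = \sum_i \sum_j w i j * (f0 (l i) * 1).
  by have := tr_w f0 (fun=> 1); rewrite mxfun_one mulmx1.
have e2 : trR (mxfun g0 B) = \sum_i \sum_j w i j * (1 * g0 (m j)).
  by have := tr_w (fun=> 1) g0; rewrite mxfun_one mul1mx.
have e3 : \sum_(t <- s) t.1.1 * trR (mxfun t.1.2 A *m mxfun t.2 B) =
    \sum_i \sum_j \sum_(t <- s) t.1.1 * (w i j * (t.1.2 (l i) * t.2 (m j))).
  transitivity (\sum_(t <- s) \sum_i \sum_j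
      t.1.1 * (w i j * (t.1.2 (l i) * t.2 (m j)))).
    apply: eq_bigr => t _; rewrite tr_w mulr_sumr; apply: eq_bigr => i _.
    by rewrite mulr_sumr.
  by rewrite exchange_big /=; apply: eq_bigr => i _; rewrite exchange_big.
rewrite e1 e2 e3 -!big_split /= sumr_ge0 // => i _.
rewrite -!big_split /= sumr_ge0 // => j _.
under eq_bigr do rewrite mulrCA.
by rewrite -mulr_sumr -!mulrDr mulr1 mul1r mulr_ge0.
Qed.

End klein.

(** * Trace inequalities *)

Section scalar_inequalities.
Context {R : realType}.
Implicit Types (x y a b p q s : R).

(** Young's inequality for x and y^(p-1) with conjugate exponents p and p/(p-1). The second exponent
    degenerates at p = 1, hence the case split. *)
Lemma young_powR p x y : 1 <= p -> 0 <= x -> 0 <= y ->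
  x * y `^ (p - 1) <= p^-1 * x `^ p + (1 - p^-1) * y `^ p.
Proof.
move=> p1 x0 y0; have p0 : 0 < p by lra.
have [p1'|pn1] := eqVneq p 1.
  by rewrite p1' subrr powRr0 invr1 subrr mul0r addr0 mul1r mulr1 powRr1.
have p1' : 0 < p - 1 by rewrite subr_gt0 lt_neqAle eq_sym pn1.
have := @conjugate_powR _ x (y `^ (p - 1)) p (p / (p - 1)) x0 (powR_ge0 _ _) p0.
rewrite divr_gt0 // => /(_ isT); have -> : p^-1 + (p / (p - 1))^-1 = 1 by field; lra.
move=> /(_ erefl); rewrite -powRrM; have -> : (p - 1) * (p / (p - 1)) = p.
  by field; lra.
move=> /le_trans; apply; rewrite le_eqVlt; apply/orP; left; apply/eqP.
by field; lra.
Qed.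

Lemma young_powR2 p x y : 1 <= p -> 0 <= x ->
  x * `|y| `^ (2 * p - 2) <= p^-1 * x `^ p + (1 - p^-1) * `|y| `^ (2 * p).
Proof.
move=> p1 x0; have := young_powR p1 x0 (powR_ge0 `|y| 2).
by rewrite -!powRrM mulrBr mulr1.
Qed.

(** Tangent lines of the convex function |x|^q lie below its graph. Deriving this from Young's
    inequality avoids derivatives and covers the kink at y = 0 for q = 1, where [Num.sg 0 = 0]
    selects the slope 0. *)
Lemma subgrad_powR q x y : 1 <= q ->
  `|y| `^ q + q * ((x - y) * (Num.sg y * `|y| `^ (q - 1))) <= `|x| `^ q.
Proof.
move=> q1; have q0 : 0 < q by lra.
have h := young_powR q1 (normr_ge0 x) (normr_ge0 y).
have e : y * (Num.sg y * `|y| `^ (q - 1)) = `|y| `^ q.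
  by rewrite mulrA [y * _]mulrC -normrEsg mulr_powRB1.
have h2 : x * (Num.sg y * `|y| `^ (q - 1)) <= `|x| * `|y| `^ (q - 1).
  rewrite mulrA ler_wpM2r ?powR_ge0 // (le_trans (ler_norm _)) // normrM.
  by rewrite ler_piMr // normr_sg; case: (y != 0).
have : q * (x * (Num.sg y * `|y| `^ (q - 1))) <= `|x| `^ q + (q - 1) * `|y| `^ q.
  have -> : `|x| `^ q + (q - 1) * `|y| `^ q =
    q * (q^-1 * `|x| `^ q + (1 - q^-1) * `|y| `^ q) by field; rewrite gt_eqF.
  by rewrite ler_pM2l // (le_trans h2).
by move=> h3; rewrite mulrBl mulrBr e; lra.
Qed.

(** The right side is s + 1 times the trapezoidal rule for the integral of t^s over [b, a], which
    overestimates because t^s is convex. *)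
Lemma trapezoid_powR s a b : 1 <= s -> 0 <= b -> b <= a ->
  a * a `^ s - b * b `^ s <= (s + 1) / 2 * ((a - b) * (a `^ s + b `^ s)).
Proof.
move=> s1; rewrite le_eqVlt => /predU1P[<- a0|b0 ba].
  (* The case b = 0, outside the range of [is_derive1_powR], amounts to (s + 1) / 2 >= 1. *)
  rewrite mul0r !subr0 powR0 ?gt_eqF //; last lra.
  by rewrite addr0 ler_peMl ?mulr_ge0 ?powR_ge0 //; lra.
have a0 : 0 < a by lra.
(* [psi] moves the lower endpoint: psi(b) is the right side plus b^(s+1), and psi(a) = a^(s+1). It
   remains to see that [psi] does not increase. *)
pose psi x := (s + 1) / 2 * ((a - x) * (a `^ s + x `^ s)) + x * x `^ s.
pose dpsi x := (s + 1) / 2 * ((a - x) * (s * x `^ (s - 1)) - (a `^ s + x `^ s)) +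
  (x * (s * x `^ (s - 1)) + x `^ s).
have psi_der x : 0 < x -> is_derive x 1 psi (dpsi x).
  move=> x0; rewrite /psi /dpsi.
  have hp := @is_derive1_powR R s x x0.
  by apply: is_derive_eq; rewrite ?scaler1 /GRing.scale /=; lra.
have [||c] := @MVT_segment R psi dpsi b a ba.
- by move=> x; rewrite in_itv /= => /andP[bx _]; apply: psi_der; lra.
- apply: derivable_within_continuous => x; rewrite in_itv /= => /andP[bx _].
  by have hx := psi_der x (lt_le_trans b0 bx).
rewrite in_itv /= => /andP[bc ca] e.
have c0 : 0 < c by lra.
(* Up to the factor (s + 1) / 2, dpsi(c) is the tangent line of t^s at c, evaluated at a, minus
   a^s. *)
have dc : dpsi c <= 0.
  have := subgrad_powR a c s1.
  rewrite gtr0_sg // mul1r !gtr0_norm //.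
  have := mulr_powRB1 (ltW c0) (lt_le_trans ltr01 s1).
  rewrite /dpsi; set u := c `^ (s - 1) => <-; set v := a `^ s => h.
  have -> : (s + 1) / 2 * ((a - c) * (s * u) - (v + c * u)) +
     (c * (s * u) + c * u) = (s + 1) / 2 * (c * u + s * ((a - c) * u) - v) by field.
  by rewrite mulr_ge0_le0 //; lra.
have : psi a - psi b <= 0 by rewrite e mulr_le0_ge0 //; lra.
by rewrite /psi subrr mul0r mulr0 add0r; lra.
Qed.

(* The trapezoidal bound for the integral of the convex function |t|^(2p-2)
   between x and y *)
Lemma mean_value_powR p x y : p = 1 \/ 3 / 2 <= p ->
  (x - y) * (x * `|x| `^ (2 * p - 2) - y * `|y| `^ (2 * p - 2)) <=
  (2 * p - 1) / 2 *
  ((x - y) ^+ 2 * (`|x| `^ (2 * p - 2) + `|y| `^ (2 * p - 2))).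
Proof.
move=> [->|p32].
  by rewrite mulr1 subrr !powRr0; lra.
set s := 2 * p - 2; have s1 : 1 <= s by rewrite /s; lra.
have -> : 2 * p - 1 = s + 1 by rewrite /s; lra.
wlog yx : x y / y <= x.
  move=> h; have [/h//|/ltW/h] := leP y x.
  by congr (_ <= _); ring.
rewrite expr2 -[(x - y) * (x - y) * _]mulrA [_ / 2 * _]mulrCA.
rewrite ler_wpM2l ?subr_ge0 //.
have [y0|y0] := leP 0 y.
  rewrite !ger0_norm //; last lra.
  exact: trapezoid_powR.
have [x0|x0] := leP x 0.
  have := @trapezoid_powR s (- y) (- x) s1; rewrite !ler0_norm //; last lra.
  by move=> h; have := h ltac:(lra) ltac:(lra); congr (_ <= _); ring.
(* For y < 0 < x the cross terms of (x - y) (|x|^s + |y|^s) are nonnegative, and (s + 1) / 2 >= 1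
   finishes. *)
rewrite gtr0_norm // ltr0_norm //.
have := powR_ge0 x s; have := powR_ge0 (- y) s.
set u := _ `^ _; set v := _ `^ _ => u0 v0.
rewrite (@le_trans _ _ ((x - y) * (v + u))) //; first by nra.
by rewrite ler_peMl ?mulr_ge0 //; lra.
Qed.

(** With m = max(1, |x|, |y|) the product is at most m^(a+b) <= m^q. This is the source of
    domination for products of powers of two random matrices. *)
Lemma norm_powRM_le a b q x y : 0 <= a -> 0 <= b -> a + b <= q ->
  `|x| `^ a * `|y| `^ b <= 1 + `|x| `^ q + `|y| `^ q.
Proof.
move=> a0 b0 abq; have q0 : 0 <= q by lra.
pose m := Num.max 1 (Num.max `|x| `|y|).
have m1 : 1 <= m by rewrite le_max lexx.
have xm : `|x| <= m by rewrite !le_max lexx !orbT.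
have ym : `|y| <= m by rewrite !le_max lexx !orbT.
have m0 : 0 <= m by lra.
have le1 : `|x| `^ a * `|y| `^ b <= m `^ q.
  apply: (@le_trans _ _ (m `^ a * m `^ b)).
    by rewrite ler_pM ?powR_ge0 // ge0_ler_powR.
  by rewrite -powRD ?ler_powR //; rewrite (gt_eqF (lt_le_trans ltr01 m1)) implybT.
apply: (le_trans le1); have := powR_ge0 `|x| q; have := powR_ge0 `|y| q.
rewrite /m; have [_|_] := leP 1 (Num.max `|x| `|y|).
  by case: (leP `|x| `|y|) => _; lra.
by rewrite powR1; lra.
Qed.

End scalar_inequalities.

(** * Positive semidefinite matrices *)

Section psd_matrices.
Context {R : realType} {d : nat}.
Local Notation C := R[i].
Implicit Types (f g : R -> R) (A B : 'M[C]_d).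

Lemma psd_herm A : psdmx A -> A \is hermsymmx.
Proof. by case. Qed.

Lemma psdD A B : psdmx A -> psdmx B -> psdmx (A + B).
Proof.
move=> [hA pA] [hB pB]; split; first exact: hermD.
by move=> v; rewrite mulmxDr mulmxDl mxE addr_ge0.
Qed.

Lemma psd0 : psdmx (0 : 'M[C]_d).
Proof. by split => [|v]; [exact: herm0|rewrite mulmx0 mul0mx mxE]. Qed.

Lemma psd_sum (I : Type) (r : seq I) (Pr : pred I) (A : I -> 'M[C]_d) :
  (forall i, Pr i -> psdmx (A i)) -> psdmx (\sum_(i <- r | Pr i) A i).
Proof. move=> h; exact: (big_ind (fun X : 'M[C]_d => psdmx X) psd0 psdD). Qed.

Lemma psd_congr n A (B : 'M[C]_(d, n)) : psdmx A -> psdmx (B^t* *m A *m B).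
Proof.
move=> [/hermP hA pA]; split.
  by apply/hermP; rewrite !adjM trmxCK hA mulmxA.
by move=> v; have := pA (B *m v); rewrite adjM !mulmxA.
Qed.

Lemma psd_scalar (a : R) : 0 <= a -> psdmx ((a%:C)%:M : 'M[C]_d).
Proof.
move=> a0; split; first exact: herm_scalar.
move=> v; rewrite mul_mx_scalar -scalemxAl mxE mulr_ge0 ?ler0c //.
by rewrite mxE sumr_ge0 // => i _; rewrite !mxE mulrC mul_conjC_ge0.
Qed.

Lemma psd_sq A : A \is hermsymmx -> psdmx (A *m A).
Proof.
move=> /hermP hA; have := psd_congr A (psd_scalar ler01).
by rewrite mulmx1 hA.
Qed.

Lemma psd_udiag U (l : 'I_d -> R) : U \is unitarymx ->
  psdmx (udiag U l) -> forall j, 0 <= l j.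
Proof.
move=> hU [_ h] j; have := h (col j (U^t*)).
have -> : (col j (U^t*))^t* = row j U.
  by apply/matrixP => i k; rewrite !mxE conjCK.
rewrite -row_mul.
have -> X : (row j X *m col j (U^t*)) 0 0 = (X *m U^t*) j j.
  by rewrite !mxE; apply: eq_bigr => k _; rewrite !mxE.
have -> : U *m udiag U l *m U^t* = diag_mx (\row_j (l j)%:C).
  rewrite udiagE !mulmxA unitary_adjVK // mul1mx.
  exact: mulmxtVK.
by rewrite !mxE eqxx mulr1n ler0c.
Qed.

Lemma udiag_psd U (l : 'I_d -> R) :
  (forall j, 0 <= l j) -> psdmx (udiag U l).
Proof.
move=> l0; rewrite udiagE; apply: psd_congr; split.
  apply/hermP/matrixP => i j; rewrite !mxE eq_sym.
  by case: eqP => [->|_]; rewrite ?mulr1n ?conjC_real // ?mulr0n ?conjC0.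
move=> v; rewrite mxE sumr_ge0 // => i _.
rewrite mul_mx_diag !mxE mulrAC [_^* * _]mulrC mulr_ge0 ?ler0c //.
exact: mul_conjC_ge0.
Qed.

Lemma psd_mxfun f A : (forall x, 0 <= f x) -> psdmx (mxfun f A).
Proof. by move=> f0; rewrite mxfunE; apply: udiag_psd. Qed.

Lemma eq_psd_mxfun f g A : psdmx A -> (forall x, 0 <= x -> f x = g x) ->
  mxfun f A = mxfun g A.
Proof.
move=> pA fg; have [U [l [hU e h]]] := herm_udiag (psd_herm pA).
rewrite e in pA; have l0 := psd_udiag hU pA.
rewrite !h; congr udiag; apply/funext => j /=; exact: fg.
Qed.

(** [klein] quantifies over all real x and y. Positivity of a matrix enters it by inserting absolute
    values in the scalar functions and removing them here. *)
Lemma psd_mxfun_norm f A : psdmx A ->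
  mxfun (fun x => f `|x|) A = mxfun f A.
Proof. by move=> pA; apply: eq_psd_mxfun => // x x0; rewrite ger0_norm. Qed.

Lemma trR_mxfun0 A : trR (mxfun (fun=> 0) A) = 0.
Proof.
by rewrite mxfunE trR_udiag ?spectral_unitarymx // big1.
Qed.

(** This is [klein] for the scalar inequality |x| |y| >= 0. *)
Lemma psd_trM_ge0 A B : psdmx A -> psdmx B -> 0 <= trR (A *m B).
Proof.
move=> pA pB; have hA := psd_herm pA; have hB := psd_herm pB.
have hs (x y : R) : 0 <= 0 + 0 +
    \sum_(t <- [:: (1, fun x : R => `|x|, fun y : R => `|y|)])
      t.1.1 * (t.1.2 x * t.2 y).
  by rewrite big_cons big_nil /= !add0r addr0 mul1r mulr_ge0.
have := klein hA hB hs; rewrite big_cons big_nil /=.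
rewrite (psd_mxfun_norm id pA) (psd_mxfun_norm id pB).
rewrite (mxfun_id hA) (mxfun_id hB) trR_mxfun0 trR_mxfun0.
by rewrite !add0r addr0 mul1r.
Qed.

End psd_matrices.

Section trace_expansions.
Context {C : comNzRingType} {d : nat}.
Implicit Types A B G H : 'M[C]_d.

Lemma mxtrace_diff_mul A B G H : \tr ((A - B) *m (G - H)) =
  \tr (A *m G) - \tr (A *m H) - (\tr (G *m B) - \tr (B *m H)).
Proof.
by rewrite (mulmxBl A B) (mulmxBr A G H) (mulmxBr B G H) 3!raddfB /= (mxtrace_mulC G).
Qed.

Lemma mxtrace_diff_sq_mul A B G H : \tr ((A - B) *m (A - B) *m (G + H)) =
  \tr (A *m (A *m G)) - \tr (A *m B *m G) -
    (\tr (B *m A *m G) - \tr (G *m (B *m B))) +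
  (\tr (A *m A *m H) - \tr (A *m (B *m H)) -
    (\tr (B *m A *m H) - \tr (B *m (B *m H)))).
Proof.
rewrite mulmxDr linearD /= (mxtrace_mulC G) !mulmxA.
by rewrite mulmxBl !mulmxBr !mulmxBl !raddfB.
Qed.

End trace_expansions.

(** * Traces of powers *)

Section trace_powers.
Context {R : realType} {d : nat}.
Local Notation C := R[i].
Implicit Types (f g : R -> R) (A B : 'M[C]_d) (p q s x c : R).

(** For Hermitian A and q > 0 this is the q-th power of the Schatten q-norm. Working with it
    postpones all roots, and the detour through [mxabs], to the end. *)
Definition trpow q A : R := trR (mxfun (fun x => `|x| `^ q) A).

Lemma trpow_ge0 q A : 0 <= trpow q A.
Proof.
by rewrite /trpow mxfunE trR_udiag ?spectral_unitarymx // sumr_ge0.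
Qed.

Lemma trpow_psd q A : psdmx A -> trpow q A = trR (mxfun (fun x => x `^ q) A).
Proof. by move=> pA; rewrite /trpow (psd_mxfun_norm (fun x => x `^ q)). Qed.

Lemma trpowZ q a A : A \is hermsymmx -> trpow q (a%:C *: A) = `|a| `^ q * trpow q A.
Proof.
move=> hA; rewrite /trpow (mxfun_scale _ _ hA) -trRZ mxfunZ.
have -> // : (fun x : R => `|a * x| `^ q) = fun x => `|a| `^ q * `|x| `^ q.
by apply/funext => x; rewrite normrM powRM.
Qed.

Lemma mxfun_pow2 A : A \is hermsymmx -> A *m A = mxfun (fun x => x * x) A.
Proof. by move=> hA; rewrite -[in LHS](mxfun_id hA) mxfunM. Qed.

Lemma trpow_sq q A : A \is hermsymmx -> trpow q (A *m A) = trpow (2 * q) A.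
Proof.
move=> hA; rewrite /trpow (mxfun_pow2 hA) (mxfun_comp _ _ hA).
have -> // : (fun x : R => `|x| `^ q) \o (fun x => x * x) = fun x => `|x| `^ (2 * q).
by apply/funext => x /=; rewrite powRrM powR_mulrn // normrM expr2.
Qed.

Lemma mxfun_mulid f A : A \is hermsymmx ->
  mxfun (fun x => x * f x) A = A *m mxfun f A.
Proof. by move=> hA; rewrite -(mxfunM id f) mxfun_id. Qed.

Lemma mxfunN f A : mxfun (fun x => - f x) A = - mxfun f A.
Proof.
rewrite -scaleN1r -(rmorph1 (real_complex R)) -rmorphN mxfunZ.
by apply: eq_mxfun => x; rewrite mulN1r.
Qed.

Lemma mxfunB f g A : mxfun f A - mxfun g A = mxfun (fun x => f x - g x) A.
Proof.
rewrite -[in LHS](@mxfunN g) mxfunD; exact: eq_mxfun.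
Qed.

Lemma trR_mxfunZ c f A : c * trR (mxfun f A) = trR (mxfun (fun x => c * f x) A).
Proof. by rewrite -mxfunZ trRZ. Qed.

(** Klein's inequality in its classical form: a scalar subgradient of u is, through the functional
    calculus, a subgradient of tr u. *)
Lemma trace_subgrad (u phi : R -> R) A B :
  (forall x y, u y + (x - y) * phi y <= u x) ->
  A \is hermsymmx -> B \is hermsymmx ->
  trR (mxfun u B) + trR ((A - B) *m mxfun phi B) <= trR (mxfun u A).
Proof.
move=> hu hA hB.
have hs (x y : R) : 0 <= u x + (y * phi y - u y) +
    \sum_(t <- [:: (- 1, id, phi)]) t.1.1 * (t.1.2 x * t.2 y).
  by rewrite big_cons big_nil /=; have := hu x y; lra.
have := klein hA hB hs; rewrite big_cons big_nil /=.
have -> : trR (mxfun (fun y => y * phi y - u y) B) =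
    trR (B *m mxfun phi B) - trR (mxfun u B).
  by rewrite -(mxfunB (fun y => y * phi y)) trRB (mxfun_mulid phi hB).
by rewrite (mxfun_id hA) mulmxBl trRB; lra.
Qed.

Lemma trpow_subgrad q A B : 1 <= q -> A \is hermsymmx -> B \is hermsymmx ->
  trpow q B + trR ((A - B) *m mxfun (fun y => q * (Num.sg y * `|y| `^ (q - 1))) B)
  <= trpow q A.
Proof.
move=> q1; apply: trace_subgrad => x y.
by rewrite mulrCA; exact: subgrad_powR.
Qed.

(** Jensen for A + B as the mean of (a+b)/a A and (a+b)/b B with weights a/(a+b) and b/(a+b). The
    subgradient at A + B is tested on both, and the weights cancel the linear terms. Taking a = b =
    1 gives the power mean bound; taking for a and b the norms gives Minkowski's inequality. *)
Lemma trpow_convex q a b A B : 1 <= q -> 0 < a -> 0 < b ->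
  A \is hermsymmx -> B \is hermsymmx ->
  trpow q (A + B) <= (a + b) `^ q *
    (a / (a + b) * (trpow q A / a `^ q) + b / (a + b) * (trpow q B / b `^ q)).
Proof.
move=> q1 a0 b0 hA hB; have hC := hermD hA hB.
have ab : 0 < a + b by lra.
pose G := mxfun (fun y => q * (Num.sg y * `|y| `^ (q - 1))) (A + B).
have sub (c : R) X : 0 < c -> X \is hermsymmx ->
    trpow q (A + B) + ((a + b) / c * trR (X *m G) - trR ((A + B) *m G)) <=
    (a + b) `^ q * (trpow q X / c `^ q).
  move=> c0 hX.
  have := trpow_subgrad q1 (hermZ ((a + b) / c) hX) hC.
  rewrite -/G mulmxBl trRB -scalemxAl trRZ trpowZ // => /le_trans; apply.
  rewrite le_eqVlt; apply/orP; left; apply/eqP.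
  rewrite gtr0_norm ?divr_gt0 // powRM ?invr_ge0; [|lra..].
  by rewrite -powR_inv1 ?ltW // -powRrM mulN1r powRN; ring.
have hsA := sub a A a0 hA; have hsB := sub b B b0 hB.
have e : trR ((A + B) *m G) = trR (A *m G) + trR (B *m G) by rewrite mulmxDl trRD.
rewrite e in hsA hsB.
have := ler_wpM2l (ltW (divr_gt0 a0 ab)) hsA.
have := ler_wpM2l (ltW (divr_gt0 b0 ab)) hsB.
set u := trR (A *m G); set v := trR (B *m G); set w := (a + b) `^ q.
move=> h1 h2.
rewrite mulrDr [w * (a / _ * _)]mulrCA [w * (b / _ * _)]mulrCA.
apply: le_trans (lerD h2 h1); rewrite -subr_ge0 le_eqVlt; apply/orP; left.
by apply/eqP; field; rewrite !gt_eqF.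
Qed.

(** For s = 2p - 2, [gpow s] is the derivative of |x|^(2p) / (2p), and (2p - 1) [hpow s] is the
    derivative of [gpow s]. *)
Definition hpow s x : R := `|x| `^ s.
Definition gpow s x : R := x * hpow s x.

Lemma trace_prod_le (f g u v : R -> R) A B :
  (forall x y, f x * g y <= u x + v y) ->
  A \is hermsymmx -> B \is hermsymmx ->
  trR (mxfun f A *m mxfun g B) <= trR (mxfun u A) + trR (mxfun v B).
Proof.
move=> huv hA hB.
have hs (x y : R) : 0 <= u x + v y +
    \sum_(t <- [:: (- 1, f, g)]) t.1.1 * (t.1.2 x * t.2 y).
  by rewrite big_cons big_nil /=; have := huv x y; lra.
by have := klein hA hB hs; rewrite big_cons big_nil /=; lra.
Qed.

Lemma trace_young p A X : 1 <= p -> A \is hermsymmx -> X \is hermsymmx ->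
  trR (A *m mxfun (hpow (2 * p - 2)) X) <=
  p^-1 * trpow p A + (1 - p^-1) * trpow (2 * p) X.
Proof.
move=> p1 hA hX; rewrite !trR_mxfunZ -[X in trR (X *m _)](mxfun_id hA).
apply: trace_prod_le => // x y; rewrite /hpow.
apply: le_trans (young_powR2 y p1 (normr_ge0 x)).
by rewrite ler_wpM2r ?powR_ge0 // ler_norm.
Qed.

Lemma trR_diff_mul A B G H : trR ((A - B) *m (G - H)) =
  trR (A *m G) - trR (A *m H) - (trR (G *m B) - trR (B *m H)).
Proof. by rewrite !trRE mxtrace_diff_mul !(ReD, ReN). Qed.

Lemma trR_diff_sq_mul A B G H : trR ((A - B) *m (A - B) *m (G + H)) =
  trR (A *m (A *m G)) - trR (A *m B *m G) - (trR (B *m A *m G) - trR (G *m (B *m B))) +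
  (trR (A *m A *m H) - trR (A *m (B *m H)) - (trR (B *m A *m H) - trR (B *m (B *m H)))).
Proof.
have e (x1 x2 x3 x4 x5 x6 x7 x8 : C) :
    complex.Re (x1 - x2 - (x3 - x4) + (x5 - x6 - (x7 - x8))) =
    complex.Re x1 - complex.Re x2 - (complex.Re x3 - complex.Re x4) +
    (complex.Re x5 - complex.Re x6 - (complex.Re x7 - complex.Re x8)).
  by rewrite !(ReD, ReN).
by rewrite !trRE mxtrace_diff_sq_mul e.
Qed.

Lemma trace_mean_value (h g : R -> R) (c : R) A B :
  (forall x y, (x - y) * (g x - g y) <= c * ((x - y) ^+ 2 * (h x + h y))) ->
  A \is hermsymmx -> B \is hermsymmx ->
  trR ((A - B) *m (mxfun g A - mxfun g B)) <=
  c * trR ((A - B) *m (A - B) *m (mxfun h A + mxfun h B)).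
Proof.
move=> hgc hA hB.
(* The scalar inequality is expanded into products: [F] collects the terms in one variable, the six
   triples below the mixed ones. *)
pose F x := c * (x * (x * h x)) - x * g x.
have hs (x y : R) : 0 <= F x + F y + \sum_(t <- [::
    (- 2 * c, fun x => x * h x, id); (c, h, fun y => y * y);
    (c, fun x => x * x, h); (- 2 * c, id, fun y => y * h y);
    (1, id, g); (1, g, id)]) t.1.1 * (t.1.2 x * t.2 y).
  rewrite !big_cons big_nil /= /F.
  by have := hgc x y; rewrite -subr_ge0; congr (_ <= _); ring.
have := klein hA hB hs; rewrite !big_cons big_nil /=.
have eF (X : 'M[C]_d) : X \is hermsymmx -> trR (mxfun F X) =
    c * trR (X *m (X *m mxfun h X)) - trR (X *m mxfun g X).
  move=> hX.
  have <- : _ = trR (mxfun F X) := congr1 (@trR R d)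
    (mxfunB (fun x => c * (x * (x * h x))) (fun x => x * g x) X).
  rewrite trRB (mxfun_mulid g hX) -(trR_mxfunZ c (fun x => x * (x * h x))).
  by rewrite (mxfun_mulid (fun x => x * h x) hX) (mxfun_mulid h hX).
rewrite (eF _ hA) (eF _ hB) (mxfun_mulid h hA) (mxfun_mulid h hB).
rewrite -(mxfun_pow2 hA) -(mxfun_pow2 hB) (mxfun_id hA) (mxfun_id hB).
have := hermP _ (mxfun_herm h A); have := hermP _ (mxfun_herm h B).
set hA' := mxfun h A; set hB' := mxfun h B.
set gA' := mxfun g A; set gB' := mxfun g B => thB thA.
(* Taking adjoints reverses a product of Hermitian factors without changing [trR]; together with
   cyclicity this puts functions of A to the left of functions of B, the order that [klein]
   produces. *)
have c1 : trR (A *m B *m hA') = trR (A *m hA' *m B).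
  rewrite -[LHS]trR_adj (adjM (A *m B)) (adjM A) (hermP _ hA) (hermP _ hB) thA.
  by rewrite [LHS]trRC -[B *m A *m _]mulmxA [LHS]trRC.
have c2 : trR (B *m A *m hA') = trR (A *m hA' *m B) by rewrite -[B *m A *m _]mulmxA [LHS]trRC.
have c3 : trR (B *m A *m hB') = trR (A *m (B *m hB')).
  rewrite -[LHS]trR_adj (adjM (B *m A)) (adjM B) (hermP _ hA) (hermP _ hB) thB.
  by rewrite [LHS]trRC -mulmxA.
rewrite trR_diff_mul trR_diff_sq_mul c1 c2 c3.
move: (trR _) (trR _) (trR _) (trR _) (trR _) (trR _) (trR _) (trR _) (trR _) (trR _).
move=> *; lra.
Qed.

End trace_powers.

(** * The square function of positive semidefinite matrices *)

Section similar_spectrum.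
Context {F : fieldType} {d : nat}.

Lemma char_poly_conj (P Pi M : 'M[F]_d) : P *m Pi = 1%:M ->
  char_poly (P *m M *m Pi) = char_poly M.
Proof.
move=> PPi; have e : map_mx polyC P *m map_mx polyC Pi = 1%:M.
  by rewrite -map_mxM PPi map_mx1.
rewrite /char_poly /char_poly_mx.
have -> : 'X%:M - map_mx polyC (P *m M *m Pi) =
    map_mx polyC P *m ('X%:M - map_mx polyC M) *m map_mx polyC Pi.
  rewrite mulmxBr mulmxBl !map_mxM mul_mx_scalar -scalemxAl e.
  by rewrite scalemx1.
by rewrite !det_mulmx mulrAC -det_mulmx e det1 mul1r.
Qed.

End similar_spectrum.

Section schur_diagonal.
Context {C : numClosedFieldType} {d : nat}.

(* By Schur triangularization, the eigenvalues of a matrix similar to a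
   Hermitian one are its diagonal entries in some orthonormal basis. *)
Lemma schur_conj_cdiag (U P Pi : 'M[C]_d) (l : 'I_d -> C) (V : nmodType)
    (f : C -> V) : U \is unitarymx -> P *m Pi = 1%:M ->
  exists2 W : 'M[C]_d, W \is unitarymx &
  \sum_i f (l i) = \sum_i f ((W *m (P *m cdiag U l *m Pi) *m W^t*) i i).
Proof.
move=> hU PPi; have [d0|d0] := posnP d.
  (* [Schur] is stated for positive dimension; in dimension 0 both sums are empty. *)
  exists 1%:M; first by apply/unitarymxP; rewrite trmx1 map_mx1 mulmx1.
  by apply: eq_bigr => -[i /= hi]; exfalso; move: hi; rewrite d0.
have [W hW tri] := Schur (P *m cdiag U l *m Pi) d0; exists W => //.
set Z := P *m cdiag U l *m Pi in tri *.
have {}tri : is_trig_mx (W *m Z *m W^t*) by rewrite -conjymx.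
(* Both lists are the roots of the same characteristic polynomial, which similarity preserves and
   which is read off the diagonal of a triangular matrix. *)
have : perm_eq (map l (index_enum 'I_d)) (map (fun i => (W *m Z *m W^t*) i i) (index_enum 'I_d)).
  apply: prod_XsubC_eq; rewrite !big_map -char_poly_trig //.
  rewrite (char_poly_conj _ (unitary_adjVK hW)) (char_poly_conj _ PPi) /cdiag.
  rewrite (char_poly_conj _ (unitary_adjK hU)).
  rewrite char_poly_trig ?diag_mx_is_trig //; apply: eq_bigr => i _.
  by rewrite !mxE eqxx mulr1n.
move=> /(perm_map f) /(perm_big _) h.
by have := h V +%R 0 xpredT id; rewrite !big_map.
Qed.

End schur_diagonal.

Section square_function_algebra.
Context {C : numClosedFieldType} {d : nat}.
Implicit Types A B K N P Q X : 'M[C]_d.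

(** It exhibits 1 - K K^* as a square plus a congruence of 1 - K^* K, so that a bound by 1 passes
    from K^* K to K K^* without singular values. *)
Lemma one_sub_mul_adj K :
  1%:M - K *m K^t* = (1%:M - K *m K^t*) *m (1%:M - K *m K^t*) +
    K *m (1%:M - K^t* *m K) *m K^t*.
Proof.
rewrite !(mulmxBl, mulmxBr) !(mul1mx, mulmx1) !mulmxA.
by rewrite subrK.
Qed.

Lemma mxtrace_square_expand (a b : C) Q P N :
  \tr ((a *: Q - b *: P) *m P *m (a *: Q - b *: P) *m N) =
  a * (a * \tr (Q *m P *m Q *m N)) - a * (b * \tr (Q *m P *m P *m N)) -
  (a * (b * \tr (P *m P *m Q *m N)) - b * (b * \tr (P *m P *m P *m N))).
Proof.
rewrite !mulmxBl !mulmxBr !mulmxBl -!(scalemxAl, scalemxAr) !raddfB /=.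
by rewrite !mxtraceZ.
Qed.

End square_function_algebra.

Lemma powR_mid (R : realType) (p u v : R) : 1 <= p -> 0 <= u -> 0 <= v ->
  ((u + v) / 2) `^ p <= (u `^ p + v `^ p) / 2.
Proof.
move=> p1 u0 v0.
have := subgrad_powR u ((u + v) / 2) p1; have := subgrad_powR v ((u + v) / 2) p1.
rewrite (ger0_norm u0) (ger0_norm v0) ger0_norm ?divr_ge0 ?addr_ge0 //.
by move: (Num.sg _ * _) => z; nra.
Qed.

Section square_function_pointwise.
Context {R : realType} {d : nat}.
Local Notation C := R[i].
Implicit Types A B K N P Q X : 'M[C]_d.

Lemma psd_one_sub_swap K :
  psdmx (1%:M - K^t* *m K) -> psdmx (1%:M - K *m K^t*).
Proof.
move=> h; rewrite one_sub_mul_adj; apply: psdD.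
  apply: psd_sq; apply: hermB.
    by have := @herm_scalar R d 1; rewrite rmorph1.
  by apply/hermP; rewrite adjM trmxCK.
by have := psd_congr (K^t*) h; rewrite trmxCK.
Qed.

(** With K = P^(1/2) Ri, the hypothesis says K^* K <= 1, hence K K^* = P^(1/2) Ri^2 P^(1/2) <= 1;
    pairing with |P|^p gives the claim. This stands in for antitonicity of the inverse and covers
    singular P. *)
Lemma trace_inverse_le p P Ri : psdmx P -> Ri \is hermsymmx ->
  psdmx (1%:M - Ri *m P *m Ri) ->
  trR (mxfun (fun x => `|x| * `|x| `^ p) P *m (Ri *m Ri)) <= trpow p P.
Proof.
move=> pP /hermP hRi h.
pose Ph := mxfun (fun x => Num.sqrt `|x|) P.
have hPh : Ph^t* = Ph by apply/hermP; exact: mxfun_herm.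
have PhPh : Ph *m Ph = P.
  rewrite /Ph mxfunM -[RHS](mxfun_id (psd_herm pP)) -[RHS](psd_mxfun_norm _ pP).
  by apply: eq_mxfun => x; rewrite -expr2 sqr_sqrtr.
pose K := Ph *m Ri.
have eK : K^t* = Ri *m Ph by rewrite adjM hPh hRi.
have : psdmx (1%:M - K *m K^t*).
  apply: psd_one_sub_swap; rewrite eK /K.
  have -> // : Ri *m Ph *m (Ph *m Ri) = Ri *m P *m Ri.
  by rewrite mulmxA -(mulmxA Ri) PhPh.
set D := mxfun (fun x => `|x| `^ p) P.
have pD : psdmx D by apply: psd_mxfun => x; exact: powR_ge0.
move=> /(psd_trM_ge0 pD); rewrite mulmxBr mulmx1 trRB subr_ge0 /trpow -/D.
have -> // : trR (D *m (K *m K^t*)) =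
  trR (mxfun (fun x => `|x| * `|x| `^ p) P *m (Ri *m Ri)).
rewrite eK /K [LHS]trRC.
have -> : Ph *m Ri *m (Ri *m Ph) *m D = Ph *m (Ri *m Ri) *m (Ph *m D).
  by rewrite !mulmxA.
have -> : mxfun (fun x => `|x| * `|x| `^ p) P = Ph *m D *m Ph.
  rewrite /Ph /D !mxfunM; apply: eq_mxfun => x.
  by rewrite mulrAC -expr2 sqr_sqrtr.
by rewrite [LHS]trRC mulmxA.
Qed.

Lemma Re_square_expand (a b : R) (x y z w : C) :
  complex.Re (a%:C * (a%:C * x) - a%:C * (b%:C * y) -
    (a%:C * (b%:C * z) - b%:C * (b%:C * w))) =
  a * (a * complex.Re x) - a * (b * complex.Re y) -
    (a * (b * complex.Re z) - b * (b * complex.Re w)).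
Proof. by case: x y z w => [? ?] [? ?] [? ?] [? ?] /=; ring. Qed.

(** Expand 0 <= tr(X P X N) for X = a Q - b P. The two cross terms have the same real trace, being
    adjoint to each other up to cyclic order, and a b = 1. *)
Lemma trace_square_amgm (a b : R) P Q N : a * b = 1 -> psdmx P ->
  Q \is hermsymmx -> psdmx N ->
  2 * trR (P *m P *m N *m Q) <=
  a ^+ 2 * trR (Q *m P *m Q *m N) + b ^+ 2 * trR (P *m P *m P *m N).
Proof.
move=> ab pP hQ pN.
have amgm (x y z1 z2 w : R) : z1 = w -> z2 = w ->
    0 <= a * (a * x) - a * (b * z1) - (a * (b * z2) - b * (b * y)) ->
    2 * w <= a ^+ 2 * x + b ^+ 2 * y.
  by move=> -> ->; rewrite !mulrA ab -!expr2 !mul1r; clear; lra.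
have hP := psd_herm pP; have hN := psd_herm pN.
pose X := a%:C *: Q - b%:C *: P.
have hX : X^t* = X by apply/hermP/hermB; exact: hermZ.
have eX : trR (X *m P *m X *m N) =
    a * (a * trR (Q *m P *m Q *m N)) - a * (b * trR (Q *m P *m P *m N)) -
    (a * (b * trR (P *m P *m Q *m N)) - b * (b * trR (P *m P *m P *m N))).
  by rewrite trRE mxtrace_square_expand Re_square_expand !trRE.
have sum_ge0 := psd_trM_ge0 (psd_congr X pP) pN; rewrite hX eX in sum_ge0.
have e1 : trR (Q *m P *m P *m N) = trR (P *m P *m N *m Q).
  by rewrite -!mulmxA trRC !mulmxA.
have e2 : trR (P *m P *m Q *m N) = trR (P *m P *m N *m Q).
  rewrite -[LHS]trR_adj !adjM (hermP _ hP) (hermP _ hN) (hermP _ hQ).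
  by rewrite mulmxA [LHS]trRC mulmxA.
exact: amgm e1 e2 sum_ge0.
Qed.

End square_function_pointwise.

Section rank_one_projections.
Context {C : numClosedFieldType} {d : nat}.

Lemma sum_cdiag_delta (W : 'M[C]_d) : W \is unitarymx ->
  \sum_i cdiag W (fun j => (j == i)%:R) = 1%:M.
Proof.
move=> hW; rewrite -(cdiag_cst 1 hW); apply/matrixP => a b.
rewrite summxE cdiagE; under eq_bigr do rewrite cdiagE.
rewrite exchange_big /=; apply: eq_bigr => k _.
rewrite -mulr_suml; congr (_ * _).
by rewrite (bigD1 k) //= eqxx big1 ?addr0 // => i /negPf; rewrite eq_sym => ->.
Qed.

(** Diagonal entries in the basis W become traces against rank-one projections, so trace
    inequalities apply entry by entry. *)
Lemma mxtrace_mul_cdiag_delta (M W : 'M[C]_d) i :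
  \tr (M *m cdiag W (fun j => (j == i)%:R)) = (W *m M *m W^t*) i i.
Proof.
have -> : \tr (M *m cdiag W (fun j => (j == i)%:R)) =
    \tr (diag_mx (\row_j (j == i)%:R) *m (W *m M *m W^t*)).
  by rewrite /cdiag !mulmxA mxtrace_mulC !mulmxA mxtrace_mulC !mulmxA.
rewrite mul_diag_mx /mxtrace (bigD1 i) //= big1 => [|j /negPf ji].
  by rewrite addr0 [LHS]mxE !mxE eqxx mul1r.
by rewrite !mxE ji mul0r.
Qed.

End rank_one_projections.

Section square_function.
Context {R : realType} {d : nat}.
Local Notation C := R[i].
Implicit Types A B K N P Q X : 'M[C]_d.

Lemma trR_mxfun_lin (F f w : R -> R) (a b : R) A B :
  trR (mxfun (fun x => F x + (a * f x + b * w x)) A *m B) =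
  trR (mxfun F A *m B) + (a * trR (mxfun f A *m B) + b * trR (mxfun w A *m B)).
Proof.
by rewrite -(mxfunD F) -(mxfunD (fun x => a * f x)) -!mxfunZ !mulmxDl !trRD
  -!scalemxAl !trRZ.
Qed.

Lemma trR_mxfun_congr (f r : R -> R) A B :
  trR (mxfun f A *m (mxfun r A *m B *m mxfun r A)) =
  trR (mxfun (fun x => r x * (f x * r x)) A *m B).
Proof.
rewrite -(mxfunM r (fun x => f x * r x)) -(mxfunM f r).
by rewrite mulmxA [LHS]trRC !mulmxA.
Qed.

(** Jensen's inequality for t^p: the traces against B of the spectral projections of the A_k,
    weighted by w, form a measure of mass at most 1. The tangent line at the mean b leaves (p-1) b^p
    times the missing mass, which has the favourable sign. *)
Lemma trace_jensen n (A : 'I_n -> 'M[C]_d) B p (w f F : R -> R) : 1 <= p ->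
  psdmx B -> (forall x, 0 <= w x) ->
  (forall x, 0 <= f x) -> (forall x, f x `^ p <= F x) ->
  \sum_k trR (mxfun w (A k) *m B) <= 1 ->
  (\sum_k trR (mxfun (fun x => w x * f x) (A k) *m B)) `^ p <=
  \sum_k trR (mxfun (fun x => w x * F x) (A k) *m B).
Proof.
move=> p1 pB w0 f0 fF hw; set b := \sum_k _.
have b0 : 0 <= b.
  apply: sumr_ge0 => k _; apply: psd_trM_ge0 pB; apply: psd_mxfun => x.
  exact: mulr_ge0.
pose phi := p * (Num.sg b * `|b| `^ (p - 1)).
have phib : phi * b = p * b `^ p.
  rewrite /phi -mulrA mulrAC -normrEsg (ger0_norm b0) mulr_powRB1 //; lra.
have hk k : 0 <= trR (mxfun (fun x => w x * F x) (A k) *m B) +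
    (- phi * trR (mxfun (fun x => w x * f x) (A k) *m B) +
     (p - 1) * b `^ p * trR (mxfun w (A k) *m B)).
  rewrite -(trR_mxfun_lin (fun x => w x * F x) (fun x => w x * f x) w).
  apply: psd_trM_ge0 pB; apply: psd_mxfun => x.
  have -> : w x * F x + (- phi * (w x * f x) + (p - 1) * b `^ p * w x) =
      w x * (F x - (b `^ p + (f x - b) * phi)).
    by rewrite [(f x - b) * phi]mulrBl (mulrC b phi) phib; ring.
  rewrite mulr_ge0 // subr_ge0; apply: le_trans (fF x).
  have := subgrad_powR (f x) b p1; rewrite (ger0_norm b0) (ger0_norm (f0 x)).
  by rewrite /phi (ger0_norm b0) mulrCA.
have := @sumr_ge0 R 'I_n (index_enum _) xpredT _ (fun k _ => hk k).
rewrite !big_split /= -!mulr_sumr -/b mulNr phib.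
have := powR_ge0 b p; set y := b `^ p; set S1 := \sum_k _ => y0.
have p1' : 0 <= p - 1 by lra.
by have := ler_wpM2l (mulr_ge0 p1' y0) hw; lra.
Qed.

End square_function.

Section square_function_inequality.
Context {R : realType} {d : nat}.
Local Notation C := R[i].
Implicit Types A B K N P Q X : 'M[C]_d.

Lemma psd_delta (W : 'M[C]_d) i : psdmx (cdiag W (fun j => (j == i)%:R)).
Proof.
have -> : cdiag W (fun j => (j == i)%:R) = udiag W (fun j => (j == i)%:R).
  by rewrite /udiag; apply: eq_cdiag => j; rewrite rmorph_nat.
by apply: udiag_psd => j; rewrite ler0n.
Qed.

(** The shift e makes Qe = |Q| + e invertible. With r its square root, S = sum P_k^2 has the
    eigenvalues of r S r^-1, and a Schur basis W shows them on the diagonal. For E_i the projection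
    on the i-th basis vector and N_i = r^-1 E_i r^-1, the i-th entry is sum_k tr(P_k^2 N_i Qe). The
    arithmetic-geometric mean inequality separates Q from the P_k, and Jensen moves the p-th power
    inside each part before the sum over i. *)
Lemma trpow_sum_sq_le_eps n (P : 'I_n -> 'M[C]_d) (p s e : R) :
  1 <= p -> 0 < s -> 0 < e -> (forall k, psdmx (P k)) ->
  trpow p (\sum_k P k *m P k) <=
  (s * trR (mxfun (fun x => (`|x| + e) `^ (2 * p)) (\sum_k P k)) +
   s^-1 * \sum_k trpow (2 * p) (P k)) / 2.
Proof.
move=> p1 s0 e0 pP; have p0 : 0 < p by lra.
set Q := \sum_k P k; set S := \sum_k P k *m P k.
have pQ : psdmx Q by exact: psd_sum.
have pS : psdmx S by apply: psd_sum => k _; exact: psd_sq (psd_herm (pP k)).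
have xe0 (x : R) : 0 < `|x| + e by rewrite ltr_wpDl.
pose r (x : R) := Num.sqrt (`|x| + e); pose ri x := (r x)^-1.
have r0 x : 0 < r x by rewrite sqrtr_gt0.
have rr x : r x * r x = `|x| + e by rewrite -expr2 sqr_sqrtr // ltW.
have rri x : r x * ri x = 1 by rewrite divff // gt_eqF.
pose Rt := mxfun r Q; pose Ri := mxfun ri Q.
have RtRi : Rt *m Ri = 1%:M.
  by rewrite /Rt /Ri mxfunM -(mxfun_one Q); exact: eq_mxfun.
have RiRt : Ri *m Rt = 1%:M by exact: mulmx1C.
have ri_le1 (x : R) : 0 <= 1 - ri x * (`|x| * ri x).
  have := xe0 x; have := rr x; have := r0 x; rewrite /ri => rx0 rrx xe.
  have -> : 1 - (r x)^-1 * (`|x| * (r x)^-1) = e / (r x * r x).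
    by have -> : e = r x * r x - `|x| by [lra|]; field; rewrite gt_eqF.
  by rewrite divr_ge0 ?mulr_ge0 // ltW.
have hRi : Ri^t* = Ri by apply/hermP/mxfun_herm.
pose Qe := mxfun (fun x => `|x| + e) Q.
have hQe : Qe \is hermsymmx by exact: mxfun_herm.
have RtRt : Rt *m Rt = Qe by rewrite /Rt mxfunM; exact: eq_mxfun.
have QE : mxfun (fun x => `|x|) Q = Q.
  by rewrite (psd_mxfun_norm id pQ) (mxfun_id (psd_herm pQ)).
have [U [l [hU eS hS]]] := herm_udiag (psd_herm pS).
have l0 : forall j, 0 <= l j by apply: psd_udiag hU _; rewrite -eS.
(* The map must accept complex entries; truncating the real part at 0 is harmless because the
   eigenvalues are nonnegative. *)
have [W hW eW] := schur_conj_cdiag (fun j => (l j)%:C)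
  (fun z : C => (Num.max 0 (complex.Re z)) `^ p) hU RtRi.
rewrite -/(udiag U l) -eS in eW.
have {eW} trS : trpow p S = \sum_i
    (Num.max 0 (complex.Re ((W *m (Rt *m S *m Ri) *m W^t*) i i))) `^ p.
  rewrite -eW trpow_psd // hS trR_udiag //; apply: eq_bigr => j _ /=.
  by rewrite max_r.
pose E i := cdiag W (fun j : 'I_d => (j == i)%:R).
pose N i := Ri *m E i *m Ri.
have pE i : psdmx (E i) by exact: psd_delta.
have pN i : psdmx (N i) by have := psd_congr Ri (pE i); rewrite hRi.
have sE : \sum_i E i = 1%:M by exact: sum_cdiag_delta.
have trE i : trR (E i) = 1.
  rewrite /E -(mul1mx (cdiag _ _)) trRE mxtrace_mul_cdiag_delta mulmx1.
  by rewrite unitary_adjVK // mxE eqxx.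
have trN f i : trR (mxfun f Q *m N i) =
    trR (mxfun (fun x => ri x * (f x * ri x)) Q *m E i).
  exact: trR_mxfun_congr.
have tE i : complex.Re ((W *m (Rt *m S *m Ri) *m W^t*) i i) =
    \sum_k trR (P k *m P k *m N i *m Qe).
  rewrite -mxtrace_mul_cdiag_delta -/(E i) -trRE -trR_sum -!mulmx_suml -/S.
  rewrite -RtRt /N.
  have -> : S *m (Ri *m E i *m Ri) *m (Rt *m Rt) = S *m Ri *m E i *m Rt.
    by rewrite !mulmxA -(mulmxA _ Ri Rt) RiRt mulmx1.
  rewrite -(mulmxA (Rt *m S) Ri (E i)) -(mulmxA Rt S (Ri *m E i)) [LHS]trRC.
  by rewrite (mulmxA S Ri (E i)).
(* The weight is balanced before taking p-th powers, so that t^p = s. *)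
pose t := s `^ p^-1.
have t0 : 0 < t by exact: powR_gt0.
have tp : t `^ p = s by rewrite /t -powRrM mulVf ?powRr1 ?gt_eqF // ltW.
pose al i := \sum_(k < 1) trR (mxfun (fun x => 1 * ((`|x| + e) * `|x|)) Q *m E i).
pose be i := \sum_k trR (mxfun (fun x => `|x| * (`|x| * `|x|)) (P k) *m N i).
have tle i : 2 * (\sum_k trR (P k *m P k *m N i *m Qe)) <= t * al i + t^-1 * be i.
  have -> : al i = \sum_k trR (Qe *m P k *m Qe *m N i).
    rewrite -trR_sum -!mulmx_suml -mulmx_sumr -/Q.
    have -> : Qe *m Q *m Qe =
        mxfun (fun x => (`|x| + e) * `|x| * (`|x| + e)) Q.
      by rewrite -[in Qe *m Q]QE /Qe !mxfunM.
    rewrite trN /al big_ord1; congr (trR (_ *m _)); apply: eq_mxfun => x.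
    have := rr x; have := rri x; have := r0 x; rewrite /ri => rx0 _ <-.
    by field; rewrite gt_eqF.
  rewrite !mulr_sumr -big_split /=; apply: ler_sum => k _.
  have -> : mxfun (fun x => `|x| * (`|x| * `|x|)) (P k) = P k *m P k *m P k.
    rewrite -[X in _ = X *m X *m X](mxfun_id (psd_herm (pP k))).
    rewrite -(psd_mxfun_norm id (pP k)) !mxfunM; apply: eq_mxfun => x.
    by rewrite mulrA.
  have := @trace_square_amgm _ _ (Num.sqrt t) (Num.sqrt t)^-1 _ _ _ _ (pP k) hQe (pN i).
  rewrite divff ?gt_eqF ?sqrtr_gt0 // => /(_ erefl).
  by rewrite exprVn sqr_sqrtr // ltW.
(* The measure here is that of Q in the state E_i, of mass tr E_i = 1. The one-term sum in [al] fits
   the shape of [trace_jensen]. *)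
have jal i : al i `^ p <= trR (mxfun (fun x => (`|x| + e) `^ (2 * p)) Q *m E i).
  have := @trace_jensen _ _ 1 (fun=> Q) (E i) p (fun=> 1)
    (fun x => (`|x| + e) * `|x|) (fun x => (`|x| + e) `^ (2 * p)) p1 (pE i).
  rewrite big_ord1 mxfun_one mul1mx trE.
  have -> : mxfun (fun x => 1 * (`|x| + e) `^ (2 * p)) Q =
    mxfun (fun x => (`|x| + e) `^ (2 * p)) Q.
    by apply: eq_mxfun => x; rewrite mul1r.
  rewrite [X in _ -> _ -> _ -> _ -> _ <= X]big_ord1; apply => // x.
    by rewrite mulr_ge0 // ltW.
  rewrite powRrM ge0_ler_powR ?nnegrE ?mulr_ge0 ?powR_ge0 //; [lra|exact: ltW|].
  rewrite powR_mulrn ?(ltW (xe0 x)) // expr2 ler_wpM2l ?(ltW (xe0 x)) //; lra.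
(* The weights |x| of all P_k against N_i have total mass tr(Q N_i) = tr(r^-1 Q r^-1 E_i) <= 1,
   since Q <= Qe. *)
have jbe i : be i `^ p <=
    \sum_k trR (mxfun (fun x => `|x| * `|x| `^ (2 * p)) (P k) *m N i).
  refine (@trace_jensen _ _ _ P (N i) p (fun x => `|x|)
    (fun x => `|x| * `|x|) (fun x => `|x| `^ (2 * p)) p1 (pN i) _ _ _ _).
  - by move=> x; exact: normr_ge0.
  - by move=> x; rewrite mulr_ge0.
  - by move=> x; rewrite powRrM powR_mulrn // expr2.
  - have -> : \sum_k trR (mxfun (fun x => `|x|) (P k) *m N i) = trR (Q *m N i).
      rewrite /Q mulmx_suml trR_sum; apply: eq_bigr => k _.
      by rewrite (psd_mxfun_norm id (pP k)) (mxfun_id (psd_herm (pP k))).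
    rewrite -QE trN -(trE i) -subr_ge0 -trRB -[X in X - _]mul1mx -(mxfun_one Q).
    rewrite -mulmxBl mxfunB; apply: psd_trM_ge0 (pE i); apply: psd_mxfun => x.
    exact: ri_le1.
have sal : \sum_i al i `^ p <= trR (mxfun (fun x => (`|x| + e) `^ (2 * p)) Q).
  apply: (le_trans (ler_sum _ (fun i _ => jal i))).
  by rewrite -trR_sum -mulmx_sumr sE mulmx1.
have sN : \sum_i N i = Ri *m Ri.
  by rewrite /N -mulmx_suml -mulmx_sumr sE mulmx1.
(* The N_i sum to the inverse of Qe, and P_k <= Q <= Qe lets [trace_inverse_le] reduce the power 2p
   + 1 to 2p. *)
have sbe : \sum_i be i `^ p <= \sum_k trpow (2 * p) (P k).
  apply: (le_trans (ler_sum _ (fun i _ => jbe i))).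
  rewrite exchange_big /=; apply: ler_sum => k _.
  rewrite -trR_sum -mulmx_sumr sN.
  refine (trace_inverse_le (2 * p) (pP k) (introT (hermP _) hRi) _).
  have -> : 1%:M - Ri *m P k *m Ri =
      (1%:M - Ri *m Q *m Ri) + Ri *m (Q - P k) *m Ri.
    by rewrite mulmxBr mulmxBl addrA subrK.
  apply: psdD.
    rewrite -QE -(mxfun_one Q) /Ri !mxfunM mxfunB; apply: psd_mxfun => x.
    rewrite -mulrA; exact: ri_le1.
  have pQk : psdmx (Q - P k).
    have -> : Q - P k = \sum_(j | j != k) P j.
      by rewrite /Q (bigD1 k isT) addrAC subrr add0r.
    by apply: psd_sum => j _; exact: pP.
  by have := psd_congr Ri pQk; rewrite hRi.
rewrite trS; apply: (@le_trans _ _ (\sum_i ((s * al i `^ p + s^-1 * be i `^ p) / 2))).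
  apply: ler_sum => i _; rewrite tE.
  have a0 : 0 <= al i.
    rewrite /al big_ord1; apply: psd_trM_ge0 (pE i); apply: psd_mxfun => x.
    by rewrite mul1r mulr_ge0 // ltW.
  have b0 : 0 <= be i.
    apply: sumr_ge0 => k _; apply: psd_trM_ge0 (pN i); apply: psd_mxfun => x.
    by rewrite !mulr_ge0.
  have u0 : 0 <= t * al i by rewrite mulr_ge0 // ltW.
  have v0 : 0 <= t^-1 * be i by rewrite mulr_ge0 // invr_ge0 ltW.
  apply: (@le_trans _ _ (((t * al i + t^-1 * be i) / 2) `^ p)).
    apply: ge0_ler_powR; rewrite ?nnegrE ?le_max ?lexx ?(ltW p0) //.
      by rewrite divr_ge0 // addr_ge0.
    rewrite ge_max divr_ge0 ?addr_ge0 //=.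
    by have := tle i; lra.
  apply: (le_trans (powR_mid p1 u0 v0)).
  rewrite (powRM _ (ltW t0)) // (powRM _ _ b0) ?invr_ge0 ?(ltW t0) //.
  by rewrite -powR_inv1 ?(ltW t0) // powRAC tp powR_inv1 // ltW.
rewrite -mulr_suml ler_pM2r ?invr_gt0 // big_split /= -!mulr_sumr.
by apply: lerD; rewrite ler_wpM2l ?invr_ge0 ?(ltW s0).
Qed.

End square_function_inequality.

(** * Removing the shift, and entrywise bounds by traces *)

Section trace_bounds.
Context {R : realType} {d : nat}.
Local Notation C := R[i].
Implicit Types (A B P Q : 'M[C]_d) (f g : R -> R).

Lemma trR_mxfunE A : exists l : 'I_d -> R,
  forall f, trR (mxfun f A) = \sum_j f (l j).
Proof.
exists (fun j => complex.Re (spectral_diag A 0 j)) => f.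
by rewrite mxfunE trR_udiag // spectral_unitarymx.
Qed.

Lemma ler_trR_mxfun f g A : (forall x, f x <= g x) ->
  trR (mxfun f A) <= trR (mxfun g A).
Proof. by move=> fg; have [l e] := trR_mxfunE A; rewrite !e ler_sum. Qed.

(** The shift e is removed by a Lipschitz estimate: for e <= 1 the tangent line of t^q bounds the
    increase of tr(|Q| + e)^q by e K. *)
Lemma trpow_sum_sq_le n (P : 'I_n -> 'M[C]_d) (p s : R) :
  1 <= p -> 0 < s -> (forall k, psdmx (P k)) ->
  trpow p (\sum_k P k *m P k) <=
  (s * trpow (2 * p) (\sum_k P k) + s^-1 * \sum_k trpow (2 * p) (P k)) / 2.
Proof.
move=> p1 s0 pP; set q := 2 * p.
have q1 : 1 <= q by rewrite /q; lra.
set Q := \sum_k P k.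
pose dq (x : R) := q * (`|x| + 1) `^ (q - 1).
pose K := trR (mxfun dq Q).
have K0 : 0 <= K.
  have [l e] := trR_mxfunE Q; rewrite /K e sumr_ge0 // => j _.
  by rewrite mulr_ge0 ?powR_ge0 //; lra.
have lip e : 0 < e <= 1 ->
    trR (mxfun (fun x => (`|x| + e) `^ q) Q) <= trpow q Q + e * K.
  move=> /andP[e0 e1].
  rewrite /trpow /K trR_mxfunZ -trRD mxfunD; apply: ler_trR_mxfun => x.
  have xe0 : 0 < `|x| + e by rewrite ltr_wpDl.
  have := subgrad_powR `|x| (`|x| + e) q1.
  rewrite normr_id (gtr0_norm xe0) (gtr0_sg xe0) mul1r.
  have : (`|x| + e) `^ (q - 1) <= (`|x| + 1) `^ (q - 1).
    apply: ge0_ler_powR; rewrite ?nnegrE; [lra|exact: ltW| |lra].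
    by rewrite addr_ge0.
  have q0 : 0 <= q by lra.
  move=> /(ler_wpM2l (ltW e0)) /(ler_wpM2l q0); rewrite /dq.
  by move: (_ `^ (q - 1)) (_ `^ (q - 1)) => u v; nra.
apply/ler_addgt0Pr => eta eta0.
(* The added 1 keeps the denominator positive when K = 0; this choice gives s e K <= eta. *)
pose e := Num.min 1 (eta / (s * K + 1)).
have sK0 : 0 < s * K + 1 by rewrite ltr_wpDl // mulr_ge0 // ltW.
have e0 : 0 < e by rewrite lt_min ltr01 divr_gt0.
have e1 : e <= 1 by rewrite ge_min lexx.
have := trpow_sum_sq_le_eps p1 s0 e0 pP; rewrite -/q -/Q => /le_trans; apply.
have esK : s * (e * K) <= eta.
  have : e * (s * K + 1) <= eta by rewrite -ler_pdivlMr // ge_min lexx orbT.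
  by have := ltW e0; nra.
have := ler_wpM2l (ltW s0) (lip e _); rewrite e0 e1 => /(_ isT).
by rewrite mulrDr; lra.
Qed.

Lemma normC_unitary_le1 (U : 'M[C]_d) i j : U \is unitarymx -> `|U i j| <= 1.
Proof.
move=> hU; rewrite -ler_sqr ?nnegrE //.
rewrite expr1n normCK.
have := congr1 (fun M : 'M[C]_d => M i i) (unitary_adjVK hU).
rewrite !mxE eqxx mulr1n (bigD1 j) //= => <-.
rewrite !mxE lerDl sumr_ge0 // => k _.
by rewrite !mxE mul_conjC_ge0.
Qed.

Lemma normC_real (a : R) : `|a%:C| = `|a|%:C :> C.
Proof. by rewrite normc_def /= expr0n /= addr0 sqrtr_sqr. Qed.

Lemma normC_mxfun_le f A i j :
  `|mxfun f A i j| <= (trR (mxfun (fun x => `|f x|) A))%:C.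
Proof.
rewrite !mxfunE trR_udiag ?spectral_unitarymx // /udiag cdiagE.
rewrite rmorph_sum /=; apply: le_trans (ler_norm_sum _ _ _) _.
apply: ler_sum => k _; rewrite !normrM norm_conjC.
rewrite -[leRHS]mulr1 ler_pM // ?mulr_ge0 //.
  by rewrite normC_real.
by rewrite mulr_ile1 // normC_unitary_le1 // spectral_unitarymx.
Qed.

Lemma sum_sum_affine (a b : 'I_d -> R) : \sum_i \sum_j (1 + a i + b j) =
  d%:R ^+ 2 + d%:R * (\sum_i a i) + d%:R * (\sum_j b j).
Proof.
have e i : \sum_j (1 + a i + b j) = d%:R + d%:R * a i + \sum_j b j.
  by rewrite big_split /= sumr_const card_ord mulrnDl -(mulr_natl (a i)).
under eq_bigr do rewrite e.
rewrite !big_split /= -mulr_sumr !sumr_const card_ord.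
by rewrite -(mulr_natl d%:R) -(mulr_natl (\sum_j b j)) expr2.
Qed.

(** Each entry of f(A) is at most tr |f(A)|. One factor d comes from the matrix product, the other
    two from summing the scalar bound over all pairs of eigenvalues. *)
Lemma normC_mxfunM_le (q : R) f g A B i j :
  (forall x y, `|f x| * `|g y| <= 1 + `|x| `^ q + `|y| `^ q) ->
  `|(mxfun f A *m mxfun g B) i j| <=
  (d%:R ^+ 3 * (1 + trpow q A + trpow q B))%:C.
Proof.
move=> fg; set a := trR (mxfun (fun x => `|f x|) A).
set b := trR (mxfun (fun x => `|g x|) B).
have ab : a * b <= d%:R ^+ 2 * (1 + trpow q A + trpow q B).
  rewrite /a /b.
  have [l eA] := trR_mxfunE A; have [m eB] := trR_mxfunE B; rewrite eA eB.
  rewrite mulr_suml; under eq_bigr do rewrite mulr_sumr.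
  apply: (@le_trans _ _ (\sum_i \sum_j (1 + `|l i| `^ q + `|m j| `^ q))).
    by apply: ler_sum => x _; apply: ler_sum => y _; exact: fg.
  rewrite sum_sum_affine /trpow eA eB.
  set X := \sum_i `|l i| `^ q; set Y := \sum_j `|m j| `^ q.
  have X0 : 0 <= X by rewrite sumr_ge0 // => ? _; exact: powR_ge0.
  have Y0 : 0 <= Y by rewrite sumr_ge0 // => ? _; exact: powR_ge0.
  have d0 : d%:R <= d%:R ^+ 2 :> R.
    by rewrite -natrX ler_nat; by case: (d) => // k; rewrite expnS expn1 leq_pmulr.
  rewrite !mulrDr mulr1.
  by have := ler_wpM2r X0 d0; have := ler_wpM2r Y0 d0; lra.
rewrite mxE; apply: le_trans (ler_norm_sum _ _ _) _.
apply: (@le_trans _ _ (\sum_(k < d) (a * b)%:C)).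
  apply: ler_sum => k _; rewrite normrM rmorphM /= ler_pM //; exact: normC_mxfun_le.
rewrite sumr_const card_ord -rmorphMn /= lecR -mulr_natl.
by rewrite exprS -mulrA ler_wpM2l.
Qed.

Lemma ReIm_le_normC (z : C) (b : R) : `|z| <= b%:C ->
  `|complex.Re z| <= b /\ `|complex.Im z| <= b.
Proof.
move=> zb; split.
  by rewrite -lecR; apply: le_trans (normc_ge_Re z) zb.
have := normc_ge_Re (z * 'i%C); rewrite ReiNIm normrN => h.
rewrite -lecR; apply: (le_trans h); rewrite normrM.
by rewrite (_ : `|'i%C| = 1 :> C) ?mulr1 // normc_def /= expr0n expr1n add0r sqrtr1.
Qed.

End trace_bounds.

(** * Measurability of the functional calculus *)

Section borel_class.
Context {R : realType}.
Variable F : (R -> R) -> Prop.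
Hypothesis F_id : F id.
Hypothesis F_cst : forall c, F (fun=> c).
Hypothesis F_add : forall f g, F f -> F g -> F (fun x => f x + g x).
Hypothesis F_mul : forall f g, F f -> F g -> F (fun x => f x * g x).
Hypothesis F_lim : forall (f_ : (R -> R)^nat) (f : R -> R), (forall n, F (f_ n)) ->
  (forall x, f_ ^~ x @ \oo --> f x) -> F f.

Let F_ext f g : F f -> f =1 g -> F g.
Proof. by move=> Ff /funext <-. Qed.

Let F_sum n (f : nat -> R -> R) : (forall k, F (f k)) ->
  F (fun x => \sum_(k < n) f k x).
Proof.
move=> Ff; elim: n => [|n ih].
  by apply: (F_ext (F_cst 0)) => x; rewrite big_ord0.
by apply: (F_ext (F_add ih (Ff n))) => x; rewrite big_ord_recr.
Qed.

Let F_expR f : F f -> F (expR \o f).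
Proof.
move=> Ff; have FX k : F (fun x => f x ^+ k).
  elim: k => [|k ih]; first exact: F_cst.
  by apply: (F_ext (F_mul Ff ih)) => x; rewrite exprS.
apply: (F_lim (f_ := fun n x => series (exp_coeff (f x)) n)).
  move=> n; apply: (@F_ext (fun x => \sum_(k < n) (k`!%:R^-1 * f x ^+ k))).
    by apply: (@F_sum n (fun k x => k`!%:R^-1 * f x ^+ k)) => k; apply: F_mul.
  move=> x; rewrite /series /= big_mkord; apply: eq_bigr => k _.
  by rewrite exp_coeffE.
by move=> x; exact: is_cvg_series_exp_coeff.
Qed.

(* exp(- exp(n (x - c))) tends to 1, 1/e or 0 according as x < c, x = c or
   c < x, and a quadratic polynomial then separates the last case. *)
Let F_ray (c : R) : F (\1_(`]c, +oo[%classic)).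
Proof.
pose L (x : R) : R := if x < c then 1 else if x == c then expR (-1) else 0.
have FL : F L.
  apply: (F_lim (f_ := fun n x => expR (- 1 * expR (n%:R * (x + - c))))).
    move=> n; apply: F_expR; apply: F_mul => //; apply: F_expR.
    by apply: F_mul => //; exact: F_add.
  move=> x; rewrite /L; have [xc|cx|->] := ltgtP x c; last first.
  - rewrite subrr; under eq_fun do rewrite mulr0 expR0 mulr1; exact: cvg_cst.
  - have cx0 : 0 < x - c by rewrite subr_gt0.
    under eq_fun do rewrite mulN1r.
    apply: (cvg_comp (fun n => expR (n%:R * (x - c))) (fun y => expR (- y))).
      apply/cvgryPge => A; near=> n.
      apply: le_trans (expR_ge1Dx _); rewrite -lerBlDl -ler_pdivrMr //.
      by near: n; exact: nbhs_infty_ger.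
    exact: cvgr_expR.
  - suff : expR (- 1 * expR (n%:R * (x + - c))) @[n --> \oo] --> expR (-1 * 0).
      by rewrite mulr0 expR0.
    apply: continuous_cvg; first exact: continuous_expR.
    apply: cvgMl_tmp.
    under eq_fun do rewrite expRM_natl.
    apply: cvg_expr; rewrite ger0_norm ?expR_ge0 // -expR0 ltr_expR; lra.
apply: (F_ext (F_mul (F_add (F_cst 1) (F_mul (F_cst (-1)) FL))
  (F_add (F_cst 1) (F_mul (F_cst (- expR 1)) FL)))) => x.
rewrite indicE mem_setE in_itv /= andbT /L.
have [xc|cx|xc] := ltgtP x c; last first.
- by rewrite (mulNr (expR 1)) -expRD subrr expR0 subrr mulr0.
- by rewrite !mulr0 !addr0 mulr1.
- by rewrite mulr1 subrr mul0r.
Unshelve. all: end_near. Qed.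

(** The sets with indicator in [F] form a sigma-algebra, and by [F_ray] it contains the open rays
    that generate the Borel sets. *)
Let F_indic (A : set R) : measurable A -> F (\1_A).
Proof.
move=> mA.
have {mA} : <<s @RGenOInfty.G R >> A.
  have : (@RGenOInfty.G R).-sigma.-measurable A.
    by rewrite -RGenOInfty.measurableE.
  by [].
move: A; apply: smallest_sub; last first.
  by move=> _ [c ->]; exact: F_ray.
have F_compl B : F (\1_B) -> F (\1_(~` B)).
  move=> FB; apply: (F_ext (F_add (F_cst 1) (F_mul (F_cst (-1)) FB))) => x.
  by rewrite !indicE in_setC mulN1r; case: (x \in B); rewrite ?subrr ?subr0.
split.
- by apply: (F_ext (F_cst 0)) => x; rewrite indic0.
- by move=> B FB; rewrite setTD; exact: F_compl.
- move=> B FB; rewrite -[\bigcup_k B k]setCK; refine (F_compl _ _).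
  rewrite setC_bigcup.
  (* The indicator of a countable intersection is the limit of finite products, each eventually
     constant in n. *)
  apply: (F_lim (f_ := fun n x => \prod_(k < n) (\1_(~` B k) x))).
    elim=> [|n ih]; first by apply: (F_ext (F_cst 1)) => x; rewrite big_ord0.
    by apply: (F_ext (F_mul ih (F_compl _ (FB n)))) => x; rewrite big_ord_recr.
  move=> x; rewrite indicE; case: (boolP (x \in _)) => [|].
    rewrite inE => xB; rewrite (_ : (fun n => _) = fun=> 1); first exact: cvg_cst.
    apply/funext => n; rewrite big1 // => k _.
    by rewrite indicE mem_set //; exact: xB.
  rewrite notin_setE => /existsNP[k /not_implyP[_ /= xB]].
  apply: cvg_near_cst; near=> n.
  have kn : (k < n)%N by near: n; exact: nbhs_infty_gt.
  by rewrite (bigD1 (Ordinal kn)) //= indicE memNset ?mul0r.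
Unshelve. all: end_near. Qed.

Import HBNNSimple.

(* A class of real functions containing the polynomials and stable under
   pointwise limits contains the Borel functions. *)
Lemma borel_class_ge0 (f : R -> R) : measurable_fun setT f -> (forall x, 0 <= f x) -> F f.
Proof.
move=> mf f0.
have mEf : measurable_fun setT (EFin \o f) by exact/measurable_EFinP.
pose g := nnsfun_approx measurableT mEf.
refine (@F_lim (fun n x => g n x) f _ _).
  move=> n; pose s : seq R := finmap.enum_fset (fset_set (g n @` setT)).
  apply: (@F_ext (fun x => \sum_(k < size s) (s`_k * \1_(g n @^-1` [set s`_k]) x))).
    apply: (@F_sum _ (fun k x => s`_k * \1_(g n @^-1` [set s`_k]) x)) => k.
    by apply: F_mul => //; apply: F_indic; exact: measurable_funPTI.
  by move=> x; rewrite [RHS]fimfunEord.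
move=> x; have := @cvg_nnsfun_approx _ _ R setT measurableT _ mEf _ x I.
by move=> /(_ (fun x _ => f0 x)) /fine_cvgP[].
Qed.

End borel_class.

Lemma ImZ (R : realType) (a : R) (x : R[i]) :
  complex.Im (a%:C * x) = a * complex.Im x.
Proof. by case: x => [b c] /=; rewrite mul0r addr0. Qed.

Lemma Im_sum (R : realType) (I : Type) (r : seq I) (Pr : pred I) (F : I -> R[i]) :
  complex.Im (\sum_(i <- r | Pr i) F i) = \sum_(i <- r | Pr i) complex.Im (F i).
Proof.
elim/big_rec2: _ => // i x y _ <-.
by case: (F i) y => [a b] [c e].
Qed.

(** * Measurable matrix-valued functions *)

Section measurable_matrices.
Context {R : realType} {dD : measure_display} {D : measurableType dD}.
Local Notation C := R[i].

Definition cmeas (z : D -> C) : Prop :=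
  measurable_fun setT (fun x => complex.Re (z x)) /\
  measurable_fun setT (fun x => complex.Im (z x)).

Lemma cmeas_cst (c : C) : cmeas (fun=> c).
Proof. by split; exact: measurable_cst. Qed.

Lemma cmeasD (y z : D -> C) : cmeas y -> cmeas z -> cmeas (fun x => y x + z x).
Proof.
move=> [y1 y2] [z1 z2]; split.
  rewrite (_ : (fun _ => _) = (fun x => complex.Re (y x)) \+ (fun x => complex.Re (z x))).
    exact: measurable_funD.
  by apply/funext => x; rewrite /=; case: (y x) (z x) => [? ?] [? ?].
rewrite (_ : (fun _ => _) = (fun x => complex.Im (y x)) \+ (fun x => complex.Im (z x))).
  exact: measurable_funD.
by apply/funext => x; rewrite /=; case: (y x) (z x) => [? ?] [? ?].
Qed.

Lemma cmeasM (y z : D -> C) : cmeas y -> cmeas z -> cmeas (fun x => y x * z x).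
Proof.
move=> [y1 y2] [z1 z2]; split.
  rewrite (_ : (fun _ => _) =
    ((fun x => complex.Re (y x)) \* (fun x => complex.Re (z x))) \-
    ((fun x => complex.Im (y x)) \* (fun x => complex.Im (z x)))).
    by apply: measurable_funB; exact: measurable_funM.
  by apply/funext => x; rewrite /=; case: (y x) (z x) => [? ?] [? ?].
rewrite (_ : (fun _ => _) =
  ((fun x => complex.Re (y x)) \* (fun x => complex.Im (z x))) \+
  ((fun x => complex.Im (y x)) \* (fun x => complex.Re (z x)))).
  by apply: measurable_funD; exact: measurable_funM.
by apply/funext => x; rewrite /=; case: (y x) (z x) => [? ?] [? ?].
Qed.

Lemma cmeas_sum (I : Type) (r : seq I) (z : I -> D -> C) :
  (forall i, cmeas (z i)) -> cmeas (fun x => \sum_(i <- r) z i x).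
Proof.
move=> hz; elim: r => [|i r ih].
  by under [fun _ => _]eq_fun do rewrite big_nil; exact: cmeas_cst.
by under [fun _ => _]eq_fun do rewrite big_cons; exact: cmeasD.
Qed.

Definition mmeas m n (M : D -> 'M[C]_(m, n)) : Prop :=
  forall i j, cmeas (fun x => M x i j).

Lemma mmeas_cst m n (A : 'M[C]_(m, n)) : mmeas (fun=> A).
Proof. by move=> i j; exact: cmeas_cst. Qed.

Lemma mmeasD m n (M N : D -> 'M[C]_(m, n)) :
  mmeas M -> mmeas N -> mmeas (fun x => M x + N x).
Proof.
by move=> hM hN i j; under [fun _ => _]eq_fun do rewrite mxE; exact: cmeasD.
Qed.

Lemma mmeasM m n q (M : D -> 'M[C]_(m, n)) (N : D -> 'M[C]_(n, q)) :
  mmeas M -> mmeas N -> mmeas (fun x => M x *m N x).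
Proof.
move=> hM hN i j; under [fun _ => _]eq_fun do rewrite mxE.
by apply: cmeas_sum => k; exact: cmeasM.
Qed.

Lemma mmeas_sum m n (I : Type) (r : seq I) (M : I -> D -> 'M[C]_(m, n)) :
  (forall i, mmeas (M i)) -> mmeas (fun x => \sum_(i <- r) M i x).
Proof.
move=> hM; elim: r => [|i r ih].
  by under [fun _ => _]eq_fun do rewrite big_nil; exact: mmeas_cst.
by under [fun _ => _]eq_fun do rewrite big_cons; exact: mmeasD.
Qed.

Lemma mmeasB m n (M N : D -> 'M[C]_(m, n)) :
  mmeas M -> mmeas N -> mmeas (fun x => M x - N x).
Proof.
move=> hM hN; apply: mmeasD => // i j.
rewrite (_ : (fun _ => _) = fun x => - 1 * N x i j); last first.
  by apply/funext => x; rewrite mxE mulN1r.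
by apply: cmeasM => //; exact: cmeas_cst.
Qed.

Lemma measurable_trR n (M : D -> 'M[C]_n) :
  mmeas M -> measurable_fun setT (fun x => trR (M x)).
Proof.
move=> hM; under [fun _ => _]eq_fun do rewrite trRE.
exact: (cmeas_sum (index_enum _) (fun i => hM i i)).1.
Qed.

(** The functions f with f(M) measurable form a class as in [borel_class_ge0]: sums and products
    pass through the functional calculus, and for a fixed matrix an entry of f(M) is a finite
    combination of values of f, so pointwise limits pass as well. *)
Lemma mmeas_mxfun_ge0 n (M : D -> 'M[C]_n) (f : R -> R) :
  mmeas M -> (forall x, M x \is hermsymmx) ->
  measurable_fun setT f -> (forall x, 0 <= f x) ->
  mmeas (fun x => mxfun f (M x)).
Proof.
move=> mM hM; apply: (borel_class_ge0 (F := fun f => mmeas (fun x => mxfun f (M x)))).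
- by under [fun _ => _]eq_fun do rewrite mxfun_id //.
- by move=> c; under [fun _ => _]eq_fun do rewrite mxfun_cst; exact: mmeas_cst.
- move=> {}f g mf mg; under [fun _ => _]eq_fun do rewrite -mxfunD.
  exact: mmeasD.
- move=> {}f g mf mg; under [fun _ => _]eq_fun do rewrite -mxfunM.
  exact: mmeasM.
move=> f_ {}f mf_ f_f i j.
have e x : exists (l : 'I_n -> R) (c : 'I_n -> C),
    forall g, mxfun g (M x) i j = \sum_k (g (l k))%:C * c k.
  exists (fun j => complex.Re (spectral_diag (M x) 0 j)).
  exists (fun k => (spectralmx (M x) k i)^*%R * spectralmx (M x) k j) => g.
  by rewrite mxfunE /udiag cdiagE.
split.
  apply: (@measurable_fun_cvg _ _ _ _ (fun m x => complex.Re (mxfun (f_ m) (M x) i j))).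
    by move=> m; exact: (mf_ m i j).1.
  move=> x _; have [l [c h]] := e x; rewrite h Re_sum.
  under eq_fun do rewrite h Re_sum.
  apply: cvg_big => [|k _]; first exact: add_continuous.
  under eq_fun do rewrite ReZ.
  by rewrite ReZ; apply: cvgMr_tmp; exact: f_f.
apply: (@measurable_fun_cvg _ _ _ _ (fun m x => complex.Im (mxfun (f_ m) (M x) i j))).
  by move=> m; exact: (mf_ m i j).2.
move=> x _; have [l [c h]] := e x; rewrite h Im_sum.
under eq_fun do rewrite h Im_sum.
apply: cvg_big => [|k _]; first exact: add_continuous.
under eq_fun do rewrite ImZ.
by rewrite ImZ; apply: cvgMr_tmp; exact: f_f.
Qed.

End measurable_matrices.

(** * Moments of random matrices *)

Section real_expectation.
Context {R : realType} {dT : measure_display} {T : measurableType dT}.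
Variable Pr : probability T R.
Implicit Types f g : T -> R.

Definition rint f : Prop := Pr.-integrable setT (EFin \o f).
Definition Ex f : R := fine ('E_Pr[f])%E.

Lemma ExE f : Ex f = \int[Pr]_w f w.
Proof. by rewrite /Ex unlock. Qed.

Lemma rint_cst c : rint (fun=> c).
Proof. exact: finite_measure_integrable_cst. Qed.

Lemma rintD f g : rint f -> rint g -> rint (fun w => f w + g w).
Proof.
by move=> hf hg; apply: eq_integrable (integrableD measurableT hf hg).
Qed.

Lemma rintB f g : rint f -> rint g -> rint (fun w => f w - g w).
Proof.
by move=> hf hg; apply: eq_integrable (integrableB measurableT hf hg).
Qed.

Lemma rintZ c f : rint f -> rint (fun w => c * f w).
Proof.
by move=> hf; apply: eq_integrable (integrableZl measurableT c hf).
Qed.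

Lemma rint_sum (I : Type) (r : seq I) (F : I -> T -> R) :
  (forall i, rint (F i)) -> rint (fun w => \sum_(i <- r) F i w).
Proof.
move=> hF; elim: r => [|i r ih].
  by under [fun _ => _]eq_fun do rewrite big_nil; exact: rint_cst.
by under [fun _ => _]eq_fun do rewrite big_cons; exact: rintD.
Qed.

Lemma le_rint f g : measurable_fun setT f -> (forall w, `|f w| <= g w) ->
  rint g -> rint f.
Proof.
move=> mf fg; apply: le_integrable => //; first exact/measurable_EFinP.
by move=> w _; rewrite /= lee_fin (le_trans (fg w)) // ler_norm.
Qed.

Lemma Ex_cst c : Ex (fun=> c) = c.
Proof. by rewrite /Ex (expectation_cst Pr c). Qed.

Lemma ExD f g : rint f -> rint g -> Ex (fun w => f w + g w) = Ex f + Ex g.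
Proof. by move=> hf hg; rewrite !ExE RintegralD. Qed.

Lemma ExB f g : rint f -> rint g -> Ex (fun w => f w - g w) = Ex f - Ex g.
Proof. by move=> hf hg; rewrite !ExE RintegralB. Qed.

Lemma ExZ c f : rint f -> Ex (fun w => c * f w) = c * Ex f.
Proof. by move=> hf; rewrite !ExE RintegralZl. Qed.

Lemma Ex_sum (I : Type) (r : seq I) (F : I -> T -> R) :
  (forall i, rint (F i)) ->
  Ex (fun w => \sum_(i <- r) F i w) = \sum_(i <- r) Ex (F i).
Proof.
move=> hF; elim: r => [|i r ih].
  by under [fun _ => _]eq_fun do rewrite big_nil; rewrite big_nil Ex_cst.
under [fun _ => _]eq_fun do rewrite big_cons.
by rewrite big_cons -ih ExD //; exact: rint_sum.
Qed.

Lemma le_Ex f g : rint f -> rint g -> (forall w, f w <= g w) -> Ex f <= Ex g.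
Proof. by move=> hf hg fg; rewrite !ExE le_Rintegral. Qed.

Lemma Ex_ge0 f : (forall w, 0 <= f w) -> 0 <= Ex f.
Proof. by move=> f0; rewrite ExE Rintegral_ge0. Qed.

Lemma eq_Ex f g : f =1 g -> Ex f = Ex g.
Proof. by move=> /funext ->. Qed.

Lemma rint_lty f : (forall w, 0 <= f w) -> measurable_fun setT f ->
  ('E_Pr[f] < +oo)%E -> rint f.
Proof.
rewrite unlock => f0 mf foo; apply/integrableP; split; first exact/measurable_EFinP.
by under eq_integral do rewrite gee0_abs ?lee_fin //.
Qed.

Lemma EFin_Ex f : rint f -> ('E_Pr[f] = (Ex f)%:E)%E.
Proof.
move=> hf; rewrite /Ex fineK // unlock.
exact: integrable_fin_num.
Qed.

End real_expectation.

Lemma mxBE (V : zmodType) m n (A B : 'M[V]_(m, n)) i j :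
  (A - B) i j = A i j - B i j.
Proof. by rewrite !mxE. Qed.

(** * Entrywise expectation *)

Section matrix_expectation.
Context {R : realType} {dT : measure_display} {T : measurableType dT}.
Variable Pr : probability T R.
Context {d : nat}.
Local Notation C := R[i].
Implicit Types M N : T -> 'M[C]_d.

Definition mint M : Prop := forall i j,
  rint Pr (fun w => complex.Re (M w i j)) /\ rint Pr (fun w => complex.Im (M w i j)).

Lemma mxexpectE M i j : mxexpect Pr M i j =
  Complex (Ex Pr (fun w => complex.Re (M w i j)))
          (Ex Pr (fun w => complex.Im (M w i j))).
Proof. by rewrite mxE. Qed.

Let trR_mul_entries (A B : 'M[C]_d) : trR (A *m B) = \sum_i \sum_j
  (complex.Re (A i j) * complex.Re (B j i) - complex.Im (A i j) * complex.Im (B j i)).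
Proof.
rewrite trRE /mxtrace Re_sum; apply: eq_bigr => i _.
rewrite mxE Re_sum; apply: eq_bigr => j _.
by case: (A i j) (B j i) => [? ?] [? ?].
Qed.

Lemma rint_trR_mull A M : mint M -> rint Pr (fun w => trR (A *m M w)).
Proof.
move=> hM; under [fun _ => _]eq_fun do rewrite trR_mul_entries.
apply: rint_sum => i; apply: rint_sum => j.
by apply: rintB; apply: rintZ; [exact: (hM j i).1|exact: (hM j i).2].
Qed.

Lemma Ex_trR_mull A M : mint M ->
  Ex Pr (fun w => trR (A *m M w)) = trR (A *m mxexpect Pr M).
Proof.
move=> hM; rewrite trR_mul_entries.
under eq_Ex do rewrite trR_mul_entries.
have h1 i j : rint Pr (fun w => complex.Re (A i j) * complex.Re (M w j i)).
  by apply: rintZ; exact: (hM j i).1.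
have h2 i j : rint Pr (fun w => complex.Im (A i j) * complex.Im (M w j i)).
  by apply: rintZ; exact: (hM j i).2.
rewrite Ex_sum => [|i]; last by apply: rint_sum => j; exact: rintB.
apply: eq_bigr => i _; rewrite Ex_sum => [|j]; last exact: rintB.
apply: eq_bigr => j _; rewrite ExB // mxexpectE /=.
by rewrite !ExZ //; [exact: (hM j i).2|exact: (hM j i).1].
Qed.

Lemma rint_trR_mulr A M : mint M -> rint Pr (fun w => trR (M w *m A)).
Proof. by move=> hM; under [fun _ => _]eq_fun do rewrite trRC; exact: rint_trR_mull. Qed.

Lemma Ex_trR_mulr A M : mint M ->
  Ex Pr (fun w => trR (M w *m A)) = trR (mxexpect Pr M *m A).
Proof. by move=> hM; under eq_Ex do rewrite trRC; rewrite Ex_trR_mull // trRC. Qed.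

Lemma rint_trR M : mint M -> rint Pr (fun w => trR (M w)).
Proof.
by move=> /(rint_trR_mull 1%:M); under [fun _ => _]eq_fun do rewrite mul1mx.
Qed.

Lemma mint_cst (A : 'M[C]_d) : mint (fun=> A).
Proof. by move=> i j; split; exact: rint_cst. Qed.

Lemma mintD M N : mint M -> mint N -> mint (fun w => M w + N w).
Proof.
move=> hM hN i j; split.
  rewrite (_ : (fun _ => _) = fun w => complex.Re (M w i j) + complex.Re (N w i j)).
    exact: rintD (hM i j).1 (hN i j).1.
  by apply/funext => w; rewrite mxE; case: (M w i j) (N w i j) => [? ?] [? ?].
rewrite (_ : (fun _ => _) = fun w => complex.Im (M w i j) + complex.Im (N w i j)).
  exact: rintD (hM i j).2 (hN i j).2.
by apply/funext => w; rewrite mxE; case: (M w i j) (N w i j) => [? ?] [? ?].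
Qed.

Lemma mxexpect_cst (A : 'M[C]_d) : mxexpect Pr (fun=> A) = A.
Proof. by apply/matrixP => i j; rewrite mxexpectE !Ex_cst; case: (A i j). Qed.

Lemma mxexpectB M N : mint M -> mint N ->
  mxexpect Pr (fun w => M w - N w) = mxexpect Pr M - mxexpect Pr N.
Proof.
move=> hM hN; apply/matrixP => i j; rewrite mxBE !mxexpectE.
have -> : Ex Pr (fun w => complex.Re ((M w - N w) i j)) =
    Ex Pr (fun w => complex.Re (M w i j)) - Ex Pr (fun w => complex.Re (N w i j)).
  rewrite -(ExB (hM i j).1 (hN i j).1); apply: eq_Ex => w.
  by rewrite mxBE; case: (M w i j) (N w i j) => [? ?] [? ?].
have -> // : Ex Pr (fun w => complex.Im ((M w - N w) i j)) =
    Ex Pr (fun w => complex.Im (M w i j)) - Ex Pr (fun w => complex.Im (N w i j)).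
rewrite -(ExB (hM i j).2 (hN i j).2); apply: eq_Ex => w.
by rewrite mxBE; case: (M w i j) (N w i j) => [? ?] [? ?].
Qed.

Lemma mxexpect_herm M : mint M -> (forall w, M w \is hermsymmx) ->
  mxexpect Pr M \is hermsymmx.
Proof.
move=> hM hh; apply/hermP/matrixP => i j; rewrite mxE mxE !mxexpectE.
have e w : M w i j = (M w j i)^*%R.
  by have /hermP/matrixP/(_ i j) := hh w; rewrite mxE mxE => <-.
have -> : Ex Pr (fun w => complex.Re (M w i j)) = Ex Pr (fun w => complex.Re (M w j i)).
  by apply: eq_Ex => w; rewrite e Re_conjC.
have -> // : Ex Pr (fun w => complex.Im (M w i j)) = - Ex Pr (fun w => complex.Im (M w j i)).
rewrite -[RHS]mulN1r -(ExZ _ (hM j i).2); apply: eq_Ex => w.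
by rewrite e; case: (M w j i) => [? ?]; rewrite mulN1r.
Qed.

(** The quadratic form at v is the trace against v v^*, a linear functional that commutes with
    expectation. *)
Lemma herm_psd (A : 'M[C]_d) : A \is hermsymmx ->
  (forall v : 'cV[C]_d, 0 <= trR ((v *m v^t*) *m A)) -> psdmx A.
Proof.
move=> hA h; split => // v; have := h v.
have -> : trR (v *m v^t* *m A) = complex.Re ((v^t* *m A *m v) 0 0).
  by rewrite trRE -mulmxA mxtrace_mulC /mxtrace big_ord1.
have : ((v^t* *m A *m v) 0 0)^*%R = (v^t* *m A *m v) 0 0.
  have : (v^t* *m A *m v)^t* = v^t* *m A *m v.
    by rewrite !adjM trmxCK (hermP _ hA) mulmxA.
  by move=> /matrixP/(_ 0 0); rewrite mxE mxE.
move=> /CrealP zr; rewrite -(RRe_real zr) /= => h0.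
by rewrite ler0c.
Qed.

Lemma mxexpect_psd M : mint M -> (forall w, psdmx (M w)) -> psdmx (mxexpect Pr M).
Proof.
move=> hM pM; apply: herm_psd => [|v].
  by apply: mxexpect_herm => // w; exact: psd_herm.
rewrite -Ex_trR_mull //; apply: Ex_ge0 => w; apply: psd_trM_ge0 (pM w).
have := psd_congr (v^t*) (@psd_scalar R 1 1 ler01).
by rewrite rmorph1 mulmx1 trmxCK.
Qed.

End matrix_expectation.

(** * Integrability from a finite moment *)

Section moments.
Context {R : realType} {dT : measure_display} {T : measurableType dT}.
Variable Pr : probability T R.
Context {d : nat}.
Local Notation C := R[i].
Implicit Types X Y : T -> 'M[C]_d.

Definition herm_rv (q : R) X : Prop :=
  [/\ mmeas X, forall w, X w \is hermsymmx & rint Pr (fun w => trpow q (X w))].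

Lemma measurable_hpow (s : R) : measurable_fun setT (hpow s).
Proof.
apply: (measurableT_comp (measurable_powR s)); exact: normr_measurable.
Qed.

Lemma mmeas_hpow (dD : measure_display) (D : measurableType dD) s (Z : D -> 'M[C]_d) :
  mmeas Z -> (forall x, Z x \is hermsymmx) -> mmeas (fun x => mxfun (hpow s) (Z x)).
Proof.
move=> mZ hZ; apply: mmeas_mxfun_ge0 => //; first exact: measurable_hpow.
by move=> x; exact: powR_ge0.
Qed.

Lemma mmeas_gpow (dD : measure_display) (D : measurableType dD) s (Z : D -> 'M[C]_d) :
  mmeas Z -> (forall x, Z x \is hermsymmx) -> mmeas (fun x => mxfun (gpow s) (Z x)).
Proof.
move=> mZ hZ; rewrite (_ : (fun _ => _) = fun x => Z x *m mxfun (hpow s) (Z x)).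
  by apply: mmeasM => //; exact: mmeas_hpow.
by apply/funext => x; rewrite -(mxfun_mulid (hpow s) (hZ x)).
Qed.

Lemma measurable_trpow q X : mmeas X -> (forall w, X w \is hermsymmx) ->
  measurable_fun setT (fun w => trpow q (X w)).
Proof. by move=> mX hX; apply: measurable_trR; exact: mmeas_hpow. Qed.

Lemma herm_rv_cst q A : A \is hermsymmx -> herm_rv q (fun=> A).
Proof.
by move=> hA; split; [exact: mmeas_cst|move=> _|exact: rint_cst].
Qed.

Lemma herm_rvD q X Y : 1 <= q -> herm_rv q X -> herm_rv q Y ->
  herm_rv q (fun w => X w + Y w).
Proof.
move=> q1 [mX hX iX] [mY hY iY].
have m : mmeas (fun w => X w + Y w) by exact: mmeasD.
have h w : X w + Y w \is hermsymmx by exact: hermD.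
split => //.
apply: (@le_rint _ _ _ _ _ (fun w => 2 `^ q / 2 * (trpow q (X w) + trpow q (Y w)))).
- exact: measurable_trpow.
- move=> w; rewrite ger0_norm ?trpow_ge0 //.
  apply: le_trans (trpow_convex q1 ltr01 ltr01 (hX w) (hY w)) _.
  by rewrite powR1 -[1 + 1]/(2 : R); lra.
- exact: rintZ (rintD iX iY).
Qed.

Lemma herm_rvZ q X (c : R) : herm_rv q X -> herm_rv q (fun w => c%:C *: X w).
Proof.
move=> [mX hX iX]; split.
- move=> i j; rewrite (_ : (fun _ => _) = fun w => c%:C * X w i j).
    by apply: cmeasM => //; exact: cmeas_cst.
  by apply/funext => w; rewrite mxE.
- by move=> w; exact: hermZ.
- rewrite (_ : (fun _ => _) = fun w => `|c| `^ q * trpow q (X w)).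
    exact: rintZ.
  by apply/funext => w; rewrite trpowZ.
Qed.

Lemma herm_rvB q X Y : 1 <= q -> herm_rv q X -> herm_rv q Y ->
  herm_rv q (fun w => X w - Y w).
Proof.
move=> q1 hX hY; have := herm_rvD q1 hX (herm_rvZ (-1) hY).
by rewrite (_ : (-1)%:C = -1) ?rmorphN1 //; under [fun w => _ + _]eq_fun do rewrite scaleN1r.
Qed.

Lemma herm_rv_sum q n (X : 'I_n -> T -> 'M[C]_d) (P : pred 'I_n) : 1 <= q ->
  (forall k, herm_rv q (X k)) -> herm_rv q (fun w => \sum_(k | P k) X k w).
Proof.
move=> q1 hX; elim: (index_enum _) => [|k r ih].
  by under [fun _ => _]eq_fun do rewrite big_nil; exact: herm_rv_cst (herm0 _).
under [fun _ => _]eq_fun do rewrite big_cons.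
by case: (P k) => //; exact: herm_rvD.
Qed.

(** Integrability becomes a count of degrees: f(X) g(Y) of total degree a + b <= q is dominated by
    the q-th moments. *)
Lemma mint_mxfunM q X Y (f g : R -> R) (a b : R) :
  herm_rv q X -> herm_rv q Y ->
  mmeas (fun w => mxfun f (X w)) -> mmeas (fun w => mxfun g (Y w)) ->
  (forall x, `|f x| = `|x| `^ a) -> (forall x, `|g x| = `|x| `^ b) ->
  0 <= a -> 0 <= b -> a + b <= q ->
  mint Pr (fun w => mxfun f (X w) *m mxfun g (Y w)).
Proof.
move=> [mX hX iX] [mY hY iY] mf mg fa gb a0 b0 abq i j.
have fg x y : `|f x| * `|g y| <= 1 + `|x| `^ q + `|y| `^ q.
  by rewrite fa gb; exact: norm_powRM_le.
have bnd w := ReIm_le_normC (normC_mxfunM_le (X w) (Y w) i j fg).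
have ib : rint Pr (fun w => d%:R ^+ 3 * (1 + trpow q (X w) + trpow q (Y w))).
  by apply: rintZ; apply: rintD iY; apply: rintD iX; exact: rint_cst.
have mfg := mmeasM mf mg.
split; apply: le_rint ib.
- exact: (mfg i j).1.
- by move=> w; exact: (bnd w).1.
- exact: (mfg i j).2.
- by move=> w; exact: (bnd w).2.
Qed.

Lemma mint_herm_rv q X : 1 <= q -> herm_rv q X -> mint Pr X.
Proof.
move=> q1 hX; have [mX hhX iX] := hX.
have := @mint_mxfunM q X X id (fun=> 1) 1 0 hX hX.
under [fun w => mxfun id _]eq_fun do rewrite mxfun_id //.
rewrite (_ : (fun w => mxfun id (X w) *m mxfun (fun=> 1) (X w)) = X); last first.
  by apply/funext => w; rewrite mxfun_one mulmx1 mxfun_id.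
apply => //.
- by under [fun w => _]eq_fun do rewrite mxfun_one; exact: mmeas_cst.
- by move=> x; rewrite powRr1.
- by move=> x; rewrite powRr0 normr1.
- by rewrite addr0.
Qed.

Lemma mint_gpow p X : 1 <= p -> herm_rv (2 * p) X ->
  mint Pr (fun w => mxfun (gpow (2 * p - 2)) (X w)).
Proof.
move=> p1 hX; have [mX hhX iX] := hX.
rewrite (_ : (fun _ => _) =
  fun w => mxfun id (X w) *m mxfun (hpow (2 * p - 2)) (X w)); last first.
  by apply/funext => w; rewrite mxfunM.
apply: (@mint_mxfunM _ _ _ _ _ 1 (2 * p - 2) hX hX); try lra.
- by under [fun w => _]eq_fun do rewrite mxfun_id //.
- exact: mmeas_hpow.
- by move=> x; rewrite powRr1.
- by move=> x; rewrite /hpow ger0_norm ?powR_ge0.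
Qed.

Lemma mint_mul_gpow p X Y : 1 <= p -> herm_rv (2 * p) X -> herm_rv (2 * p) Y ->
  mint Pr (fun w => X w *m mxfun (gpow (2 * p - 2)) (Y w)).
Proof.
move=> p1 hX hY; have [mX hhX iX] := hX; have [mY hhY iY] := hY.
rewrite (_ : (fun _ => _) =
  fun w => mxfun id (X w) *m mxfun (gpow (2 * p - 2)) (Y w)); last first.
  by apply/funext => w; rewrite mxfun_id.
apply: (@mint_mxfunM _ _ _ _ _ 1 (2 * p - 1) hX hY); try lra.
- by under [fun w => _]eq_fun do rewrite mxfun_id //.
- exact: mmeas_gpow.
- by move=> x; rewrite powRr1.
- move=> x; rewrite /gpow /hpow normrM [ `|_ `^ _|]ger0_norm ?powR_ge0 //.
  by rewrite -[RHS]mulr_powRB1 //; [congr (_ * _ `^ _); ring|lra].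
Qed.

Lemma mint_hpow p X : 1 <= p -> herm_rv (2 * p) X ->
  mint Pr (fun w => mxfun (hpow (2 * p - 2)) (X w)).
Proof.
move=> p1 hX; have [mX hhX iX] := hX.
rewrite (_ : (fun _ => _) =
  fun w => mxfun (hpow (2 * p - 2)) (X w) *m mxfun (fun=> 1) (X w)); last first.
  by apply/funext => w; rewrite mxfun_one mulmx1.
apply: (@mint_mxfunM _ _ _ _ _ (2 * p - 2) 0 hX hX); try lra.
- exact: mmeas_hpow.
- by under [fun w => _]eq_fun do rewrite mxfun_one; exact: mmeas_cst.
- by move=> x; rewrite /hpow ger0_norm ?powR_ge0.
- by move=> x; rewrite powRr0 normr1.
Qed.

Lemma mint_mul_hpow p X Y : 1 <= p -> herm_rv (2 * p) X -> herm_rv (2 * p) Y ->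
  mint Pr (fun w => X w *m mxfun (hpow (2 * p - 2)) (Y w)).
Proof.
move=> p1 hX hY; have [mX hhX iX] := hX; have [mY hhY iY] := hY.
rewrite (_ : (fun _ => _) =
  fun w => mxfun id (X w) *m mxfun (hpow (2 * p - 2)) (Y w)); last first.
  by apply/funext => w; rewrite mxfun_id.
apply: (@mint_mxfunM _ _ _ _ _ 1 (2 * p - 2) hX hY); try lra.
- by under [fun w => _]eq_fun do rewrite mxfun_id //.
- exact: mmeas_hpow.
- by move=> x; rewrite powRr1.
- by move=> x; rewrite /hpow ger0_norm ?powR_ge0.
Qed.

Lemma mint_sq_mul_hpow p X Y : 1 <= p -> herm_rv (2 * p) X -> herm_rv (2 * p) Y ->
  mint Pr (fun w => X w *m X w *m mxfun (hpow (2 * p - 2)) (Y w)).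
Proof.
move=> p1 hX hY; have [mX hhX iX] := hX; have [mY hhY iY] := hY.
rewrite (_ : (fun _ => _) =
  fun w => mxfun (fun x => x * x) (X w) *m mxfun (hpow (2 * p - 2)) (Y w)); last first.
  by apply/funext => w; rewrite mxfun_pow2.
apply: (@mint_mxfunM _ _ _ _ _ 2 (2 * p - 2) hX hY); try lra.
- by under [fun w => _]eq_fun do rewrite -mxfun_pow2 //; exact: mmeasM.
- exact: mmeas_hpow.
- by move=> x; rewrite powR_mulrn // normrM expr2.
- by move=> x; rewrite /hpow ger0_norm ?powR_ge0.
Qed.

Lemma mint_sq p X : 1 <= p -> herm_rv (2 * p) X -> mint Pr (fun w => X w *m X w).
Proof.
move=> p1 hX; have [mX hhX iX] := hX.
rewrite (_ : (fun _ => _) = fun w => mxfun id (X w) *m mxfun id (X w)); last first.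
  by apply/funext => w; rewrite mxfun_id.
have e x : `|x : R| = `|x| `^ 1 by rewrite powRr1.
apply: (@mint_mxfunM _ _ _ _ _ 1 1 hX hX) => //; try lra.
- by under [fun w => _]eq_fun do rewrite mxfun_id //.
- by under [fun w => _]eq_fun do rewrite mxfun_id //.
Qed.

End moments.

(** * The exchange inequality with the other summands frozen *)

Section exchangeable_pair.
Context {R : realType} {dT : measure_display} {T : measurableType dT}.
Variable Pr : probability T R.
Context {d : nat}.
Local Notation C := R[i].

(* Averaging the mean value trace inequality for A = X w + y and B = X w' + y
   over an independent copy w' and then over w. *)
Lemma stein_pair_le (p : R) (X : T -> 'M[C]_d) (y : 'M[C]_d) :
  p = 1 \/ 3 / 2 <= p -> herm_rv Pr (2 * p) X -> mxexpect Pr X = 0 ->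
  y \is hermsymmx ->
  Ex Pr (fun w => trR (X w *m mxfun (gpow (2 * p - 2)) (X w + y))) <=
  (2 * p - 1) / 2 * Ex Pr (fun w =>
    trR ((X w *m X w + mxexpect Pr (fun w => X w *m X w)) *m
         mxfun (hpow (2 * p - 2)) (X w + y))).
Proof.
move=> hp hX EX hy; have p1 : 1 <= p by case: hp => [->|]; lra.
have q1 : 1 <= 2 * p by lra.
have [mX hhX iX] := hX.
have hXy : herm_rv Pr (2 * p) (fun w => X w + y).
  exact: herm_rvD q1 hX (herm_rv_cst _ _ hy).
have [_ hhXy _] := hXy.
set c := (2 * p - 1) / 2; set V := mxexpect Pr (fun w => X w *m X w).
pose G w := mxfun (gpow (2 * p - 2)) (X w + y).
pose H w := mxfun (hpow (2 * p - 2)) (X w + y).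
have iM : mint Pr X by exact: mint_herm_rv q1 hX.
have iG : mint Pr G by exact: mint_gpow p1 hXy.
have iH : mint Pr H by exact: mint_hpow p1 hXy.
have iXH : mint Pr (fun w => X w *m H w) by exact: mint_mul_hpow p1 hX hXy.
have iXG : mint Pr (fun w => X w *m G w) by exact: mint_mul_gpow p1 hX hXy.
have iXX : mint Pr (fun w => X w *m X w) by exact: mint_sq p1 hX.
have iXXH : mint Pr (fun w => X w *m X w *m H w) by exact: mint_sq_mul_hpow p1 hX hXy.
pose K := mxexpect Pr (fun w => X w *m H w).
have hHm w : (H w)^t* = H w by apply/hermP/mxfun_herm.
pose t1 := Ex Pr (fun w => trR (X w *m G w)).
pose t2 := Ex Pr (fun w => trR (X w *m X w *m H w)).
have point w w' :
    trR (X w *m G w) - trR (X w *m G w') -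
      (trR (G w *m X w') - trR (X w' *m G w')) <=
    c * ((trR (X w *m X w *m H w) - trR (H w *m X w *m X w')
       - (trR (X w *m H w *m X w') - trR (H w *m (X w' *m X w')))) +
       (trR (X w *m X w *m H w') - 2 * trR (X w *m (X w' *m H w'))
         + trR (X w' *m X w' *m H w'))).
  have := trace_mean_value (fun x y => mean_value_powR x y hp) (hhXy w) (hhXy w').
  have -> : X w + y - (X w' + y) = X w - X w' by rewrite opprD addrACA subrr addr0.
  rewrite -/c -[mxfun _ (X w + y)]/(G w) -[mxfun _ (X w' + y)]/(G w').
  rewrite -[mxfun _ (X w + y)]/(H w) -[mxfun _ (X w' + y)]/(H w').
  rewrite trR_diff_mul trR_diff_sq_mul => mean_value.
  have e1 : trR (X w *m X w' *m H w) = trR (H w *m X w *m X w').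
    by rewrite [LHS]trRC mulmxA.
  have e2 : trR (X w' *m X w *m H w) = trR (X w *m H w *m X w').
    by rewrite -mulmxA [LHS]trRC.
  have e3 : trR (X w' *m X w *m H w') = trR (X w *m (X w' *m H w')).
    rewrite -[LHS]trR_adj (adjM (X w' *m X w)) (adjM (X w')) hHm.
    by rewrite (hermP _ (hhX w)) (hermP _ (hhX w')) [LHS]trRC mulmxA.
  have e4 : trR (X w *m (X w *m H w)) = trR (X w *m X w *m H w) by rewrite mulmxA.
  have e5 : trR (X w' *m (X w' *m H w')) = trR (X w' *m X w' *m H w').
    by rewrite mulmxA.
  have combine (l x1 x2 x3 x4 x5 x6 x7 x8 y1 y2 y3 y8 : R) :
      x1 = y1 -> x2 = y2 -> x3 = y3 -> x7 = x6 -> x8 = y8 ->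
      l <= c * (x1 - x2 - (x3 - x4) + (x5 - x6 - (x7 - x8))) ->
      l <= c * (y1 - y2 - (y3 - x4) + (x5 - 2 * x6 + y8)).
    move=> -> -> -> -> -> h; apply: le_trans h _.
    by rewrite le_eqVlt; apply/orP; left; apply/eqP; ring.
  exact: combine e4 e1 e2 e3 e5 mean_value.
have rXG : rint Pr (fun w => trR (X w *m G w)) by exact: rint_trR iXG.
have rXXH : rint Pr (fun w => trR (X w *m X w *m H w)) by exact: rint_trR iXXH.
have Z0 A : trR (A *m mxexpect Pr X) = 0 by rewrite EX mulmx0 trR0.
(* Expectation in w' with w fixed. The terms linear in X w' against a matrix depending on w alone
   vanish because X is centered. *)
have step w : trR (X w *m G w) - trR (X w *m mxexpect Pr G) + t1 <=
    c * ((trR (X w *m X w *m H w) + trR (H w *m V)) +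
      (trR (X w *m X w *m mxexpect Pr H) - 2 * trR (X w *m K) + t2)).
  have l1 := rint_trR_mull (X w) iG; have l2 := rint_trR_mull (G w) iM.
  have r1 := rint_trR_mull (H w *m X w) iM; have r2 := rint_trR_mull (X w *m H w) iM.
  have r3 := rint_trR_mull (H w) iXX; have r4 := rint_trR_mull (X w *m X w) iH.
  have r5 := rintZ 2 (rint_trR_mull (X w) iXH).
  have k1 := rint_cst Pr (trR (X w *m G w)).
  have k2 := rint_cst Pr (trR (X w *m X w *m H w)).
  have L := rintB (rintB k1 l1) (rintB l2 rXG).
  have R1 := rintB (rintB k2 r1) (rintB r2 r3).
  have R2 := rintD (rintB r4 r5) rXXH.
  have := le_Ex L (rintZ c (rintD R1 R2)) (point w).
  rewrite (ExB (rintB k1 l1) (rintB l2 rXG)) (ExB k1 l1) (ExB l2 rXG).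
  rewrite (ExZ _ (rintD R1 R2)) (ExD R1 R2).
  rewrite (ExB (rintB k2 r1) (rintB r2 r3)) (ExB k2 r1) (ExB r2 r3).
  rewrite (ExD (rintB r4 r5) rXXH) (ExB r4 r5) (ExZ _ (rint_trR_mull (X w) iXH)).
  rewrite !Ex_cst (Ex_trR_mull (X w) iG) (Ex_trR_mull (G w) iM).
  rewrite (Ex_trR_mull (H w *m X w) iM) (Ex_trR_mull (X w *m H w) iM).
  rewrite (Ex_trR_mull (H w) iXX) (Ex_trR_mull (X w *m X w) iH) (Ex_trR_mull (X w) iXH).
  rewrite (Z0 (G w)) (Z0 (H w *m X w)) (Z0 (X w *m H w)) -/t1 -/t2 -/V -/K.
  by rewrite !sub0r !subr0 !opprK.
have l1 := rint_trR_mulr (mxexpect Pr G) iM.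
have r1 := rint_trR_mulr V iH; have r2 := rint_trR_mulr (mxexpect Pr H) iXX.
have r3 := rintZ 2 (rint_trR_mulr K iM).
have k1 := rint_cst Pr t1; have k2 := rint_cst Pr t2.
have L := rintD (rintB rXG l1) k1.
have R1 := rintD rXXH r1; have R2 := rintD (rintB r2 r3) k2.
(* Expectation in w. By symmetry between w and w' both sides come out as twice the desired
   quantities. *)
have := le_Ex L (rintZ c (rintD R1 R2)) step.
rewrite (ExD (rintB rXG l1) k1) (ExB rXG l1) (ExZ _ (rintD R1 R2)) (ExD R1 R2).
rewrite (ExD rXXH r1) (ExD (rintB r2 r3) k2) (ExB r2 r3).
rewrite (ExZ _ (rint_trR_mulr K iM)) !Ex_cst !Ex_trR_mulr // EX !mul0mx trR0.
rewrite -/t1 -/t2 -/V mulr0 !subr0 (trRC _ V).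
have -> : Ex Pr (fun w => trR ((X w *m X w + V) *m H w)) =
    t2 + trR (V *m mxexpect Pr H).
  rewrite -(Ex_trR_mull V iH) -(ExD rXXH (rint_trR_mull V iH)).
  by apply: eq_Ex => w; rewrite mulmxDl trRD.
move: (trR _) => z h; lra.
Qed.

End exchangeable_pair.

Section cmx_measurability.
Context {R : realType} {dD : measure_display} {D : measurableType dD} {d : nat}.

Lemma mmeasP (M : D -> cmx R d) :
  measurable_fun setT M <-> mmeas (M : D -> 'M[R[i]]_d).
Proof.
split=> [mM i j|mM].
  split=> _ B mB; rewrite setTI.
    have mA : measurable ([set N : 'M[R[i]]_d | B (complex.Re (N i j))] : set (cmx R d)).
      by apply: sub_sigma_algebra; exists i, j, B; split => //; left.
    by have := mM measurableT _ mA; rewrite setTI.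
  have mA : measurable ([set N : 'M[R[i]]_d | B (complex.Im (N i j))] : set (cmx R d)).
    by apply: sub_sigma_algebra; exists i, j, B; split => //; right.
  by have := mM measurableT _ mA; rewrite setTI.
apply: (@measurability _ _ _ _ _ _ (@cmx_cylinders R d)) => //.
move=> _ [_ [i [j [B [mB [->|->]]]]] <-].
  by have := (mM i j).1 measurableT _ mB.
by have := (mM i j).2 measurableT _ mB.
Qed.

End cmx_measurability.

(** * Independence *)

Section decoupling.
Context {R : realType} {dT : measure_display} {T : measurableType dT}.
Variable Pr : probability T R.

Definition indep (d1 d2 : measure_display) (E1 : measurableType d1)
    (E2 : measurableType d2) (X : T -> E1) (Y : T -> E2) : Prop :=
  forall A B, measurable A -> measurable B ->
    (Pr (X @^-1` A `&` Y @^-1` B) = Pr (X @^-1` A) * Pr (Y @^-1` B))%E.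

(** Under independence the joint law is the product of the marginals, and Fubini integrates X with Y
    frozen. The pair is taken as (Y, X) so that the inner integral runs over X; integrability at
    every y makes it a genuine [Ex]. *)
Lemma decoupling d1 d2 (E1 : measurableType d1) (E2 : measurableType d2)
    (X : T -> E1) (Y : T -> E2) (F : E1 -> E2 -> R) :
  measurable_fun setT X -> measurable_fun setT Y -> indep X Y ->
  measurable_fun setT (fun z : E1 * E2 => F z.1 z.2) ->
  rint Pr (fun w => F (X w) (Y w)) ->
  (forall y, rint Pr (fun w => F (X w) y)) ->
  rint Pr (fun w => Ex Pr (fun w1 => F (X w1) (Y w))) /\
  Ex Pr (fun w => F (X w) (Y w)) = Ex Pr (fun w => Ex Pr (fun w1 => F (X w1) (Y w))).
Proof.
move=> mX mY XY mF iF iFy.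
pose Xm : {mfun T >-> E1} := HB.pack X (isMeasurableFun.Build _ _ _ _ X mX).
pose Ym : {mfun T >-> E2} := HB.pack Y (isMeasurableFun.Build _ _ _ _ Y mY).
have mZ : measurable_fun setT (fun w => (Y w, X w)) by exact: measurable_fun_pair.
pose Z : {mfun T >-> (E2 * E1)%type} :=
  HB.pack (fun w => (Y w, X w)) (isMeasurableFun.Build _ _ _ _ _ mZ).
pose m1 := distribution Pr Xm; pose m2 := distribution Pr Ym.
pose mz := distribution Pr Z.
(* A product measure is determined by its values on rectangles, where independence gives them. *)
have mE S : measurable S -> (m2 \x m1)%E S = mz S.
  move=> mS; apply: product_measure_unique => // A B mA mB.
  by rewrite muleC -[RHS](XY _ _ mB mA) setIC.
pose G z : \bar R := (F z.2 z.1)%:E.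
have mG : measurable_fun setT G.
  apply/measurable_EFinP.
  have := measurableT_comp mF (@measurable_swap _ _ E2 E1).
  by [].
have iG : mz.-integrable setT G by apply: integrable_pushforward.
have iGp : (m2 \x m1)%E.-integrable setT G.
  apply/integrableP; split => //; have /integrableP[_] := iG.
  by congr (_ < _)%E; apply: eq_measure_integral => S mS _; exact: esym (mE S mS).
have inner : forall y, (\int[m1]_x G (y, x) = (Ex Pr (fun w1 => F (X w1) y))%:E)%E.
  move=> y; rewrite /m1 integral_distribution.
  - by rewrite -(EFin_Ex (iFy y)) unlock.
  - exact: measurable_fun_pair2 mG.
  - exact: iFy y.
have iH : m2.-integrable setT (fun y => (Ex Pr (fun w1 => F (X w1) y))%:E).
  have h := integrable_fubini_F iGp.
  rewrite (_ : (fun _ => _) = fubini_F m1 G) //.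
  apply/funext => y; rewrite /fubini_F; symmetry; exact: inner.
have mH := measurable_int _ iH.
have iHY : rint Pr (fun w => Ex Pr (fun w1 => F (X w1) (Y w))).
  have /integrableP[_ oo] := iH; apply/integrableP; split.
    exact: measurableT_comp mH mY.
  move: oo; rewrite /m2 ge0_integral_distribution //.
  exact: measurableT_comp.
split => //; apply: EFin_inj.
rewrite -(EFin_Ex iF) -(EFin_Ex iHY) unlock.
transitivity (\int[mz]_z G z)%E.
  by rewrite /mz integral_distribution.
transitivity (\int[(m2 \x m1)%E]_z G z)%E.
  by apply: eq_measure_integral => S mS _; exact: esym (mE S mS).
rewrite -integral12_prod_meas1 // /fubini_F.
under eq_integral do rewrite inner.
by rewrite /m2 integral_distribution.
Qed.

End decoupling.

(** * One summand against the sum of the others *)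

Section mutual_independence.
Context {R : realType} {dT : measure_display} {T : measurableType dT}.
Variable Pr : probability T R.
Context {d n : nat}.

(* mutually_independent, for families not bundled as random variables. *)
Definition mindep (X : 'I_n -> T -> cmx R d) : Prop :=
  forall (J : {set 'I_n}) (B : 'I_n -> set (cmx R d)), (forall k, measurable (B k)) ->
    (Pr (\bigcap_(k in [set` J]) (X k @^-1` B k)) =
     \prod_(k in J) Pr (X k @^-1` B k))%E.

Lemma mindep_comp (X : 'I_n -> T -> cmx R d) (phi : 'I_n -> cmx R d -> cmx R d) :
  (forall k, measurable_fun setT (phi k)) -> mindep X ->
  mindep (fun k w => phi k (X k w)).
Proof.
move=> mphi hX J B mB; apply: (hX J (fun k => phi k @^-1` B k)) => k.
by have := mphi k measurableT _ (mB k); rewrite setTI.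
Qed.

(** A pi-lambda argument: E -> P(E, X_k in A) and E -> P(X_k in A) P(E) are finite measures that
    agree on the cylinder events of the other variables. These are closed under intersection and
    generate a sigma-algebra for which the sum of the others is measurable. *)
Lemma mindep_indep (X : 'I_n -> T -> cmx R d) k :
  (forall j, measurable_fun setT (X j)) -> mindep X ->
  indep Pr (X k) ((fun w => \sum_(j | j != k) (X j w : 'M[R[i]]_d)) : T -> cmx R d).
Proof.
move=> mX hX A B mA mB.
pose J : {set 'I_n} := (~: [set k])%SET.
have inJ j : (j \in J) = (j != k) by rewrite !inE.
pose others : set (set T) := [set E | exists B : 'I_n -> set (cmx R d),
  (forall j, measurable (B j)) /\ E = \bigcap_(j in [set` J]) (X j @^-1` B j)].
have mXB j (S : set (cmx R d)) : measurable S -> measurable (X j @^-1` S).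
  by move=> mS; have := mX j measurableT _ mS; rewrite setTI.
have others_meas : others `<=` measurable.
  move=> _ [S [mS ->]]; apply: fin_bigcap_measurable => //.
  by move=> j _; exact: mXB.
have othersT : others setT.
  exists (fun=> setT); split => //; apply/seteqP; split => // w _ j _ //.
(* An event of X_j alone is a cylinder with the full space at every other index. *)
have others_meas_X (j : 'I_n) : j != k ->
    measurable_fun setT (X j : g_sigma_algebraType others -> cmx R d).
  move=> jk _ S mS; rewrite setTI; apply: sub_sigma_algebra.
  exists (fun i => if i == j then S else setT); split.
    by move=> i; case: ifP.
  apply/seteqP; split => [w Xw i _ /=|w /(_ j)]; last first.
    by rewrite /= eqxx; apply; rewrite !inE.
  by case: eqP => // ->.
have mW : (<<s others >>) ((fun w => \sum_(j | j != k) (X j w : 'M[R[i]]_d)) @^-1` B).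
  have : measurable_fun setT ((fun w => \sum_(j | j != k) (X j w : 'M[R[i]]_d))
      : g_sigma_algebraType others -> cmx R d).
    apply/mmeasP; rewrite (_ : (fun _ => _) = fun w =>
        \sum_(j <- index_enum 'I_n) (if j != k then (X j w : 'M[R[i]]_d) else 0)).
      apply: mmeas_sum => j; case: (boolP (j != k)) => [jk|_]; last exact: mmeas_cst.
      exact: (mmeasP _).1 (others_meas_X j jk).
    by apply/funext => w; rewrite big_mkcond.
  by move=> /(_ measurableT _ mB); rewrite setTI.
set A' := X k @^-1` A.
have mA' : measurable A' by exact: mXB.
have PA : Pr A' \is a fin_num by exact: fin_num_measure.
pose r : {nonneg R} := NngNum (fine_ge0 (measure_ge0 Pr A')).
have rE : (r%:num%:E = Pr A')%E by rewrite /= fineK.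
have := @g_sigma_algebra_measure_unique _ _ _ others others_meas (fun=> setT)
  (fun=> othersT) _ (mrestr Pr mA') (mscale r Pr).
move=> /(_ _ _ _ _ _ mW) h.
rewrite setIC -rE; apply: h => //.
- by apply/seteqP; split => // w _; exists 0%N.
- move=> _ _ [S [mS ->]] [S' [mS' ->]]; exists (fun j => S j `&` S' j); split.
    by move=> j; exact: measurableI.
  by rewrite bigcapI.
- move=> _ [S [mS ->]]; rewrite /mrestr /mscale rE; cbv beta.
  (* Placing A at index k turns the intersection into one event over the full index set, to which
     mutual independence applies. *)
  pose B' j := if j == k then A else S j.
  have mB' j : measurable (B' j) by rewrite /B'; case: ifP.
  have e : \bigcap_(j in [set` J]) (X j @^-1` S j) `&` A' =
      \bigcap_(j in [set` [set: 'I_n]%SET]) (X j @^-1` B' j).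
    apply/seteqP; split => [w [h1 h2] j _|w hw].
      rewrite /B'; case: eqP => [->//|/eqP jk]; apply: h1.
      by rewrite /= !inE.
    split => [j|]; last by have := hw k; rewrite /B' eqxx; apply; rewrite /= inE.
    rewrite /= !inE => jk; have := hw j; rewrite /B' (negPf jk); apply.
    by rewrite /= inE.
  transitivity (Pr (\bigcap_(j in [set` [set: 'I_n]%SET]) (X j @^-1` B' j))).
    by congr (Pr _); exact: e.
  transitivity (Pr A' * \prod_(j in J) Pr (X j @^-1` S j))%E; last first.
    by congr (_ * _)%E; [exact: esym rE | exact: esym (hX _ _ mS)].
  rewrite (hX _ _ mB') (bigD1 k) ?inE //= {1}/B' eqxx; congr (_ * _)%E.
  apply: eq_big => j; first by rewrite !inE.
  by move=> /andP[_ /negPf jk]; rewrite /B' jk.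
- move=> _; change (Pr (setT `&` A') < +oo)%E.
  by rewrite setTI -ge0_fin_numE.
Qed.

End mutual_independence.

Section hermitian_part.
Context {R : realType} {dD : measure_display} {D : measurableType dD} {d : nat}.
Local Notation C := R[i].

Definition hermpart (M : 'M[C]_d) : 'M[C]_d := (2^-1)%:C *: (M + M^t*).

Lemma hermpart_herm M : hermpart M \is hermsymmx.
Proof. by apply: hermZ; apply/hermP; rewrite adjD trmxCK addrC. Qed.

Lemma hermpart_id M : M \is hermsymmx -> hermpart M = M.
Proof.
move=> /hermP hM; rewrite /hermpart hM scalerDr -scalerDl -rmorphD.
by rewrite (_ : 2^-1 + 2^-1 = 1) ?rmorph1 ?scale1r //; lra.
Qed.

Lemma hermpartD M N : M \is hermsymmx -> hermpart (M + N) = M + hermpart N.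
Proof.
move=> hM; rewrite -{2}(hermpart_id hM) /hermpart adjD addrACA.
exact: scalerDr.
Qed.

Lemma mmeas_hermpart (M : D -> 'M[C]_d) : mmeas M -> mmeas (fun x => hermpart (M x)).
Proof.
move=> mM i j.
rewrite (_ : (fun _ => _) = fun x => (2^-1)%:C * (M x i j + (M x j i)^*%R)); last first.
  by apply/funext => x; rewrite !mxE.
apply: cmeasM; first exact: cmeas_cst.
apply: cmeasD => //; split.
  by under [fun _ => _]eq_fun do rewrite Re_conjC; exact: (mM j i).1.
rewrite (_ : (fun _ => _) = fun x => - complex.Im (M x j i)); last first.
  by apply/funext => x; case: (M x j i).
by apply: measurable_funN; exact: (mM j i).2.
Qed.

End hermitian_part.

Section independent_sums.
Context {R : realType} {dT : measure_display} {T : measurableType dT}.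
Variable Pr : probability T R.
Context {d : nat}.
Local Notation C := R[i].

(* The Hermitian part only serves to make the integrands measurable on all
   pairs of matrices. *)
Lemma stein_indep_le (p : R) (X Y : T -> 'M[C]_d) :
  p = 1 \/ 3 / 2 <= p -> herm_rv Pr (2 * p) X -> herm_rv Pr (2 * p) Y ->
  mxexpect Pr X = 0 -> indep Pr (X : T -> cmx R d) (Y : T -> cmx R d) ->
  Ex Pr (fun w => trR (X w *m mxfun (gpow (2 * p - 2)) (X w + Y w))) <=
  (2 * p - 1) / 2 * Ex Pr (fun w =>
    trR ((X w *m X w + mxexpect Pr (fun w => X w *m X w)) *m
         mxfun (hpow (2 * p - 2)) (X w + Y w))).
Proof.
move=> hp hX hY EX XY; have p1 : 1 <= p by case: hp => [->|]; lra.
have q1 : 1 <= 2 * p by lra.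
have [mX hhX iX] := hX; have [mY hhY iY] := hY.
set V := mxexpect Pr (fun w => X w *m X w).
pose F1 (a y : cmx R d) := trR ((a : 'M[C]_d) *m
  mxfun (gpow (2 * p - 2)) (hermpart ((a : 'M[C]_d) + y))).
pose F2 (a y : cmx R d) := trR (((a : 'M[C]_d) *m (a : 'M[C]_d) + V) *m
  mxfun (hpow (2 * p - 2)) (hermpart ((a : 'M[C]_d) + y))).
have m1 : @mmeas R _ (cmx R d * cmx R d)%type d d (fun z => z.1).
  exact: (mmeasP _).1 measurable_fst.
have m2 : @mmeas R _ (cmx R d * cmx R d)%type d d (fun z => z.2).
  exact: (mmeasP _).1 measurable_snd.
have m3 := mmeas_hermpart (mmeasD m1 m2).
have h3 (z : (cmx R d * cmx R d)%type) := hermpart_herm ((z.1 : 'M[C]_d) + z.2).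
have mF1 : measurable_fun setT (fun z : (cmx R d * cmx R d)%type => F1 z.1 z.2).
  by apply: measurable_trR; apply: (mmeasM m1); exact: mmeas_gpow m3 h3.
have mF2 : measurable_fun setT (fun z : (cmx R d * cmx R d)%type => F2 z.1 z.2).
  apply: measurable_trR; apply: mmeasM; last exact: mmeas_hpow m3 h3.
  by apply: mmeasD; [exact: (mmeasM m1 m1)|exact: mmeas_cst].
have rF1 (Z : T -> 'M[C]_d) : herm_rv Pr (2 * p) Z ->
    rint Pr (fun w => trR (X w *m mxfun (gpow (2 * p - 2)) (X w + Z w))).
  by move=> hZ; exact: rint_trR (mint_mul_gpow p1 hX (herm_rvD q1 hX hZ)).
have rF2 (Z : T -> 'M[C]_d) : herm_rv Pr (2 * p) Z ->
    rint Pr (fun w => trR ((X w *m X w + V) *m mxfun (hpow (2 * p - 2)) (X w + Z w))).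
  move=> hZ; have hXZ := herm_rvD q1 hX hZ.
  have r1 := rint_trR (mint_sq_mul_hpow p1 hX hXZ).
  have r2 := rint_trR_mull V (mint_hpow p1 hXZ).
  by under [fun _ => _]eq_fun do rewrite mulmxDl trRD; exact: rintD.
have e1 : (fun w => F1 (X w) (Y w)) =
    fun w => trR (X w *m mxfun (gpow (2 * p - 2)) (X w + Y w)).
  by apply/funext => w; rewrite /F1 hermpartD // (hermpart_id (hhY w)).
have e2 : (fun w => F2 (X w) (Y w)) =
    fun w => trR ((X w *m X w + V) *m mxfun (hpow (2 * p - 2)) (X w + Y w)).
  by apply/funext => w; rewrite /F2 hermpartD // (hermpart_id (hhY w)).
have e1y y : (fun w => F1 (X w) y) =
    fun w => trR (X w *m mxfun (gpow (2 * p - 2)) (X w + hermpart y)).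
  by apply/funext => w; rewrite /F1 hermpartD.
have e2y y : (fun w => F2 (X w) y) =
    fun w => trR ((X w *m X w + V) *m mxfun (hpow (2 * p - 2)) (X w + hermpart y)).
  by apply/funext => w; rewrite /F2 hermpartD.
have hy y : herm_rv Pr (2 * p) (fun=> hermpart y).
  exact: herm_rv_cst (hermpart_herm y).
have [] := @decoupling _ _ _ Pr _ _ _ _ (X : T -> cmx R d) (Y : T -> cmx R d) F1.
- exact: (mmeasP _).2 mX.
- exact: (mmeasP _).2 mY.
- exact: XY.
- exact: mF1.
- by rewrite e1; exact: rF1.
- by move=> y; rewrite e1y; exact: rF1.
move=> i1 D1.
have [] := @decoupling _ _ _ Pr _ _ _ _ (X : T -> cmx R d) (Y : T -> cmx R d) F2.
- exact: (mmeasP _).2 mX.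
- exact: (mmeasP _).2 mY.
- exact: XY.
- exact: mF2.
- by rewrite e2; exact: rF2.
- by move=> y; rewrite e2y; exact: rF2.
move=> i2 D2.
have via (a a' b b' c : R) : a = a' -> b = b' -> a' <= c * b' -> a <= c * b.
  by move=> -> ->.
refine (via _ _ _ _ _ (etrans (congr1 (Ex Pr) (esym e1)) D1)
  (etrans (congr1 (Ex Pr) (esym e2)) D2) _).
(* With Y frozen, both inner expectations are those of [stein_pair_le] with y the Hermitian part of
   Y w. *)
rewrite -(ExZ _ i2); apply: (le_Ex i1 (rintZ _ i2)) => w.
rewrite e1y e2y; exact: stein_pair_le hp hX EX (hermpart_herm _).
Qed.

Lemma trpow_mul_gpow (p : R) (A : 'M[C]_d) : 1 <= p -> A \is hermsymmx ->
  trpow (2 * p) A = trR (A *m mxfun (gpow (2 * p - 2)) A).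
Proof.
move=> p1 hA; rewrite -(mxfun_mulid _ hA) /trpow; congr trR; apply: eq_mxfun => x.
rewrite /gpow /hpow mulrA -expr2 -real_normK ?num_real // expr2 -mulrA.
rewrite (_ : 2 * p - 2 = 2 * p - 1 - 1); last by ring.
by rewrite !mulr_powRB1 //; lra.
Qed.

(** Writing |x|^(2p) as x times [gpow] exposes one factor X_k at a time; each term is treated with
    the sum of the others as the independent part. *)
Lemma trpow_sum_indep_le (p : R) n (X : 'I_n -> T -> 'M[C]_d) :
  p = 1 \/ 3 / 2 <= p -> (forall k, herm_rv Pr (2 * p) (X k)) ->
  (forall k, mxexpect Pr (X k) = 0) -> mindep Pr (X : 'I_n -> T -> cmx R d) ->
  Ex Pr (fun w => trpow (2 * p) (\sum_k X k w)) <=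
  (2 * p - 1) / 2 * Ex Pr (fun w =>
    trR ((\sum_k (X k w *m X k w + mxexpect Pr (fun w => X k w *m X k w))) *m
         mxfun (hpow (2 * p - 2)) (\sum_k X k w))).
Proof.
move=> hp hX EX iX; have p1 : 1 <= p by case: hp => [->|]; lra.
have q1 : 1 <= 2 * p by lra.
have hS : herm_rv Pr (2 * p) (fun w => \sum_k X k w).
  exact: (@herm_rv_sum _ _ _ Pr d (2 * p) n X xpredT q1 hX).
have [_ hhS _] := hS.
pose V k := mxexpect Pr (fun w => X k w *m X k w).
have r1 k : rint Pr (fun w => trR (X k w *m mxfun (gpow (2 * p - 2)) (\sum_k X k w))).
  exact: rint_trR (mint_mul_gpow p1 (hX k) hS).
have r2 k : rint Pr (fun w => trR ((X k w *m X k w + V k) *m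
    mxfun (hpow (2 * p - 2)) (\sum_k X k w))).
  have s1 := rint_trR (mint_sq_mul_hpow p1 (hX k) hS).
  have s2 := rint_trR_mull (V k) (mint_hpow p1 hS).
  by under [fun _ => _]eq_fun do rewrite mulmxDl trRD; exact: rintD s1 s2.
have -> : Ex Pr (fun w => trpow (2 * p) (\sum_k X k w)) =
    \sum_k Ex Pr (fun w => trR (X k w *m mxfun (gpow (2 * p - 2)) (\sum_k X k w))).
  rewrite -Ex_sum //; apply: eq_Ex => w.
  by rewrite (trpow_mul_gpow p1 (hhS w)) mulmx_suml trR_sum.
have -> : Ex Pr (fun w =>
    trR ((\sum_k (X k w *m X k w + V k)) *m
         mxfun (hpow (2 * p - 2)) (\sum_k X k w))) =
    \sum_k Ex Pr (fun w => trR ((X k w *m X k w + V k) *m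
         mxfun (hpow (2 * p - 2)) (\sum_k X k w))).
  rewrite -Ex_sum //; apply: eq_Ex => w.
  by rewrite mulmx_suml trR_sum.
rewrite mulr_sumr; apply: ler_sum => k _.
have e w : \sum_j X j w = X k w + \sum_(j | j != k) X j w by rewrite (bigD1 k).
under eq_Ex do rewrite e.
under [X in _ <= _ * X]eq_Ex do rewrite e.
have hR := @herm_rv_sum _ _ _ Pr d (2 * p) n X (fun j => j != k) q1 hX.
apply: (stein_indep_le hp (hX k) hR (EX k)).
apply: (mindep_indep k _ iX) => j.
by have [mX _ _] := hX j; exact: (mmeasP _).2 mX.
Qed.

End independent_sums.

(** * Moment inequalities for independent sums *)

Section moment_inequalities.
Context {R : realType} {dT : measure_display} {T : measurableType dT}.
Variable Pr : probability T R.
Context {d : nat}.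
Local Notation C := R[i].
Implicit Types X Y A : T -> 'M[C]_d.

Lemma trpowN q (A : 'M[C]_d) : A \is hermsymmx -> trpow q (- A) = trpow q A.
Proof.
move=> hA; have := trpowZ q (-1) hA.
by rewrite rmorphN1 scaleN1r normrN1 powR1 mul1r.
Qed.

(** Young's inequality for A and for -A bounds the trace on both sides, so a p-th moment of A
    suffices against the power 2p - 2 of X. *)
Lemma rint_trR_mul_hpow p X A : 1 <= p -> herm_rv Pr (2 * p) X -> herm_rv Pr p A ->
  rint Pr (fun w => trR (A w *m mxfun (hpow (2 * p - 2)) (X w))).
Proof.
move=> p1 [mX hX iX] [mA hA iA].
apply: (le_rint _ _ (rintD (rintZ p^-1 iA) (rintZ (1 - p^-1) iX))).
  by apply: measurable_trR; apply: mmeasM => //; exact: mmeas_hpow.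
move=> w; rewrite ler_norml; apply/andP; split; last exact: trace_young.
have hN : - A w \is hermsymmx by have := hermZ (-1) (hA w); rewrite rmorphN1 scaleN1r.
have := trace_young p1 hN (hX w).
by rewrite mulNmx trRN (trpowN _ (hA w)) lerNl.
Qed.

(* Young's inequality bounds the right-hand side of the hypothesis by
   [p^-1 * c `^ p * Ex (trpow p A) + (1 - p^-1) * Ex (trpow (2 * p) X)]. *)
Lemma young_absorb p (c : R) X A : 1 <= p -> 0 <= c ->
  herm_rv Pr (2 * p) X -> herm_rv Pr p A ->
  Ex Pr (fun w => trpow (2 * p) (X w)) <=
    c * Ex Pr (fun w => trR (A w *m mxfun (hpow (2 * p - 2)) (X w))) ->
  Ex Pr (fun w => trpow (2 * p) (X w)) <= c `^ p * Ex Pr (fun w => trpow p (A w)).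
Proof.
move=> p1 c0 hX hA h; have [mX hhX iX] := hX; have [mA hhA iA] := hA.
have rAX := rint_trR_mul_hpow p1 hX hA.
have pw w : c * trR (A w *m mxfun (hpow (2 * p - 2)) (X w)) <=
    p^-1 * (c `^ p * trpow p (A w)) + (1 - p^-1) * trpow (2 * p) (X w).
  have := trace_young p1 (hermZ c (hhA w)) (hhX w).
  by rewrite -scalemxAl trRZ (trpowZ _ _ (hhA w)) ger0_norm.
have := le_Ex (rintZ c rAX)
  (rintD (rintZ p^-1 (rintZ (c `^ p) iA)) (rintZ (1 - p^-1) iX)) pw.
rewrite (ExD (rintZ p^-1 (rintZ (c `^ p) iA)) (rintZ (1 - p^-1) iX)).
rewrite (ExZ _ rAX) (ExZ _ (rintZ (c `^ p) iA)) (ExZ _ iA) (ExZ _ iX) => h2.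
have := le_trans h h2; move: (Ex _ _) (_ * Ex _ _) => F G.
rewrite mulrBl mul1r => h3.
have : p^-1 * F <= p^-1 * G by lra.
by rewrite ler_pM2l // invr_gt0 (lt_le_trans ltr01).
Qed.

Lemma herm_rv_sq p X : herm_rv Pr (2 * p) X -> herm_rv Pr p (fun w => X w *m X w).
Proof.
move=> [mX hX iX]; split; [exact: mmeasM|by move=> w; exact: herm_sq|].
by under [fun _ => _]eq_fun => w do rewrite (trpow_sq _ (hX w)).
Qed.

Lemma mxexpectD X Y : mint Pr X -> mint Pr Y ->
  mxexpect Pr (fun w => X w + Y w) = mxexpect Pr X + mxexpect Pr Y.
Proof.
move=> iX iY; have := mxexpectB (mintD iX iY) iY.
by under [fun w => _ - _]eq_fun do rewrite addrK; move=> ->; rewrite subrK.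
Qed.

Lemma mint_sum (I : Type) (r : seq I) (X : I -> T -> 'M[C]_d) :
  (forall i, mint Pr (X i)) -> mint Pr (fun w => \sum_(i <- r) X i w).
Proof.
move=> iX; elim: r => [|i r ih].
  by under [fun _ => _]eq_fun do rewrite big_nil; exact: mint_cst.
by under [fun _ => _]eq_fun do rewrite big_cons; exact: mintD.
Qed.

Lemma mxexpect_sum (I : Type) (r : seq I) (X : I -> T -> 'M[C]_d) :
  (forall i, mint Pr (X i)) ->
  mxexpect Pr (fun w => \sum_(i <- r) X i w) = \sum_(i <- r) mxexpect Pr (X i).
Proof.
move=> iX; elim: r => [|i r ih].
  by under [fun _ => _]eq_fun do rewrite big_nil; rewrite mxexpect_cst big_nil.
under [fun _ => _]eq_fun do rewrite big_cons.
by rewrite mxexpectD ?ih ?big_cons //; exact: mint_sum.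
Qed.

(** Jensen's inequality: the subgradient at B = E X has a linear term of mean zero. *)
Lemma trpow_mxexpect_le q X : 1 <= q -> herm_rv Pr q X ->
  trpow q (mxexpect Pr X) <= Ex Pr (fun w => trpow q (X w)).
Proof.
move=> q1 hX; have [mX hhX iX] := hX; have iM := mint_herm_rv q1 hX.
set B := mxexpect Pr X; have hB : B \is hermsymmx by exact: mxexpect_herm.
set phi := mxfun (fun y => q * (Num.sg y * `|y| `^ (q - 1))) B.
have r1 := rint_trR_mulr phi iM; have r2 := rint_cst Pr (trR (B *m phi)).
have pw w : trpow q B + (trR (X w *m phi) - trR (B *m phi)) <= trpow q (X w).
  by have := trpow_subgrad q1 (hhX w) hB; rewrite mulmxBl trRB.
have := le_Ex (rintD (rint_cst Pr (trpow q B)) (rintB r1 r2)) iX pw.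
rewrite (ExD (rint_cst Pr (trpow q B)) (rintB r1 r2)) (ExB r1 r2) !Ex_cst.
by rewrite (Ex_trR_mulr _ iM) -/B subrr addr0.
Qed.

Lemma minkowski_trpow q X Y : 1 <= q -> herm_rv Pr q X -> herm_rv Pr q Y ->
  Ex Pr (fun w => trpow q (X w + Y w)) `^ q^-1 <=
  Ex Pr (fun w => trpow q (X w)) `^ q^-1 + Ex Pr (fun w => trpow q (Y w)) `^ q^-1.
Proof.
move=> q1 hX hY; have [mX hhX iX] := hX; have [mY hhY iY] := hY.
have q0 : 0 < q by lra.
have rootK (x : R) : 0 <= x -> (x `^ q) `^ q^-1 = x.
  by move=> x0; rewrite -powRrM divff ?gt_eqF // powRr1.
have rootKV (x : R) : 0 <= x -> (x `^ q^-1) `^ q = x.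
  by move=> x0; rewrite -powRrM mulVf ?gt_eqF // powRr1.
have root1 (x : R) (e : R) : 0 <= x -> 0 < e ->
    ((x `^ q^-1 + e / 2) `^ q)^-1 * x <= 1.
  move=> x0 e0; have pos : 0 < x `^ q^-1 + e / 2.
    by rewrite ltr_wpDl ?powR_ge0 // divr_gt0.
  rewrite mulrC ler_pdivrMr ?powR_gt0 // mul1r -[leLHS]rootKV //.
  rewrite ge0_ler_powR ?nnegrE ?powR_ge0 // ltW //.
  by rewrite ltrDl divr_gt0.
have conv (a b u v : R) : 0 < a -> 0 < b -> u <= 1 -> v <= 1 ->
    a / (a + b) * u + b / (a + b) * v <= 1.
  move=> a0 b0 u1 v1; have ab0 : 0 < a + b by exact: addr_gt0.
  have -> : 1 = a / (a + b) * 1 + b / (a + b) * 1.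
    by rewrite !mulr1 -mulrDl divff // gt_eqF.
  by apply: lerD; rewrite ler_wpM2l // ltW // divr_gt0.
have [_ _ iXY] := herm_rvD q1 hX hY.
set F := Ex Pr (fun w => trpow q (X w + Y w)).
set a0 := Ex Pr (fun w => trpow q (X w)); set b0 := Ex Pr (fun w => trpow q (Y w)).
have a00 : 0 <= a0 by apply: Ex_ge0 => w; exact: trpow_ge0.
have b00 : 0 <= b0 by apply: Ex_ge0 => w; exact: trpow_ge0.
have F0 : 0 <= F by apply: Ex_ge0 => w; exact: trpow_ge0.
apply/ler_addgt0Pr => e e0.
(* With a and b the two norms, the bracket in [trpow_convex] averages to at most 1; adding e / 2
   keeps both positive. *)
pose a := a0 `^ q^-1 + e / 2; pose b := b0 `^ q^-1 + e / 2.
have ap : 0 < a by rewrite ltr_wpDl ?powR_ge0 // divr_gt0.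
have bp : 0 < b by rewrite ltr_wpDl ?powR_ge0 // divr_gt0.
have a1 : (a `^ q)^-1 * a0 <= 1 by exact: root1.
have b1 : (b `^ q)^-1 * b0 <= 1 by exact: root1.
have ab0 : 0 < a + b by exact: addr_gt0.
have h : F <= (a + b) `^ q.
  have rx := rintZ (a / (a + b)) (rintZ (a `^ q)^-1 iX).
  have ry := rintZ (b / (a + b)) (rintZ (b `^ q)^-1 iY).
  have pw w : trpow q (X w + Y w) <= (a + b) `^ q *
      (a / (a + b) * ((a `^ q)^-1 * trpow q (X w)) +
       b / (a + b) * ((b `^ q)^-1 * trpow q (Y w))).
    have := trpow_convex q1 ap bp (hhX w) (hhY w).
    by rewrite [_ / a `^ q]mulrC [_ / b `^ q]mulrC.
  have := le_Ex iXY (rintZ ((a + b) `^ q) (rintD rx ry)) pw.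
  rewrite (ExZ _ (rintD rx ry)) (ExD rx ry) (ExZ _ (rintZ (a `^ q)^-1 iX)).
  rewrite (ExZ _ (rintZ (b `^ q)^-1 iY)) (ExZ _ iX) (ExZ _ iY) -/F -/a0 -/b0.
  move=> /le_trans; apply; rewrite ler_piMr ?powR_ge0 //.
  exact: conv.
rewrite (splitr e) addrACA -/a -/b -[leRHS]rootK; last exact: ltW.
by rewrite ge0_ler_powR ?nnegrE ?powR_ge0 // invr_ge0 ltW.
Qed.

(** The best s is sqrt(b) / sqrt(a), which equalizes the two terms. If a or b vanishes, s is sent to
    infinity or to 0 instead. *)
Lemma le_sqrt_of_forall (x a b : R) : 0 <= a -> 0 <= b ->
  (forall s, 0 < s -> x <= (s * a + s^-1 * b) / 2) -> x <= Num.sqrt (a * b).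
Proof.
move=> a0 b0 h.
have small (e : R) : 0 <= e -> (forall s, 0 < s -> x <= s * e / 2) -> x <= 0.
  move=> e0 hs; apply/ler_addgt0Pr => t t0; rewrite add0r.
  have e1 : 0 < e + 1 by lra.
  apply: le_trans (hs (t / (e + 1)) (divr_gt0 t0 e1)) _.
  rewrite -[t / _ * e / 2]/(t * (e + 1)^-1 * e * 2^-1).
  have : (e + 1)^-1 * e <= 1 by rewrite mulrC ler_pdivrMr // mul1r lerDl.
  have : 0 <= (e + 1)^-1 * e by rewrite mulr_ge0 // invr_ge0 ltW.
  by rewrite -(mulrA t); move: (_^-1 * e) => z *; nra.
have [a_eq|an0] := eqVneq a 0.
  rewrite a_eq mul0r sqrtr0; apply: (small b b0) => s s0.
  have : 0 < s^-1 by rewrite invr_gt0.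
  by move=> /h; rewrite a_eq mulr0 add0r invrK.
have [b_eq|bn0] := eqVneq b 0.
  rewrite b_eq mulr0 sqrtr0; apply: (small a a0) => s s0.
  by have := h s s0; rewrite b_eq mulr0 addr0.
have ap : 0 < a by rewrite lt_neqAle eq_sym an0.
have bp : 0 < b by rewrite lt_neqAle eq_sym bn0.
have sa : 0 < Num.sqrt a by rewrite sqrtr_gt0.
have sb : 0 < Num.sqrt b by rewrite sqrtr_gt0.
have := h _ (divr_gt0 sb sa); rewrite sqrtrM //.
rewrite -{2}(sqr_sqrtr a0) -{3}(sqr_sqrtr b0) invf_div => /le_trans; apply.
move: (Num.sqrt a) (Num.sqrt b) sa sb => u v u0 v0.
rewrite le_eqVlt; apply/orP; left; apply/eqP; field.
by rewrite !gt_eqF.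
Qed.

End moment_inequalities.

(** * Centering positive semidefinite summands *)

Section psd_sums.
Context {R : realType} {dT : measure_display} {T : measurableType dT}.
Variable Pr : probability T R.
Context {d : nat}.
Local Notation C := R[i].
Implicit Types X Y A : T -> 'M[C]_d.

Let trRD4 (A B M N : 'M[C]_d) :
  trR (A + B + (M + N)) = trR A + trR B + (trR M + trR N).
Proof. by rewrite 3!trRD. Qed.

Let trRB4 (A B M N : 'M[C]_d) :
  trR (A - B - (M - N)) = trR A - trR B - (trR M - trR N).
Proof. by rewrite 3!trRB. Qed.

Lemma trR_parallelogram (N A B : 'M[C]_d) :
  trR (N *m ((A + B) *m (A + B))) + trR (N *m ((A - B) *m (A - B))) =
  2 * trR (N *m (A *m A)) + 2 * trR (N *m (B *m B)).
Proof.
rewrite (mulmxDl A B) (mulmxDr A A B) (mulmxDr B A B).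
rewrite (mulmxBl A B) (mulmxBr A A B) (mulmxBr B A B).
rewrite (mulmxBr N (A *m A - A *m B) (B *m A - B *m B)).
rewrite (mulmxBr N (A *m A) (A *m B)) (mulmxBr N (B *m A) (B *m B)).
rewrite (mulmxDr N (A *m A + A *m B) (B *m A + B *m B)).
rewrite (mulmxDr N (A *m A) (A *m B)) (mulmxDr N (B *m A) (B *m B)).
rewrite (trRB4 (N *m (A *m A)) (N *m (A *m B)) (N *m (B *m A)) (N *m (B *m B))).
rewrite (trRD4 (N *m (A *m A)) (N *m (A *m B)) (N *m (B *m A)) (N *m (B *m B))).
by move: (trR _) (trR _) (trR _) (trR _) => *; lra.
Qed.

Lemma trR_variance p X (N : 'M[C]_d) : 1 <= p -> herm_rv Pr (2 * p) X ->
  trR (N *m mxexpect Pr (fun w =>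
    (X w - mxexpect Pr X) *m (X w - mxexpect Pr X))) =
  trR (N *m mxexpect Pr (fun w => X w *m X w)) -
  trR (N *m (mxexpect Pr X *m mxexpect Pr X)).
Proof.
set M := mxexpect Pr X => p1 hX; have q1 : 1 <= 2 * p by lra.
have [mX hhX _] := hX; have iM := mint_herm_rv q1 hX.
have hM : M \is hermsymmx by exact: mxexpect_herm.
have hXM : herm_rv Pr (2 * p) (fun w => X w - M).
  exact: herm_rvB q1 hX (herm_rv_cst _ _ hM).
have r0 := rint_trR_mull N (mint_sq p1 hX).
have r1 := rint_trR_mull (N *m M) iM; have r2 := rint_trR_mull (M *m N) iM.
have r3 := rintB r0 (rintD r1 r2).
rewrite -(Ex_trR_mull _ (mint_sq p1 hXM)) -(Ex_trR_mull _ (mint_sq p1 hX)).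
have e w : trR (N *m ((X w - M) *m (X w - M))) =
    trR (N *m (X w *m X w)) - (trR (N *m M *m X w) + trR (M *m N *m X w)) +
    trR (N *m (M *m M)).
  rewrite (mulmxBl (X w) M) (mulmxBr (X w) (X w) M) (mulmxBr M (X w) M).
  rewrite (mulmxBr N (X w *m X w - X w *m M) (M *m X w - M *m M)).
  rewrite (mulmxBr N (X w *m X w) (X w *m M)) (mulmxBr N (M *m X w) (M *m M)).
  rewrite (trRB4 (N *m (X w *m X w)) (N *m (X w *m M)) (N *m (M *m X w)) (N *m (M *m M))).
  have -> : trR (N *m M *m X w) = trR (N *m (M *m X w)) by rewrite mulmxA.
  have -> : trR (M *m N *m X w) = trR (N *m (X w *m M)).
    by rewrite -mulmxA [LHS]trRC -mulmxA.
  by move: (trR _) (trR _) (trR _) (trR _) => *; lra.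
rewrite (eq_Ex _ e) (ExD r3 (rint_cst _ _)) (ExB r0 (rintD r1 r2)) (ExD r1 r2).
rewrite Ex_cst !(Ex_trR_mull _ iM) -/M.
have -> : trR (N *m M *m M) = trR (N *m (M *m M)) by rewrite mulmxA.
have -> : trR (M *m N *m M) = trR (N *m (M *m M)).
  by rewrite -mulmxA [LHS]trRC -mulmxA.
by move: (trR _) (Ex _ _) => *; lra.
Qed.

(* The difference of the two sides is tr N ((X + M)^2 + E (X - M)^2), M = E X. *)
Lemma trR_centered_sq_le p X (N : 'M[C]_d) w : 1 <= p -> herm_rv Pr (2 * p) X ->
  psdmx N ->
  trR (((X w - mxexpect Pr X) *m (X w - mxexpect Pr X) +
    mxexpect Pr (fun w => (X w - mxexpect Pr X) *m (X w - mxexpect Pr X))) *m N) <=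
  2 * trR ((X w *m X w + mxexpect Pr (fun w => X w *m X w)) *m N).
Proof.
have combine (s v x a b m : R) : 0 <= s -> 0 <= v -> s + x = 2 * a + 2 * m ->
    v = b - m -> x + v <= 2 * (a + b) by lra.
set M := mxexpect Pr X => p1 hX pN; have q1 : 1 <= 2 * p by lra.
have [mX hhX _] := hX; have iM := mint_herm_rv q1 hX.
have hM : M \is hermsymmx by exact: mxexpect_herm.
have hXM : herm_rv Pr (2 * p) (fun w => X w - M).
  exact: herm_rvB q1 hX (herm_rv_cst _ _ hM).
have g1 : 0 <= trR (N *m ((X w + M) *m (X w + M))).
  exact: (psd_trM_ge0 pN (psd_sq (hermD (hhX w) hM))).
have g2 : 0 <= trR (N *m mxexpect Pr (fun w => (X w - M) *m (X w - M))).
  apply: (psd_trM_ge0 pN); apply: mxexpect_psd; first exact: mint_sq p1 hXM.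
  move=> w'; exact: (psd_sq (hermB (hhX w') hM)).
have g3 := trR_parallelogram N (X w) M.
have := trR_variance N p1 hX; rewrite -/M => g4.
rewrite !(trRC _ N) (mulmxDr N ((X w - M) *m (X w - M))) (mulmxDr N (X w *m X w)) !trRD.
exact: combine g1 g2 g3 g4.
Qed.

(** [trR_centered_sq_le] doubles (2p-1)/2 to 2p - 1, which Young's inequality raises to the power p.
    The power mean bound for S + E S, followed by Jensen for E S, adds the factor 2^p. *)
Lemma trpow_centered_sum_le p n (P : 'I_n -> T -> 'M[C]_d) :
  p = 1 \/ 3 / 2 <= p -> (forall k, herm_rv Pr (2 * p) (P k)) ->
  mindep Pr (P : 'I_n -> T -> cmx R d) ->
  Ex Pr (fun w => trpow (2 * p) (\sum_k (P k w - mxexpect Pr (P k)))) <=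
  (4 * p - 2) `^ p * Ex Pr (fun w => trpow p (\sum_k P k w *m P k w)).
Proof.
move=> hp hP iP; have p1 : 1 <= p by case: hp => [->|]; lra.
have q1 : 1 <= 2 * p by lra.
pose M k := mxexpect Pr (P k).
pose X k w := P k w - M k.
have iM k := mint_herm_rv q1 (hP k).
have hM k : M k \is hermsymmx.
  by apply: mxexpect_herm => // w; have [_ hh _] := hP k; exact: hh.
have hX k : herm_rv Pr (2 * p) (X k).
  exact: herm_rvB q1 (hP k) (herm_rv_cst _ _ (hM k)).
have EX k : mxexpect Pr (X k) = 0.
  by rewrite (mxexpectB (iM k) (mint_cst _ _)) mxexpect_cst subrr.
have iX : mindep Pr (X : 'I_n -> T -> cmx R d).
  apply: (mindep_comp (phi := fun k (A : cmx R d) => (A : 'M[C]_d) - M k)) iP => k.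
  apply: (mmeasP _).2; apply: mmeasB; last exact: mmeas_cst.
  by apply: (mmeasP _).1; exact: measurable_id.
pose W k := mxexpect Pr (fun w => P k w *m P k w).
have iW k : mint Pr (fun w => P k w *m P k w) by exact: mint_sq p1 (hP k).
have hS : herm_rv Pr (2 * p) (fun w => \sum_k X k w).
  exact: (@herm_rv_sum _ _ _ Pr d (2 * p) n X xpredT q1 hX).
have [_ hhS _] := hS.
pose S w := \sum_k P k w *m P k w.
have hSS : herm_rv Pr p S.
  apply: (@herm_rv_sum _ _ _ Pr d p n (fun k w => P k w *m P k w) xpredT p1) => k.
  exact: herm_rv_sq (hP k).
have [_ hhSS iSS] := hSS.
have hWs : mxexpect Pr S \is hermsymmx.
  by apply: mxexpect_herm => //; exact: mint_herm_rv p1 hSS.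
have hA : herm_rv Pr p (fun w => S w + mxexpect Pr S).
  exact: herm_rvD p1 hSS (herm_rv_cst _ _ hWs).
have hV k : mxexpect Pr (fun w => X k w *m X k w) \is hermsymmx.
  apply: mxexpect_herm => [|w]; first exact: mint_sq p1 (hX k).
  have [_ hh _] := hX k; exact: herm_sq (hh w).
have hD : herm_rv Pr p (fun w =>
    \sum_k (X k w *m X k w + mxexpect Pr (fun w => X k w *m X k w))).
  apply: (@herm_rv_sum _ _ _ Pr d p n
    (fun k w => X k w *m X k w + mxexpect Pr (fun w => X k w *m X k w)) xpredT p1) => k.
  exact: herm_rvD p1 (herm_rv_sq (hX k)) (herm_rv_cst _ _ (hV k)).
have step : Ex Pr (fun w => trpow (2 * p) (\sum_k X k w)) <=
    (2 * p - 1) * Ex Pr (fun w => trR ((S w + mxexpect Pr S) *m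
       mxfun (hpow (2 * p - 2)) (\sum_k X k w))).
  apply: le_trans (trpow_sum_indep_le hp hX EX iX) _.
  have r1 := rint_trR_mul_hpow p1 hS hD; have r2 := rint_trR_mul_hpow p1 hS hA.
  have pw w : trR ((\sum_k (X k w *m X k w + mxexpect Pr (fun w => X k w *m X k w))) *m
       mxfun (hpow (2 * p - 2)) (\sum_k X k w)) <=
      2 * trR ((S w + mxexpect Pr S) *m mxfun (hpow (2 * p - 2)) (\sum_k X k w)).
    have pH : psdmx (mxfun (hpow (2 * p - 2)) (\sum_k X k w)).
      by apply: psd_mxfun => x; exact: powR_ge0.
    rewrite (mxexpect_sum _ iW) -big_split /=.
    rewrite !mulmx_suml !trR_sum mulr_sumr; apply: ler_sum => k _.
    exact: trR_centered_sq_le p1 (hP k) pH.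
  have := le_Ex r1 (rintZ 2 r2) pw; rewrite (ExZ _ r2).
  move: (Ex _ _) (Ex _ _) => u v h; nra.
have c0 : 0 <= 2 * p - 1 by lra.
apply: le_trans (young_absorb p1 c0 hS hA step) _.
have J := trpow_mxexpect_le p1 hSS.
have r1 := rintZ (2 `^ p / 2) (rintD iSS (rint_cst Pr (trpow p (mxexpect Pr S)))).
have [_ _ iA] := hA.
have pw w : trpow p (S w + mxexpect Pr S) <=
    2 `^ p / 2 * (trpow p (S w) + trpow p (mxexpect Pr S)).
  apply: le_trans (trpow_convex p1 ltr01 ltr01 (hhSS w) hWs) _.
  by rewrite powR1 -[1 + 1]/(2 : R); lra.
have := le_Ex iA r1 pw.
rewrite (ExZ _ (rintD iSS (rint_cst Pr (trpow p (mxexpect Pr S))))).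
rewrite (ExD iSS (rint_cst _ _)) Ex_cst => h2.
have -> : (4 * p - 2) `^ p = (2 * p - 1) `^ p * 2 `^ p.
  by rewrite -powRM //; congr (_ `^ _); ring.
rewrite -mulrA; apply: ler_wpM2l; first exact: powR_ge0.
apply: le_trans h2 _.
have := powR_ge0 2 p; move: (2 `^ p) J; rewrite -/S.
by move: (trpow _ _) (Ex _ _) => u v c h c0'; nra.
Qed.

End psd_sums.

(** * The two inequalities in terms of [trpow] *)

Section rosenthal.
Context {R : realType} {dT : measure_display} {T : measurableType dT}.
Variable Pr : probability T R.
Context {d : nat}.
Local Notation C := R[i].

Lemma powR_root_le (q x y : R) : 0 < q -> 0 <= x -> 0 <= y ->
  x <= y -> x `^ q^-1 <= y `^ q^-1.
Proof.
by move=> q0 x0 y0 xy; rewrite ge0_ler_powR ?nnegrE // invr_ge0 ltW.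
Qed.

Lemma powR_sqrt_sq (x q : R) : q != 0 -> (x `^ (2 * q)^-1) ^+ 2 = x `^ q^-1.
Proof.
move=> q0; rewrite -powR_mulrn ?powR_ge0 // -powRrM; congr (_ `^ _).
by rewrite invfM mulrAC mulVf ?mul1r // pnatr_eq0.
Qed.

(** If x > m + s, then x^2 > m x + s x >= m^2 + s x. *)
Lemma sq_le_sqrt_add (x m s : R) : 0 <= m -> 0 <= x -> 0 <= s ->
  x ^+ 2 <= m ^+ 2 + s * x -> x <= m + s.
Proof.
move=> m0 x0 s0 h; rewrite leNgt; apply/negP => lt.
have : (m + s) * x < x * x by rewrite ltr_pM2r //; lra.
have : m * m <= m * x by rewrite ler_wpM2l //; lra.
by move: h; rewrite !expr2 mulrDl; lra.
Qed.

(** The last step of (ii), with c = 4p - 1: part (i) brings the constant sqrt(c - 1), and the first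
    square is its bound. The difference of the sides is c a b (2 sqrt(c) - sqrt(c - 1)) + c (c + 1)
    b^2 / 2. *)
Lemma half_sum_sq_le (c a b : R) : 1 <= c -> 0 <= a -> 0 <= b ->
  c / 2 * ((a + Num.sqrt (c - 1) * b) ^+ 2 + a ^+ 2) <=
  (Num.sqrt c * a + c * b) ^+ 2.
Proof.
move=> c1 a0 b0.
have s2 : Num.sqrt (c - 1) ^+ 2 = c - 1 by rewrite sqr_sqrtr //; lra.
have t2 : Num.sqrt c ^+ 2 = c by rewrite sqr_sqrtr //; lra.
have st : Num.sqrt (c - 1) <= Num.sqrt c by rewrite ler_wsqrtr //; lra.
move: (Num.sqrt (c - 1)) (Num.sqrt c) (sqrtr_ge0 c) s2 t2 st => s t t0 s2 t2 st.
have h1 : 0 <= c * (a * b) * (t - s) by rewrite !mulr_ge0 //; lra.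
have h2 : 0 <= c * (a * b) * t by rewrite !mulr_ge0 //; lra.
have h3 : 0 <= c * (c + 1) * b ^+ 2 by rewrite !mulr_ge0 ?sqr_ge0 //; lra.
rewrite -subr_ge0 (_ : _ - _ =
  c * (a * b) * (t - s) + c * (a * b) * t + c * (c + 1) * b ^+ 2 / 2).
  by rewrite !addr_ge0 ?divr_ge0.
by rewrite !sqrrD !exprMn s2 t2; field.
Qed.

Lemma rosenthal_psd p n (P : 'I_n -> T -> 'M[C]_d) :
  p = 1 \/ 3 / 2 <= p -> (forall k, herm_rv Pr (2 * p) (P k)) ->
  (forall k w, psdmx (P k w)) -> mindep Pr (P : 'I_n -> T -> cmx R d) ->
  Ex Pr (fun w => trpow (2 * p) (\sum_k P k w)) `^ (2 * p)^-1 <=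
  (trpow (2 * p) (\sum_k mxexpect Pr (P k)) `^ (4 * p)^-1 +
   Num.sqrt (4 * p - 2) *
   (\sum_k Ex Pr (fun w => trpow (2 * p) (P k w))) `^ (4 * p)^-1) ^+ 2.
Proof.
move=> hp hP pP iP; have p1 : 1 <= p by case: hp => [->|]; lra.
have q1 : 1 <= 2 * p by lra.
have q0 : 0 < 2 * p by lra.
have hS : herm_rv Pr (2 * p) (fun w => \sum_k P k w).
  exact: (@herm_rv_sum _ _ _ Pr d (2 * p) n P xpredT q1 hP).
have hS2 : herm_rv Pr p (fun w => \sum_k P k w *m P k w).
  apply: (@herm_rv_sum _ _ _ Pr d p n (fun k w => P k w *m P k w) xpredT p1) => k.
  exact: herm_rv_sq (hP k).
have hM k : mxexpect Pr (P k) \is hermsymmx.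
  apply: mxexpect_herm (mint_herm_rv q1 (hP k)) _ => w.
  by have [_ hh _] := hP k; exact: hh.
have hMs : \sum_k mxexpect Pr (P k) \is hermsymmx by exact: herm_sum.
have iPk k : rint Pr (fun w => trpow (2 * p) (P k w)) by have [] := hP k.
have [_ _ iS] := hS; have [_ _ iS2] := hS2.
set F0 := Ex Pr (fun w => trpow (2 * p) (\sum_k P k w)).
set B := \sum_k Ex Pr (fun w => trpow (2 * p) (P k w)).
set mu := trpow (2 * p) (\sum_k mxexpect Pr (P k)).
have F00 : 0 <= F0 by apply: Ex_ge0 => w; exact: trpow_ge0.
have B0 : 0 <= B by apply: sumr_ge0 => k _; apply: Ex_ge0 => w; exact: trpow_ge0.
have mu0 : 0 <= mu by exact: trpow_ge0.
(* The parameter s stays free until after the expectation; optimizing it then acts as a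
   Cauchy-Schwarz inequality. *)
have sq_bound : Ex Pr (fun w => trpow p (\sum_k P k w *m P k w)) <= Num.sqrt (F0 * B).
  apply: le_sqrt_of_forall => // s s0.
  have r1 := rintZ s iS; have r2 := rintZ s^-1 (rint_sum (index_enum 'I_n) iPk).
  have r3 := rintZ 2^-1 (rintD r1 r2).
  have pw w : trpow p (\sum_k P k w *m P k w) <= 2^-1 *
      (s * trpow (2 * p) (\sum_k P k w) + s^-1 * \sum_k trpow (2 * p) (P k w)).
    by rewrite mulrC; apply: trpow_sum_sq_le.
  have := le_Ex iS2 r3 pw; rewrite (ExZ _ (rintD r1 r2)) (ExD r1 r2) (ExZ _ iS).
  by rewrite (ExZ _ (rint_sum _ iPk)) (Ex_sum _ iPk) mulrC.
have hX := trpow_centered_sum_le hp hP iP.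
have hXs : herm_rv Pr (2 * p) (fun w => \sum_k (P k w - mxexpect Pr (P k))).
  apply: (@herm_rv_sum _ _ _ Pr d (2 * p) n
    (fun k w => P k w - mxexpect Pr (P k)) xpredT q1) => k.
  exact: herm_rvB q1 (hP k) (herm_rv_cst _ _ (hM k)).
set F := Ex Pr (fun w => trpow (2 * p) (\sum_k (P k w - mxexpect Pr (P k)))) in hX.
have F_0 : 0 <= F by apply: Ex_ge0 => w; exact: trpow_ge0.
have tri : F0 `^ (2 * p)^-1 <= F `^ (2 * p)^-1 + mu `^ (2 * p)^-1.
  have e w : \sum_k (P k w - mxexpect Pr (P k)) + \sum_k mxexpect Pr (P k) =
      \sum_k P k w.
    by rewrite -big_split; apply: eq_bigr => k _; rewrite /= subrK.
  have := minkowski_trpow q1 hXs (herm_rv_cst Pr (2 * p) hMs).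
  rewrite Ex_cst -/F -/mu; under eq_Ex do rewrite e.
  by [].
(* The root of order 2p turns (4p-2)^p into sqrt(4p-2), and sqrt(F0 B) into the product of the roots
   of order 4p. *)
have Fle : F `^ (2 * p)^-1 <= Num.sqrt (4 * p - 2) * (F0 `^ (4 * p)^-1 * B `^ (4 * p)^-1).
  have c0 : 0 <= 4 * p - 2 by lra.
  have le1 : F <= (4 * p - 2) `^ p * Num.sqrt (F0 * B).
    by apply: le_trans hX _; rewrite ler_wpM2l ?powR_ge0.
  apply: le_trans (powR_root_le q0 F_0 _ le1) _.
    by rewrite mulr_ge0 ?powR_ge0 ?sqrtr_ge0.
  rewrite powRM ?powR_ge0 ?sqrtr_ge0 // -powRrM -!powR12_sqrt ?mulr_ge0 //.
  rewrite -powRrM powRM //.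
  have -> : p * (2 * p)^-1 = 2^-1 by rewrite invfM mulrCA divff ?mulr1 // gt_eqF //; lra.
  rewrite (_ : 2^-1 * (2 * p)^-1 = (4 * p)^-1) // -invfM; congr (_^-1); ring.
rewrite -(@powR_sqrt_sq F0 (2 * p)) ?gt_eqF // ler_sqr ?nnegrE ?powR_ge0 //; last first.
  by rewrite addr_ge0 ?mulr_ge0 ?powR_ge0 ?sqrtr_ge0.
have e4 : 2 * (2 * p) = 4 * p by ring.
(* The unknown is x = F0^(1/(4p)): Minkowski gives x^2 <= m^2 + s x, where m^2 is the norm of the
   mean. *)
rewrite e4; apply: sq_le_sqrt_add; rewrite ?mulr_ge0 ?powR_ge0 ?sqrtr_ge0 //.
rewrite -e4 !powR_sqrt_sq ?gt_eqF // e4 addrC.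
apply: le_trans tri _; rewrite lerD2r -mulrA [B `^ _ * _]mulrC; exact: Fle.
Qed.

Lemma rosenthal_herm p n (Y : 'I_n -> T -> 'M[C]_d) :
  p = 1 \/ 3 / 2 <= p -> (forall k, herm_rv Pr (4 * p) (Y k)) ->
  (forall k, mxexpect Pr (Y k) = 0) -> mindep Pr (Y : 'I_n -> T -> cmx R d) ->
  Ex Pr (fun w => trpow (4 * p) (\sum_k Y k w)) `^ (4 * p)^-1 <=
  Num.sqrt (4 * p - 1) *
    trpow (2 * p) (\sum_k mxexpect Pr (fun w => Y k w *m Y k w)) `^ (4 * p)^-1 +
  (4 * p - 1) *
    (\sum_k Ex Pr (fun w => trpow (4 * p) (Y k w))) `^ (4 * p)^-1.
Proof.
move=> hp + EY iY; have p1 : 1 <= p by case: hp => [->|]; lra.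
have -> : 4 * p = 2 * (2 * p) by ring.
set q := 2 * p => hY.
(* The doubled exponent satisfies q >= 2, so it lies in the convex range even for p = 1. *)
have q32 : q = 1 \/ 3 / 2 <= q by right; rewrite /q; lra.
have q1 : 1 <= q by rewrite /q; lra.
have q0 : 0 < q by exact: lt_le_trans q1.
have qq1 : 1 <= 2 * q by rewrite /q; lra.
have hYY k : herm_rv Pr q (fun w => Y k w *m Y k w) by exact: herm_rv_sq (hY k).
have iYY k : mint Pr (fun w => Y k w *m Y k w) by exact: mint_sq q1 (hY k).
have hhY k w : Y k w \is hermsymmx by have [_ hh _] := hY k; exact: hh.
have hV k : mxexpect Pr (fun w => Y k w *m Y k w) \is hermsymmx.
  by apply: (mxexpect_herm (iYY k)) => w; exact: herm_sq.
set V := \sum_k mxexpect Pr (fun w => Y k w *m Y k w).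
have hVs : V \is hermsymmx by exact: herm_sum.
have hS : herm_rv Pr (2 * q) (fun w => \sum_k Y k w).
  exact: (@herm_rv_sum _ _ _ Pr d (2 * q) n Y xpredT qq1 hY).
have hSS : herm_rv Pr q (fun w => \sum_k Y k w *m Y k w).
  exact: (@herm_rv_sum _ _ _ Pr d q n (fun k w => Y k w *m Y k w) xpredT q1).
have hSV := herm_rvD q1 hSS (herm_rv_cst Pr q hVs).
have eS w : \sum_k (Y k w *m Y k w + mxexpect Pr (fun w => Y k w *m Y k w)) =
    \sum_k Y k w *m Y k w + V by rewrite big_split.
have bdg : Ex Pr (fun w => trpow (2 * q) (\sum_k Y k w)) <= (2 * q - 1) / 2 *
    Ex Pr (fun w => trR ((\sum_k Y k w *m Y k w + V) *m
      mxfun (hpow (2 * q - 2)) (\sum_k Y k w))).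
  by apply: le_trans (trpow_sum_indep_le q32 hY EY iY) _; under eq_Ex do rewrite eS.
have c0 : 0 <= (2 * q - 1) / 2 by rewrite divr_ge0 //; lra.
have {}bdg := young_absorb q1 c0 hS hSV bdg.
have mink := minkowski_trpow q1 hSS (herm_rv_cst Pr q hVs).
rewrite Ex_cst in mink.
have iYY2 : mindep Pr ((fun k w => Y k w *m Y k w) : 'I_n -> T -> cmx R d).
  apply: (mindep_comp (phi := fun k (A : cmx R d) => (A : 'M[C]_d) *m A)) iY => k.
  apply: (mmeasP _).2; apply: mmeasM; apply: (mmeasP _).1; exact: measurable_id.
have pYY k w : psdmx (Y k w *m Y k w) by exact: psd_sq (hhY k w).
(* Part (i) for the squares: tr (Y_k^2)^(2p) = tr |Y_k|^(4p), so its right side is already in the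
   terms of (ii). *)
have psd := rosenthal_psd hp hYY pYY iYY2.
have e1 : \sum_k Ex Pr (fun w => trpow (2 * p) (Y k w *m Y k w)) =
    \sum_k Ex Pr (fun w => trpow (2 * q) (Y k w)).
  by apply: eq_bigr => k _; apply: eq_Ex => w; exact: trpow_sq (hhY k w).
rewrite e1 -/q -/V (_ : 4 * p = 2 * q) in psd; last by rewrite /q; ring.
set F := Ex Pr (fun w => trpow (2 * q) _) in bdg *.
set G := Ex Pr (fun w => trpow q (\sum_k Y k w *m Y k w + V)) in bdg mink.
set H := Ex Pr (fun w => trpow q (\sum_k Y k w *m Y k w)) in mink psd.
set B := (\sum_k _) `^ _ in psd *.
have F0 : 0 <= F by apply: Ex_ge0 => w; exact: trpow_ge0.
have G0 : 0 <= G by apply: Ex_ge0 => w; exact: trpow_ge0.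
have v0 : 0 <= trpow q V by exact: trpow_ge0.
set al := trpow q V `^ (2 * q)^-1 in psd *.
have al0 : 0 <= al by exact: powR_ge0.
have B0 : 0 <= B by exact: powR_ge0.
(* The norm of V is written as the square of [al], to match the square on the right of (i). *)
rewrite -[trpow q V `^ q^-1]powR_sqrt_sq ?gt_eqF // -/al in mink.
have Fle : F `^ q^-1 <= (2 * q - 1) / 2 * G `^ q^-1.
  apply: le_trans (powR_root_le q0 F0 _ bdg) _; first by rewrite mulr_ge0 ?powR_ge0.
  by rewrite powRM ?powR_ge0 // -powRrM divff ?gt_eqF // powRr1.
rewrite -powR_sqrt_sq ?gt_eqF // in Fle.
have {}Fle := le_trans Fle (ler_wpM2l c0 (le_trans mink (lerD psd (lexx _)))).
rewrite -ler_sqr ?nnegrE ?powR_ge0 ?addr_ge0 ?mulr_ge0 ?sqrtr_ge0 //; last by lra.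
apply: le_trans Fle _.
have -> : 2 * q - 2 = 2 * q - 1 - 1 by ring.
by apply: half_sum_sq_le => //; lra.
Qed.

End rosenthal.

(** * Schatten norms *)

Section schatten_norm.
Context {R : realType} {d : nat}.
Local Notation C := R[i].
Implicit Types A : 'M[C]_d.

(** For Hermitian A the product A^* A is A^2, and the square root of x^2 is |x|. *)
Lemma schattenE q A : A \is hermsymmx -> schatten q A = trpow q A `^ q^-1.
Proof.
move=> hA; rewrite /schatten /mxpowR /mxabs /mxsqrt !hermfunE -trRE.
congr (_ `^ _); congr trR; rewrite (hermP _ hA) (mxfun_pow2 hA).
rewrite (mxfun_comp _ _ hA) (mxfun_comp _ _ hA); apply: eq_mxfun => x.
by rewrite /= -expr2 sqrtr_sqr.
Qed.

Lemma schatten_powR q A : 0 < q -> A \is hermsymmx -> schatten q A `^ q = trpow q A.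
Proof.
move=> q0 hA; rewrite schattenE // -powRrM mulVf ?gt_eqF // powRr1 //.
exact: trpow_ge0.
Qed.

Lemma trpow_mxsqrt q A : psdmx A -> trpow (2 * q) (mxsqrt A) = trpow q A.
Proof.
move=> pA; rewrite /trpow /mxsqrt hermfunE (mxfun_comp _ _ (psd_herm pA)).
congr trR; apply: eq_psd_mxfun => // x x0.
by rewrite /= ger0_norm ?sqrtr_ge0 // -powR12_sqrt // -powRrM mulrA mulVf ?mul1r //
  ger0_norm.
Qed.

End schatten_norm.

Section schatten_moments.
Context {R : realType} {dT : measure_display} {T : measurableType dT}.
Variable Pr : probability T R.
Context {d : nat}.
Local Notation C := R[i].

Lemma schatten_momentE q (X : T -> 'M[C]_d) : 0 < q ->
  (forall w, X w \is hermsymmx) ->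
  schatten_moment Pr q X = ('E_Pr[fun w => trpow q (X w)])%E.
Proof.
move=> q0 hX; rewrite /schatten_moment; congr ('E_Pr[_])%E.
by apply/funext => w; rewrite schatten_powR.
Qed.

Lemma schatten_momentEFin q (X : T -> 'M[C]_d) : 0 < q -> herm_rv Pr q X ->
  schatten_moment Pr q X = (Ex Pr (fun w => trpow q (X w)))%:E.
Proof. by move=> q0 [_ hX iX]; rewrite schatten_momentE // EFin_Ex. Qed.

Lemma schatten_moment_herm_rv q (X : {RV Pr >-> cmx R d}) : 0 < q ->
  (forall w, (X w : 'M[C]_d) \is hermsymmx) ->
  (schatten_moment Pr q X < +oo)%E -> herm_rv Pr q (X : T -> 'M[C]_d).
Proof.
move=> q0 hX oo.
have mX : mmeas (X : T -> 'M[C]_d) by apply: (mmeasP _).1; exact: measurable_funP.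
split => //; apply: rint_lty.
- by move=> w; exact: trpow_ge0.
- exact: measurable_trpow.
- by rewrite -schatten_momentE.
Qed.

End schatten_moments.

Theorem corollary7p4 (R : realType) (dT : measure_display)
    (T : measurableType dT) (Pr : probability T R) (d : nat) (p : R)
    (hp : p = 1 \/ 3 / 2 <= p) :
  (forall (n : nat) (P : 'I_n -> {RV Pr >-> cmx R d}),
    mutually_independent P ->
    (forall k w, psdmx (P k w)) ->
    (forall k, (schatten_moment Pr (2 * p) (P k) < +oo)%E) ->
    (schatten_moment Pr (2 * p) (fun w => (\sum_(k < n) (P k w : 'M[R[i]]_d))%R)
       `^ (2 * p)^-1
     <=
     ((schatten (2 * p) (\sum_(k < n) mxexpect Pr (P k)) `^ 2^-1)%:E
      + (Num.sqrt (4 * p - 2))%:E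
        * (\sum_(k < n) schatten_moment Pr (2 * p) (P k)) `^ (4 * p)^-1)
     ^+ 2)%E)
  /\
  (forall (n : nat) (Y : 'I_n -> {RV Pr >-> cmx R d}),
    mutually_independent Y ->
    (forall k w, (Y k w : 'M[R[i]]_d) \is hermsymmx) ->
    (forall k, mxexpect Pr (Y k) = 0) ->
    (forall k, (schatten_moment Pr (4 * p) (Y k) < +oo)%E) ->
    (schatten_moment Pr (4 * p) (fun w => (\sum_(k < n) (Y k w : 'M[R[i]]_d))%R)
       `^ (4 * p)^-1
     <=
     (Num.sqrt (4 * p - 1)
      * schatten (4 * p)
          (mxsqrt (\sum_(k < n)
             mxexpect Pr (fun w => (Y k w : 'M[R[i]]_d) *m Y k w))))%:E
     + (4 * p - 1)%:E
       * (\sum_(k < n) schatten_moment Pr (4 * p) (Y k)) `^ (4 * p)^-1)%E).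
Proof.
have p1 : 1 <= p by case: hp => [->|]; lra.
have [p20 p40] : 0 < 2 * p /\ 0 < 4 * p by split; lra.
split=> [n P iP pP ooP|n Y iY hY EY ooY].
  have hhP k w : (P k w : 'M[R[i]]_d) \is hermsymmx by exact: psd_herm (pP k w).
  have hP k : herm_rv Pr (2 * p) (P k : T -> 'M[R[i]]_d).
    exact: schatten_moment_herm_rv p20 (hhP k) (ooP k).
  have q1 : 1 <= 2 * p by lra.
  have hS : herm_rv Pr (2 * p) (fun w => \sum_(k < n) (P k w : 'M[R[i]]_d)).
    exact: (@herm_rv_sum _ _ _ Pr d (2 * p) n (fun k => P k : T -> 'M[R[i]]_d) xpredT q1 hP).
  have hM k : mxexpect Pr (P k) \is hermsymmx.
    by apply: (mxexpect_herm (mint_herm_rv q1 (hP k))) => w; exact: hhP.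
  rewrite (schatten_momentEFin p20 hS).
  have -> : (\sum_(k < n) schatten_moment Pr (2 * p) (P k) =
      (\sum_k Ex Pr (fun w => trpow (2 * p) (P k w : 'M[R[i]]_d)))%:E)%E.
    by rewrite -sumEFin; apply: eq_bigr => k _; exact: schatten_momentEFin p20 (hP k).
  rewrite !poweR_EFin -EFinM -EFinD -EFin_expe lee_fin.
  rewrite schattenE; last exact: herm_sum.
  rewrite -powRrM (_ : (2 * p)^-1 * 2^-1 = (4 * p)^-1); last first.
    by rewrite -invfM; congr (_^-1); ring.
  exact: (rosenthal_psd hp hP pP iP).
have hYk k : herm_rv Pr (4 * p) (Y k : T -> 'M[R[i]]_d).
  exact: schatten_moment_herm_rv p40 (hY k) (ooY k).
have q1 : 1 <= 4 * p by lra.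
have q21 : 1 <= 2 * p by lra.
have hS : herm_rv Pr (4 * p) (fun w => \sum_(k < n) (Y k w : 'M[R[i]]_d)).
  exact: (@herm_rv_sum _ _ _ Pr d (4 * p) n (fun k => Y k : T -> 'M[R[i]]_d) xpredT q1 hYk).
have e4 : 4 * p = 2 * (2 * p) by ring.
(* [Num.sqrt] sends negative numbers to 0, so positivity is what makes [mxsqrt] a true square root,
   with tr (V^(1/2))^(4p) = tr V^(2p). *)
have hV : psdmx (\sum_(k < n) mxexpect Pr (fun w => (Y k w : 'M[R[i]]_d) *m Y k w)).
  apply: psd_sum => k _; apply: mxexpect_psd => [|w]; last exact: psd_sq (hY k w).
  by apply: mint_sq q21 _; rewrite -e4; exact: hYk.
rewrite (schatten_momentEFin p40 hS).
have -> : (\sum_(k < n) schatten_moment Pr (4 * p) (Y k) =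
      (\sum_k Ex Pr (fun w => trpow (4 * p) (Y k w : 'M[R[i]]_d)))%:E)%E.
    by rewrite -sumEFin; apply: eq_bigr => k _; exact: schatten_momentEFin p40 (hYk k).
rewrite !poweR_EFin -EFinM -EFinD lee_fin.
rewrite schattenE; last by rewrite /mxsqrt hermfunE mxfun_herm.
rewrite [X in trpow X (mxsqrt _)]e4 (trpow_mxsqrt _ hV).
exact: (rosenthal_herm hp hYk EY iY).
Qed.
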